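(* Let $A\in C^\infty_{\mathbb R}(S^1)$. Then $$\dot Z_A=0\quad\Longleftrightarrow\quad A\in\operatorname{span}_{\mathbb R}\{1,\cos\theta,\sin\theta\}.$$ Thus the kernel of the map $A\mapsto\dot Z_A$ on $C^\infty_{\mathbb R}(S^1)$ (the differential before normalization) is exactly the space of infinitesimal Möbius transformations of $S^1$.
   Context: $H^{1/2}(S^1)$ is the Hilbert space of (classes modulo constants of) complex-valued functions $u$ on $S^1$ with $\|u\|_{H^{1/2}}^2=\sum_{n\ne0}|n||\widehat u(n)|^2<\infty$. $H^{1/2}_+$ and $H^{1/2}_-$ are the closed spans of $\{e^{in\theta}:n\ge1\}$ and $\{e^{-in\theta}:n\ge1\}$, with orthogonal projections $P_\pm$. For an orientation-preserving $C^\infty$ diffeomorphism $h$ of $S^1$, $V_hu=u\circ h$ is bounded and invertible on $H^{1/2}(S^1)$; put $A_h=P_+V_h|_{H^{1/2}_+}$, $B_h=P_-V_h|_{H^{1/2}_+}$. $A_h$ is an isomorphism of $H^{1/2}_+$ and $Z_h=B_hA_h^{-1}:H^{1/2}_+\to H^{1/2}_-$. A smooth path $h_t$ in $\mathrm{Diff}_+(S^1)$ (real $t$ near $0$, $h_0=\mathrm{id}$) has initial vector field $A\in C^\infty_{\mathbb R}(S^1)$ if, with angular lifts $h_t(e^{i\theta})=e^{i\varphi_t(\theta)}$, one has $\varphi_t(\theta)=\theta+tA(\theta)+o(t)$ in $C^\infty(S^1)$. For such a path the operator-norm derivative $\dot Z_A=\frac{d}{dt}\big|_{t=0}Z_{h_t}\in\mathrm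 B(H^{1/2}_+,H^{1/2}_-)$ (bounded linear operators) exists and depends only on $A$. The infinitesimal Möbius transformations of $S^1$ are the vector fields $A(\theta)\partial_\theta$ with $A\in\operatorname{span}_{\mathbb R}\{1,\cos\theta,\sin\theta\}$. *)

(* Defs.v *)
(* Functions on S^1 are 2 pi-periodic functions of the angle. An element of
   H^{1/2}(S^1), i.e. a class of functions modulo constants (and modulo null
   sets), is handled through its representatives: [eqH u v] says that u and v
   represent the same element, and operators act on representatives. *)
From HB Require Import structures.
From mathcomp Require Import all_boot all_order all_algebra.
From mathcomp Require Import all_classical all_reals all_analysis.
From mathcomp.real_closed Require Import complex.
Set Implicit Arguments.
Unset Strict Implicit.
Unset Printing Implicit Defensive.
Import Order.TTheory GRing.Theory Num.Theory.
Import numFieldNormedType.Exports.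
Local Open Scope classical_set_scope.
Local Open Scope ring_scope.
Local Open Scope complex_scope.

Section HalfSpace.
Variable R : realType.
Local Notation mu := (@lebesgue_measure R).

Definition Re_ (z : R[i]) : R := complex.Re z.
Definition Im_ (z : R[i]) : R := complex.Im z.
Definition absC2 (z : R[i]) : R := Re_ z ^+ 2 + Im_ z ^+ 2.

Definition expi (x : R) : R[i] := cos x +i* sin x.

Definition periodic2pi (T : Type) (u : R -> T) : Prop :=
  forall x, u (x + 2 * pi) = u x.

Definition circle_int (f : R -> R[i]) : R[i] :=
  (\int[mu]_(x in `[0, 2 * pi]) Re_ (f x))%R +i*
  (\int[mu]_(x in `[0, 2 * pi]) Im_ (f x))%R.

Definition fourier (u : R -> R[i]) (n : int) : R[i] :=
  ((2 * pi)^-1)%:C * circle_int (fun x => u x * expi (- (n%:~R * x))).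

Definition L2circle (u : R -> R[i]) : Prop :=
  [/\ periodic2pi u,
      measurable_fun setT (fun x => Re_ (u x)),
      measurable_fun setT (fun x => Im_ (u x)) &
      (\int[mu]_(x in `[0%R, (2 * pi)%R]) (absC2 (u x))%:E < +oo)%E].

(* The sums over n <> 0 group the indices n and - n. *)
Definition sqnormH (u : R -> R[i]) : \bar R :=
  (\sum_(1 <= n <oo)
     (n%:R * (absC2 (fourier u n%:Z) + absC2 (fourier u (- n%:Z))))%:E)%E.

Definition normH (u : R -> R[i]) : \bar R := sqrte (sqnormH u).

Definition Hhalf (u : R -> R[i]) : Prop :=
  L2circle u /\ (sqnormH u < +oo)%E.

Definition eqH (u v : R -> R[i]) : Prop :=
  exists c : R[i], {ae mu, forall x, u x = v x + c}.

Definition inner_term (u v : R -> R[i]) (n : nat) : R[i] :=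
  n%:R * (fourier u n%:Z * (fourier v n%:Z)^* +
          fourier u (- n%:Z) * (fourier v (- n%:Z))^*).

Definition innerH (u v : R -> R[i]) : R[i] :=
  limn (fun N => \sum_(1 <= n < N) Re_ (inner_term u v n)) +i*
  limn (fun N => \sum_(1 <= n < N) Im_ (inner_term u v n)).

Definition zero_fun : R -> R[i] := fun=> 0.
Definition add_fun (u v : R -> R[i]) : R -> R[i] := fun x => u x + v x.
Definition sub_fun (u v : R -> R[i]) : R -> R[i] := fun x => u x - v x.
Definition scale_fun (c : R[i]) (u : R -> R[i]) : R -> R[i] := fun x => c * u x.

Definition trigpoly_plus (N : nat) (c : nat -> R[i]) : R -> R[i] :=
  fun x => \sum_(1 <= n < N) c n * expi (n%:R * x).
Definition trigpoly_minus (N : nat) (c : nat -> R[i]) : R -> R[i] :=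
  fun x => \sum_(1 <= n < N) c n * expi (- (n%:R * x)).

Definition Hplus (u : R -> R[i]) : Prop :=
  Hhalf u /\ forall e : R, 0 < e ->
    exists N c, (normH (sub_fun u (trigpoly_plus N c)) < e%:E)%E.
Definition Hminus (u : R -> R[i]) : Prop :=
  Hhalf u /\ forall e : R, 0 < e ->
    exists N c, (normH (sub_fun u (trigpoly_minus N c)) < e%:E)%E.

Definition orth_proj (K : (R -> R[i]) -> Prop) (u : R -> R[i]) : R -> R[i] :=
  xget zero_fun
    [set v | K v /\ forall w, K w -> innerH (sub_fun u v) w = 0].
Definition Pplus := orth_proj Hplus.
Definition Pminus := orth_proj Hminus.

Definition smooth (f : R -> R) : Prop := forall k x, derivable (derive1n k f) x 1.

Definition smooth_circle (A : R -> R) : Prop := smooth A /\ periodic2pi A.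

(* f is an angular lift of an orientation-preserving smooth diffeomorphism
   of the circle: orientation is encoded by the sign of the 2 pi shift. *)
Definition diffeo_lift (f : R -> R) : Prop :=
  [/\ smooth f, forall x, f (x + 2 * pi) = f x + 2 * pi &
      exists g, [/\ smooth g, cancel f g & cancel g f]].

Definition Vop (f : R -> R) (u : R -> R[i]) : R -> R[i] := u \o f.
Definition Aop (f : R -> R) (u : R -> R[i]) : R -> R[i] := Pplus (Vop f u).
Definition Bop (f : R -> R) (u : R -> R[i]) : R -> R[i] := Pminus (Vop f u).
Definition Aop_inv (f : R -> R) (v : R -> R[i]) : R -> R[i] :=
  xget zero_fun [set u | Hplus u /\ eqH (Aop f u) v].
Definition Zop (f : R -> R) (v : R -> R[i]) : R -> R[i] :=
  Bop f (Aop_inv f v).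

(* Joint smoothness on ]-e, e[ x R: g i j is the mixed partial derivative
   d_t^i d_x^j of p. *)
Definition jointly_smooth (e : R) (p : R -> R -> R) : Prop :=
  exists g : nat -> nat -> R -> R -> R,
    g 0%N 0%N = p /\
    forall i j t x, `|t| < e ->
      [/\ {for (t, x), continuous (fun z : R * R => g i j z.1 z.2)},
          is_derive t 1 (fun s => g i j s x) (g i.+1 j t x) &
          is_derive x 1 (fun y => g i j t y) (g i j.+1 t x)].

(* p t is a lift of h_t; only the values for t near 0 matter. *)
Definition smooth_path (p : R -> R -> R) : Prop :=
  p 0 = id /\
  exists2 e : R, 0 < e &
    (forall t, `|t| < e -> diffeo_lift (p t)) /\ jointly_smooth e p.

Definition initial_field (p : R -> R -> R) (A : R -> R) : Prop :=
  forall (k : nat) (e : R), 0 < e ->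
    \forall t \near (0 : R), forall x,
      `| derive1n k (fun y => p t y - y - t * A y) x | <= e * `|t|.

(* An operator acts on representatives of elements of H^{1/2}_+; its values
   on other functions are irrelevant. *)
Definition operator := (R -> R[i]) -> (R -> R[i]).

Definition op_zero : operator := fun=> zero_fun.

Definition eq_op_plus (S T : operator) : Prop :=
  forall u, Hplus u -> eqH (S u) (T u).

Definition opnorm (T : operator) : \bar R :=
  ereal_sup [set normH (T u) | u in [set u | Hplus u /\ (normH u <= 1)%E]].

Definition bounded_plus_minus (T : operator) : Prop :=
  [/\ forall u, Hplus u -> Hminus (T u),
      forall u v, Hplus u -> Hplus v -> eqH u v -> eqH (T u) (T v),
      forall c u v, Hplus u -> Hplus v ->
        eqH (T (add_fun (scale_fun c u) v))
            (add_fun (scale_fun c (T u)) (T v)) &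
      (opnorm T < +oo)%E].

Definition Z_derivative (p : R -> R -> R) (D : operator) : Prop :=
  (fun t : R => opnorm (fun u =>
     sub_fun (scale_fun (t^-1)%:C (sub_fun (Zop (p t) u) (Zop (p 0) u)))
             (D u))) @ (0 : R)^' --> 0%E.

Definition is_Zdot (A : R -> R) (D : operator) : Prop :=
  bounded_plus_minus D /\
  forall p, smooth_path p -> initial_field p A -> Z_derivative p D.

Definition Zdot (A : R -> R) : operator := xget op_zero (is_Zdot A).

Definition inf_moebius : set (R -> R) :=
  [set A | exists a b c : R, forall x, A x = a + b * cos x + c * sin x].

End HalfSpace.

Arguments op_zero {R}.

(* Main.v *)
Require Import Defs.
From HB Require Import structures.
From mathcomp Require Import all_boot all_order all_algebra.
From mathcomp Require Import all_classical all_reals all_analysis.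
From mathcomp Require Import measurable_realfun.
From mathcomp.real_closed Require Import complex.
From mathcomp Require Import ring lra zify.
Set Implicit Arguments.
Unset Strict Implicit.
Unset Printing Implicit Defensive.
Import Order.TTheory GRing.Theory Num.Theory.
Import numFieldNormedType.Exports.
Local Open Scope classical_set_scope.
Local Open Scope ring_scope.
Local Open Scope complex_scope.

(** Everything is read on Fourier coefficients. Let [e_k] be the character of
    frequency [k] and [M_(m,k)] the coefficient at [m] of [e_k o h]. Modulo
    constants an element of H^{1/2}_+ is a sequence of coefficients at the
    frequencies [k >= 1] with finite weighted square sum ([HsgnP]). If [w] in
    H^{1/2}_+ solves [P_+ (w o h) = u], then [Z_h u = P_- (w o h)] ([Zop_spec]).

    The entries [M_(-m,k)] with [m, k >= 1], which mix the two signs, are means of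
    [exp i (k h(x) + m x)]. When [h] is at distance [d] from the identity in C^4,
    this phase is nonstationary and three integrations by parts bound the entry by
    a constant times [d / (m + k)^3] ([near_id_mixing]). Hence, first, [P_- (w o h)]
    is small, while invariance of the symplectic form
    [mean (f' conj f)] under substitution shows that [w o h] is bounded in terms of
    [w] and that [P_+ (w o h)] controls [w] ([comp_bounded], [comp_lower]).
    Secondly, [P_+ (w o h) = u] is solvable: with [g] the inverse of [h], put
    [w = (u + r) o g - b], where the antianalytic [b] is the fixed point of a
    contraction built from the mixing entries of [h] and [g]
    ([solve_analytic]); the entries for [g] are those for [h] transposed, up to a
    factor ([cmx_inverse]).

    Along a path [h_t] with initial field [A], the quotient [M_(-m,k) / t] tends to
    the entry [i k A^(-m-k)] of the operator [D : u |-> P_- (A u')], where [A^(n)]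
    is the coefficient of [A] at [n]. So [D] must be the derivative, and the point is convergence in operator norm. The difference
    quotient is computed from [w] and [D] from [u = P_+ (w o h_t)]; rewriting [D u]
    in terms of [w] gives an error matrix acting on the coefficients of [w]. Its
    entries tend to 0 one by one and are dominated by a multiple of [m^-2 l^-1].
    Therefore they are eventually at most [eps m^(-3/2) l^(-1/2)] simultaneously
    ([mixing_error_small]), and the Cauchy inequality bounds the operator norm
    ([error_opnorm], [Z_derivative_Dop]).

    For every smooth [A] the maps [x + t A(x)] are diffeomorphisms for small [t], so
    any derivative has the coefficients of [D] ([is_Zdot_coef]). It vanishes exactly
    when [A^(-N) = 0] for all [N >= 2] ([eq_op_zero_Dmx], [Dmx_zero]), which for a
    real function says that [A] has no frequency besides -1, 0 and 1
    ([fourier_inf_moebius]). *)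

(** * Complex numbers and complex-valued functions of a real variable *)
Notation normc := Normc.normc.

Section ComplexKit.
Variable R : realType.
Implicit Types (z w : R[i]) (f g : R -> R[i]).

Lemma normcE z : normc z = Num.sqrt (absC2 z).
Proof. by case: z. Qed.

Lemma normc_ge0 z : 0 <= normc z.
Proof. by rewrite normcE sqrtr_ge0. Qed.

Lemma absC2_ge0 z : 0 <= absC2 z.
Proof. by rewrite addr_ge0// sqr_ge0. Qed.

Lemma absC2E z : absC2 z = normc z ^+ 2.
Proof. by rewrite normcE sqr_sqrtr// absC2_ge0. Qed.

Lemma normc_conj z : normc (z^*) = normc z.
Proof. by rewrite !normcE; case: z => a b; rewrite /absC2/= sqrrN. Qed.

Lemma normc_real (x : R) : normc x%:C = `|x|.
Proof. by rewrite normcE /absC2/= expr0n addr0 sqrtr_sqr. Qed.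

Lemma normcX z n : normc (z ^+ n) = normc z ^+ n.
Proof.
elim: n => [|n IH]; first by rewrite !expr0 Normc.normc1.
by rewrite !exprS Normc.normcM IH.
Qed.

Lemma normc_nat n : normc (n%:R : R[i]) = n%:R.
Proof. by rewrite -(rmorph_nat (real_complex R)) normc_real ger0_norm. Qed.

Lemma normc_i : normc ('i : R[i]) = 1.
Proof. by rewrite normcE /absC2 /= expr0n expr1n add0r sqrtr1. Qed.

Lemma normc_eq0P z : (normc z <= 0) -> z = 0.
Proof.
by move=> h; apply: Normc.eq0_normc; apply/eqP; rewrite eq_le h normc_ge0.
Qed.

Lemma normcB z w : normc (z - w) <= normc z + normc w.
Proof. by rewrite -(normcN w); apply: le_normcD. Qed.

Lemma normc_sum (I : Type) (r : seq I) (P : pred I) (F : I -> R[i]) :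
  normc (\sum_(i <- r | P i) F i) <= \sum_(i <- r | P i) normc (F i).
Proof.
elim/big_ind2: _ => //; first by rewrite Normc.normc0.
by move=> z1 x1 z2 x2 h1 h2; apply: (le_trans (le_normcD _ _)); apply: lerD.
Qed.

Lemma Re_le_normc z : `|Re_ z| <= normc z.
Proof.
by rewrite normcE -sqrtr_sqr ler_wsqrtr// lerDl sqr_ge0.
Qed.

Lemma Im_le_normc z : `|Im_ z| <= normc z.
Proof.
by rewrite normcE -sqrtr_sqr ler_wsqrtr// lerDr sqr_ge0.
Qed.

Lemma normc_le_ReIm z : normc z <= `|Re_ z| + `|Im_ z|.
Proof.
rewrite normcE -(@ler_pXn2r _ 2) ?nnegrE ?addr_ge0 ?sqrtr_ge0//.
rewrite sqr_sqrtr ?absC2_ge0// sqrrD !real_normK ?num_real// addrAC lerDl.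
by rewrite mulrn_wge0// mulr_ge0.
Qed.

Lemma Re_D z w : Re_ (z + w) = Re_ z + Re_ w. Proof. by case: z; case: w. Qed.
Lemma Im_D z w : Im_ (z + w) = Im_ z + Im_ w. Proof. by case: z; case: w. Qed.
Lemma Re_N z : Re_ (- z) = - Re_ z. Proof. by case: z. Qed.
Lemma Im_N z : Im_ (- z) = - Im_ z. Proof. by case: z. Qed.
Lemma Re_M z w : Re_ (z * w) = Re_ z * Re_ w - Im_ z * Im_ w.
Proof. by case: z; case: w. Qed.
Lemma Im_M z w : Im_ (z * w) = Re_ z * Im_ w + Im_ z * Re_ w.
Proof. by case: z; case: w. Qed.
Definition ReImE := (Re_D, Im_D, Re_N, Im_N, Re_M, Im_M).

Lemma complex_ext z w : Re_ z = Re_ w -> Im_ z = Im_ w -> z = w.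
Proof. by case: z => a b; case: w => c d /= -> ->. Qed.

Lemma expiD (x y : R) : expi (x + y) = expi x * expi y.
Proof.
apply: complex_ext; rewrite ReImE /=; first by rewrite cosD.
by rewrite sinD addrC.
Qed.

Lemma expi0 : expi (0 : R) = 1.
Proof. by apply: complex_ext; rewrite /= ?cos0 ?sin0. Qed.

Lemma normc_expi (x : R) : normc (expi x) = 1.
Proof. by rewrite normcE /absC2/= cos2Dsin2 sqrtr1. Qed.

Lemma expiN (x : R) : expi (- x) = (expi x)^*.
Proof. by apply: complex_ext; rewrite /= ?cosN ?sinN. Qed.

Lemma expi_periodic (x : R) (n : int) : expi (x + n%:~R * (2 * pi)) = expi x.
Proof.
have h (k : nat) (y : R) : expi (y + k%:R * (2 * pi)) = expi y.
  elim: k y => [|k IH] y; first by rewrite mul0r addr0.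
  rewrite -natr1 mulrDl mul1r addrA expiD IH -[RHS]mulr1; congr (_ * _).
  rewrite mulrC.
  by apply: complex_ext => /=; rewrite mulr_natr ?cos2pi ?sin2pi.
case: n => n; first by rewrite -pmulrn h.
by rewrite NegzE mulrNz -pmulrn -{2}(subrK (n.+1%:R * (2 * pi)) x) mulNr h.
Qed.

Definition cderiv f f' := forall x : R,
  is_derive x 1 (fun y => Re_ (f y)) (Re_ (f' x)) /\
  is_derive x 1 (fun y => Im_ (f y)) (Im_ (f' x)).

Definition ccont f :=
  continuous (fun y => Re_ (f y)) /\ continuous (fun y => Im_ (f y)).

Lemma is_derive_cont (f f' : R -> R) :
  (forall x : R, is_derive x 1 f (f' x)) -> continuous f.
Proof.
by move=> h x; apply/differentiable_continuous/derivable1_diffP; case: (h x).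
Qed.

Lemma cderiv_cont f f' : cderiv f f' -> ccont f.
Proof.
by move=> h; split; [apply: (@is_derive_cont _ (fun x => Re_ (f' x)))
                    |apply: (@is_derive_cont _ (fun x => Im_ (f' x)))];
  move=> x; case: (h x).
Qed.

Lemma cderivM f g f' g' : cderiv f f' -> cderiv g g' ->
  cderiv (fun x => f x * g x) (fun x => f' x * g x + f x * g' x).
Proof.
move=> hf hg x; have [hf1 hf2] := hf x; have [hg1 hg2] := hg x; split.
  under [X in is_derive _ _ X _]eq_fun do rewrite Re_M.
  apply: is_derive_eq; rewrite !ReImE /GRing.scale/=; ring.
under [X in is_derive _ _ X _]eq_fun do rewrite Im_M.
apply: is_derive_eq; rewrite !ReImE /GRing.scale/=; ring.
Qed.

Lemma cderivD f g f' g' : cderiv f f' -> cderiv g g' ->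
  cderiv (fun x => f x + g x) (fun x => f' x + g' x).
Proof.
move=> hf hg x; have [hf1 hf2] := hf x; have [hg1 hg2] := hg x; split.
  under [X in is_derive _ _ X _]eq_fun do rewrite Re_D.
  by apply: is_derive_eq; rewrite !ReImE.
under [X in is_derive _ _ X _]eq_fun do rewrite Im_D.
by apply: is_derive_eq; rewrite !ReImE.
Qed.

Lemma cderiv_cst (c : R[i]) : cderiv (fun=> c) (fun=> 0).
Proof. by move=> x; split; apply: is_derive_eq. Qed.

Lemma cderivZ (c : R[i]) f f' : cderiv f f' ->
  cderiv (fun x => c * f x) (fun x => c * f' x).
Proof.
move=> hf; have := cderivM (cderiv_cst c) hf.
by under [X in cderiv _ X -> _]eq_fun do rewrite mul0r add0r.
Qed.

Lemma cderiv_real (a a' : R -> R) : (forall x : R, is_derive x 1 a (a' x)) ->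
  cderiv (fun x => (a x)%:C) (fun x => (a' x)%:C).
Proof. by move=> h x; split => //=; apply: is_derive_eq. Qed.

Lemma cderiv_expi (p p' : R -> R) : (forall x : R, is_derive x 1 p (p' x)) ->
  cderiv (fun x => expi (p x)) (fun x => 'i * (p' x)%:C * expi (p x)).
Proof.
move=> h x; split => /=.
  by apply: (is_derive_eq (is_derive1_comp (is_derive_cos (p x)) (h x))); ring.
by apply: (is_derive_eq (is_derive1_comp (is_derive_sin (p x)) (h x))); ring.
Qed.

Lemma ccontM f g : ccont f -> ccont g -> ccont (fun x => f x * g x).
Proof.
move=> [f1 f2] [g1 g2]; split => x.
  under eq_fun do rewrite Re_M.
  by apply: cvgB; apply: cvgM; [apply: f1|apply: g1|apply: f2|apply: g2].
under eq_fun do rewrite Im_M.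
by apply: cvgD; apply: cvgM; [apply: f1|apply: g2|apply: f2|apply: g1].
Qed.

Lemma ccontD f g : ccont f -> ccont g -> ccont (fun x => f x + g x).
Proof.
move=> [f1 f2] [g1 g2]; split => x.
  by under eq_fun do rewrite Re_D; apply: cvgD; [apply: f1|apply: g1].
by under eq_fun do rewrite Im_D; apply: cvgD; [apply: f2|apply: g2].
Qed.

Lemma ccont_cst (c : R[i]) : ccont (fun=> c).
Proof. by split => x; apply: cvg_cst. Qed.

Lemma ccont_real (a : R -> R) : continuous a -> ccont (fun x => (a x)%:C).
Proof. by move=> h; split => //= x; apply: cvg_cst. Qed.

Lemma ccont_expi (p : R -> R) : continuous p -> ccont (fun x => expi (p x)).
Proof.
move=> h; split => x /=.
  by apply: continuous_comp; [apply: h|apply: continuous_cos].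
by apply: continuous_comp; [apply: h|apply: continuous_sin].
Qed.

Lemma ccont_comp f (p : R -> R) : ccont f -> continuous p ->
  ccont (fun x => f (p x)).
Proof.
move=> [f1 f2] h; split => x /=.
  exact: (continuous_comp (h x) (f1 (p x))).
exact: (continuous_comp (h x) (f2 (p x))).
Qed.

Lemma ccontN f : ccont f -> ccont (fun x => - f x).
Proof.
move=> [f1 f2]; split => x.
  by under eq_fun do rewrite Re_N; apply: cvgN; apply: f1.
by under eq_fun do rewrite Im_N; apply: cvgN; apply: f2.
Qed.

Lemma ccont_sum (I : Type) (r : seq I) (F : I -> R -> R[i]) :
  (forall i, ccont (F i)) -> ccont (fun x => \sum_(i <- r) F i x).
Proof.
move=> h; elim: r => [|i r IH].
  by under eq_fun do rewrite big_nil; apply: ccont_cst.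
by under eq_fun do rewrite big_cons; apply: ccontD.
Qed.

Implicit Types (s : nat -> R[i]) (l : R[i]).

Definition ccvg (s : nat -> R[i]) (l : R[i]) := forall e : R, 0 < e ->
  exists N0, forall N, (N0 <= N)%N -> normc (s N - l) <= e.

Lemma ccvg_unique s l l' : ccvg s l -> ccvg s l' -> l = l'.
Proof.
move=> h h'; apply/eqP; rewrite -subr_eq0; apply/eqP; apply: normc_eq0P.
apply/ler_addgt0Pr => e e0; rewrite add0r.
have e2 : 0 < e / 2 by rewrite divr_gt0.
have [N1 h1] := h _ e2; have [N2 h2] := h' _ e2.
have := h1 (maxn N1 N2) (leq_maxl _ _); have := h2 (maxn N1 N2) (leq_maxr _ _).
set N := maxn _ _ => a b.
have -> : l - l' = (s N - l') - (s N - l) by ring.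
apply: (le_trans (normcB _ _)); rewrite [e in _ <= e](splitr e).
by apply: lerD; [apply: a|apply: b].
Qed.

Lemma ccvgD s l s' l' : ccvg s l -> ccvg s' l' ->
  ccvg (fun N => s N + s' N) (l + l').
Proof.
move=> h h' e e0.
have e2 : 0 < e / 2 by rewrite divr_gt0.
have [N1 h1] := h _ e2; have [N2 h2] := h' _ e2.
exists (maxn N1 N2) => N; rewrite geq_max => /andP[/h1 a /h2 b].
have -> : s N + s' N - (l + l') = (s N - l) + (s' N - l') by ring.
by apply: (le_trans (le_normcD _ _)); rewrite [e in _ <= e](splitr e) lerD.
Qed.

Lemma ccvgZ (c : R[i]) s l : ccvg s l -> ccvg (fun N => c * s N) (c * l).
Proof.
move=> h e e0.
have c0 : 0 < normc c + 1 by rewrite ltr_wpDl ?normc_ge0.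
have [N1 h1] := h _ (divr_gt0 e0 c0).
exists N1 => N /h1 a; rewrite -mulrBr Normc.normcM.
apply: (@le_trans _ _ ((normc c + 1) * (e / (normc c + 1)))).
  by apply: ler_pM; rewrite ?normc_ge0 ?lerDl.
by rewrite mulrC divfK ?gt_eqF.
Qed.

Lemma ccvg_cst (c : R[i]) : ccvg (fun=> c) c.
Proof. by move=> e e0; exists 0%N => N _; rewrite subrr Normc.normc0 ltW. Qed.

Lemma ccvg_ext s s' l : (forall N, s N = s' N) -> ccvg s l -> ccvg s' l.
Proof. by move=> /funext ->. Qed.

Lemma ccvg_le s l (b : R) N1 : ccvg s l ->
  (forall N, (N1 <= N)%N -> normc (s N) <= b) -> normc l <= b.
Proof.
move=> h hb; apply/ler_addgt0Pr => e e0.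
have [N0 h0] := h e e0.
have a := h0 (maxn N0 N1) (leq_maxl _ _); have b' := hb (maxn N0 N1) (leq_maxr _ _).
have -> : l = s (maxn N0 N1) - (s (maxn N0 N1) - l) by ring.
by apply: (le_trans (normcB _ _)); apply: lerD.
Qed.

Lemma ccvg_squeeze s l (r : R) : 0 <= r ->
  (forall N, (0 < N)%N -> normc (s N - l) <= r / N%:R) -> ccvg s l.
Proof.
move=> r0 h e e0; exists (Num.truncn (r / e)).+1 => N hN.
have N0 : (0 < N)%N by apply: leq_trans hN.
apply: (le_trans (h N N0)); rewrite ler_pdivrMr ?ltr0n// mulrC -ler_pdivrMr//.
by apply: ltW; apply: (lt_le_trans (Num.Theory.truncnS_gt _)); rewrite ler_nat.
Qed.

End ComplexKit.

(** * Integration over one period *)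
Section CircleIntegral.
Variable R : realType.
Local Notation mu := (@lebesgue_measure R).
Local Notation D0 := (`[(0:R), (2 * pi)%R]%classic).
Implicit Types (f g : R -> R[i]) (a b : R).

Lemma twopi_gt0 : 0 < 2 * pi :> R.
Proof. by rewrite mulr_gt0// pi_gt0. Qed.

Definition integrable_on_period (f : R -> R) := mu.-integrable D0 (EFin \o f).

Definition cintegrable f :=
  integrable_on_period (fun x => Re_ (f x)) /\
  integrable_on_period (fun x => Im_ (f x)).

Lemma continuous_integrable (f : R -> R) a b : continuous f ->
  mu.-integrable `[a, b] (EFin \o f).
Proof.
move=> cf; apply: continuous_compact_integrable; first exact: segment_compact.
exact: continuous_subspaceT.
Qed.

Lemma ccont_cintegrable f : ccont f -> cintegrable f.
Proof. by move=> [h1 h2]; split; apply: continuous_integrable. Qed.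

Lemma continuous_bounded_segment (f : R -> R) a b : continuous f ->
  exists2 M, 0 < M & forall x, a <= x <= b -> `|f x| <= M.
Proof.
move=> cf.
have /compact_bounded[M [_ hM]] : compact (f @` `[a, b]).
  by apply: continuous_compact; [exact: continuous_subspaceT|exact: segment_compact].
exists (`|M| + 1); first by rewrite ltr_wpDl.
move=> x xab; apply: (hM (`|M| + 1)); first by rewrite (le_lt_trans (ler_norm _))// ltrDl.
by exists x => //=; rewrite in_itv.
Qed.

Lemma integrableM_continuous (f g : R -> R) a b :
  mu.-integrable `[a, b] (EFin \o f) -> continuous g ->
  mu.-integrable `[a, b] (EFin \o (fun x => f x * g x)).
Proof.
move=> fi cg; have [M M0 hM] := continuous_bounded_segment a b cg.
have := @integrableMl _ _ _ mu `[a, b]%classic (measurable_itv _) (EFin \o f) g fi.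
apply; first by apply: measurable_funTS; exact: continuous_measurable_fun.
exists M; split; first exact: num_real.
move=> M' MM' x /=; rewrite in_itv /= => /hM; move/le_trans; apply; exact: ltW.
Qed.

Lemma FTC_global (F f : R -> R) a b : a <= b ->
  (forall x : R, is_derive x 1 F (f x)) -> continuous f ->
  (\int[mu]_(x in `[a, b]) (f x)%:E = (F b - F a)%:E)%E.
Proof.
rewrite le_eqVlt => /predU1P[->|ab] dF cf.
  by rewrite set_itv1 integral_set1 subrr.
have cF := is_derive_cont dF.
rewrite (@continuous_FTC2 _ f F)//.
- exact: continuous_subspaceT.
- split; first by move=> x _; case: (dF x).
    by apply: cvg_at_right_filter; apply: cF.
  by apply: cvg_at_left_filter; apply: cF.
- by move=> x _; rewrite derive1E; case: (dF x).
Qed.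

Section ChangeOfVariables.
Variables (h hp g : R -> R).
Hypothesis dh : forall x : R, is_derive x 1 h (hp x).
Hypothesis chp : continuous hp.
Hypothesis hp_ge0 : forall x, 0 <= hp x.
Hypothesis h_mono : {mono h : x y / x <= y}.
Hypothesis ghK : cancel g h.

Let mh : measurable_fun [set: measurableTypeR R] (h : measurableTypeR R -> measurableTypeR R).
Proof. by apply: continuous_measurable_fun; apply: is_derive_cont dh. Qed.

Let mhp : measurable_fun [set: measurableTypeR R] (hp : measurableTypeR R -> R).
Proof. exact: continuous_measurable_fun. Qed.

Let mcomp (k : measurableTypeR R -> R) : measurable_fun setT k ->
  measurable_fun [set: measurableTypeR R] (fun x => k (h x)).
Proof. by move=> mk; apply: measurableT_comp. Qed.

Definition pulled_measure (E : set (measurableTypeR R)) : \bar R :=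
  (\int[mu]_(x in h @^-1` E) (hp x)%:E)%E.

Let mpre (E : set (measurableTypeR R)) : measurable E ->
  measurable (h @^-1` E : set (measurableTypeR R)).
Proof. by move=> mE; rewrite -[X in measurable X]setTI; apply: mh. Qed.

Let pulled0 : pulled_measure set0 = 0%E.
Proof. by rewrite /pulled_measure preimage_set0 integral_set0. Qed.

Let pulled_ge0 E : (0 <= pulled_measure E)%E.
Proof. by apply: integral_ge0 => x _; rewrite lee_fin. Qed.

Let pulled_sadd : semi_sigma_additive pulled_measure.
Proof.
move=> /= F mF tF mUF; rewrite /pulled_measure; apply: cvg_toP.
  apply: ereal_nondecreasing_is_cvgn => m n mn.
  by apply: lee_sum_nneg_natr => // k _ _; apply: pulled_ge0.
rewrite preimage_bigcup ge0_integral_bigcup//=.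
- by move=> k; apply: mpre.
- by apply: measurable_funTS; exact/measurable_EFinP.
- by move=> x _; rewrite lee_fin.
- by apply/trivIsetP => /= i j _ _ ij; rewrite -preimage_setI; move/trivIsetP : tF => ->//; rewrite preimage_set0.
Qed.

HB.instance Definition _ := isMeasure.Build _ _ _ pulled_measure
  pulled0 pulled_ge0 pulled_sadd.

(** By the fundamental theorem of calculus both measures give a half-open
    interval its length, and these values characterize Lebesgue measure. *)
Lemma pulled_measureE (E : set (measurableTypeR R)) : measurable E ->
  mu E = pulled_measure E.
Proof.
apply: lebesgue_measure_unique => _ [[c d] _ <-] /=.
rewrite lebesgue_measure_itv /= lte_fin /pulled_measure.
have gE : h @^-1` (`]c, d]%classic : set R) = `]g c, g d]%classic.
  apply/seteqP; split => x /=; rewrite !in_itv /= !ltNge.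
    by rewrite -[in X in X -> _](ghK c) -[in X in X -> _](ghK d) !h_mono.
  by rewrite -[in X in _ -> X](ghK c) -[in X in _ -> X](ghK d) !h_mono.
rewrite gE integral_itv_obnd_cbnd; last first.
  by apply: measurable_funTS; exact/measurable_EFinP.
case: ltP => cd.
  by rewrite (FTC_global _ dh chp) ?ghK// -h_mono !ghK ltW.
move: cd; rewrite le_eqVlt => /predU1P[->|cd].
  by rewrite set_itv1 integral_set1.
rewrite set_itv_ge ?integral_set0//= bnd_simp -ltNge ltNge -h_mono !ghK -ltNge//.
Qed.

Import HBNNSimple.

Let cov_indic (E : set (measurableTypeR R)) : measurable E ->
  (\int[mu]_x (\1_E x)%:E = \int[mu]_x (\1_E (h x) * hp x)%:E)%E.
Proof.
move=> mE; rewrite integral_indic// setIT [LHS](pulled_measureE mE) /pulled_measure.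
rewrite integral_mkcond; apply: eq_integral => x _.
rewrite patchE indicE; case: ifPn => hx.
  by rewrite (_ : h x \in E) ?mul1r//; move: hx; rewrite !inE.
by rewrite (_ : (h x \in E) = false) ?mul0r//; apply: contraNF hx; rewrite !inE.
Qed.

Let cov_nnsfun (f : {nnsfun (measurableTypeR R) >-> R}) :
  (\int[mu]_x (f x)%:E = \int[mu]_x (f (h x) * hp x)%:E)%E.
Proof.
under [LHS]eq_integral do rewrite fimfunE -fsumEFin//.
rewrite [LHS]ge0_integral_fsum//; last 2 first.
  - by move=> r; exact/measurable_EFinP/measurableT_comp.
  - by move=> n x _; rewrite EFinM nnfun_muleindic_ge0.
under [RHS]eq_integral.
  move=> x xD; rewrite fimfunE EFinM -fsumEFin// ge0_mule_fsuml; last first.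
    by move=> r; rewrite EFinM nnfun_muleindic_ge0.
  over.
rewrite [RHS]ge0_integral_fsum//; last 2 first.
  - move=> r; apply/emeasurable_funM; apply/measurable_EFinP => //.
    apply: measurable_funM => //.
    by apply: (mcomp (k := \1_(f @^-1` [set r]))).
  - move=> n x _; apply: mule_ge0; rewrite lee_fin//.
    by have := nnfun_muleindic_ge0 f n (h x); rewrite -EFinM lee_fin.
apply: eq_fsbigr => r /set_mem[y _ fy].
have r0 : 0 <= r by rewrite -fy.
under eq_integral do rewrite EFinM.
rewrite ge0_integralZl//; last by apply/measurable_EFinP; apply: measurable_indic.
rewrite cov_indic// -ge0_integralZl//.
- by apply: eq_integral => x _; rewrite -!EFinM mulrA.
- apply/measurable_EFinP; apply: measurable_funM => //.
  by apply: (mcomp (k := \1_(f @^-1` [set r]))).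
- by move=> x _; rewrite lee_fin mulr_ge0.
Qed.

(** [pulled_measureE] is the case of indicators; simple functions and monotone
    limits reduce to it. *)
Lemma change_of_variables_ge0 (f : R -> \bar R) :
  @measurable_fun _ _ (measurableTypeR R) _ setT f -> (forall x, 0 <= f x)%E ->
  (\int[mu]_x f x = \int[mu]_x (f (h x) * (hp x)%:E))%E.
Proof.
move=> mf f0.
pose f_ := nnsfun_approx measurableT mf.
transitivity (limn (fun n => \int[mu]_x (f_ n x)%:E))%E.
  rewrite -monotone_convergence//=.
  - apply: eq_integral => ? /[!inE] xD; apply/esym/cvg_lim => //=.
    exact: cvg_nnsfun_approx.
  - by move=> n; exact/measurable_EFinP/measurable_funTS.
  - by move=> n ? _; rewrite lee_fin.
  - by move=> ? _ ? ? mn; rewrite lee_fin; exact/lefP/nd_nnsfun_approx.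
under eq_fun do rewrite cov_nnsfun.
rewrite -monotone_convergence//=.
- apply: eq_integral => x _.
  under eq_fun do rewrite EFinM.
  apply/cvg_lim => //; apply: cvgeZr => //.
  exact: cvg_nnsfun_approx.
- move=> n; apply/measurable_EFinP/measurable_funM => //.
  by apply: (mcomp (k := f_ n)).
- by move=> n x _; rewrite lee_fin mulr_ge0.
- move=> x _ m n mn; rewrite lee_fin ler_wpM2r//.
  by have /lefP := nd_nnsfun_approx measurableT mf mn.
Qed.

Lemma change_of_variables_itv (f : R -> R) a b :
  measurable_fun [set: R] f -> (forall x, 0 <= f x) ->
  (\int[mu]_(x in `[h a, h b]) (f x)%:E =
   \int[mu]_(x in `[a, b]) (f (h x) * hp x)%:E)%E.
Proof.
move=> mf f0; rewrite integral_mkcond [RHS]integral_mkcond.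
rewrite change_of_variables_ge0.
- apply: eq_integral => x _; rewrite !patchE.
  have -> : (h x \in (`[h a, h b]%classic : set R)) = (x \in (`[a, b]%classic : set R)).
    by apply/idP/idP; rewrite !inE /= !in_itv /= !h_mono.
  by case: ifP => _; rewrite ?mul0e// EFinM.
- apply/(measurable_restrictT _ _).1 => //.
  by apply/measurable_EFinP; apply: measurable_funTS.
- by move=> x; rewrite patchE; case: ifP => // _; rewrite lee_fin.
Qed.

End ChangeOfVariables.

Lemma ge0_integral_split (f : R -> R) a b c : a <= b -> b <= c ->
  measurable_fun [set: R] f -> (forall x, 0 <= f x) ->
  (\int[mu]_(x in `[a, c]) (f x)%:E =
   \int[mu]_(x in `[a, b]) (f x)%:E + \int[mu]_(x in `[b, c]) (f x)%:E)%E.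
Proof.
move=> ab bc mf f0.
have mE (A : set R) : measurable_fun A (fun x => (f x)%:E).
  by apply: measurable_funTS; exact/measurable_EFinP.
rewrite -(@integral_itv_obnd_cbnd _ b).
  rewrite -ge0_integral_setU//=.
  - by rewrite -itv_bndbnd_setU// bnd_simp.
  - exact: mE.
  - by move=> x _; rewrite lee_fin.
  - by rewrite disj_set2E; apply/eqP/seteqP; split=> x //= []; rewrite !in_itv/= => /andP[_ xb] /andP[/lt_le_trans/(_ xb)]; rewrite ltxx.
exact: mE.
Qed.

Lemma ge0_integral_shift (f : R -> R) a b c :
  measurable_fun [set: R] f -> (forall x, 0 <= f x) ->
  (\int[mu]_(x in `[(a + c)%R, (b + c)%R]) (f x)%:E =
   \int[mu]_(x in `[a, b]) (f (x + c)%R)%:E)%E.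
Proof.
move=> mf f0.
have dx (x : R) : is_derive x 1 (fun y : R => y + c) 1.
  by apply: is_derive_eq; rewrite addr0.
rewrite (@change_of_variables_itv _ (fun=> 1) (fun x => x - c) dx)//.
- by apply: eq_integral => x _; rewrite mulr1.
- exact: cst_continuous.
- by move=> x y; rewrite lerD2r.
- by move=> x; rewrite subrK.
Qed.

Lemma periodic_shift (T : Type) (u : R -> T) (k : int) x : periodic2pi u ->
  u (x + k%:~R * (2 * pi)) = u x.
Proof.
move=> pu.
have h (n : nat) (y : R) : u (y + n%:R * (2 * pi)) = u y.
  elim: n y => [|n IH] y; first by rewrite mul0r addr0.
  by rewrite -natr1 mulrDl mul1r addrA pu IH.
case: k => n; first by rewrite -pmulrn h.
by rewrite NegzE mulrNz -pmulrn -[LHS](h n.+1) mulNr subrK.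
Qed.

(** Translate by a multiple of the period until the interval starts in the base
    period, then move the overhang back to the front. *)
Lemma ge0_integral_period (f : R -> R) a :
  measurable_fun [set: R] f -> (forall x, 0 <= f x) -> periodic2pi f ->
  (\int[mu]_(x in `[a, (a + 2 * pi)%R]) (f x)%:E = \int[mu]_(x in D0) (f x)%:E)%E.
Proof.
move=> mf f0 pf.
have pfz (k : int) x := periodic_shift k x pf.
pose k := Num.floor (a / (2 * pi)).
pose a0 := a - k%:~R * (2 * pi).
have a0_ge0 : 0 <= a0 by rewrite subr_ge0 -ler_pdivlMr ?twopi_gt0// floor_le.
have a0_le : a0 <= 2 * pi.
  rewrite lerBlDr -{1}[2 * pi]mul1r -mulrDl -ler_pdivrMr ?twopi_gt0//.
  by rewrite ltW// addrC -[1]/(1%:~R) -intrD floorD1_gt.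
have aE : a = a0 + k%:~R * (2 * pi) by rewrite subrK.
clearbody a0 k; subst a.
rewrite addrAC.
have := @ge0_integral_shift f a0 (a0 + 2 * pi) (k%:~R * (2 * pi)) mf f0; move=> ->.
under eq_integral do rewrite pfz.
rewrite (@ge0_integral_split _ _ (2 * pi)) ?lerDr//.
rewrite [in RHS](@ge0_integral_split _ _ a0)// addeC; congr (_ + _)%E.
have := @ge0_integral_shift f 0 a0 (2 * pi) mf f0; rewrite add0r => ->.
by apply: eq_integral => x _; rewrite pf.
Qed.

(** ** Lifts of circle diffeomorphisms as substitutions *)

(** Substitution in an integral needs the derivative of a lift to be continuous
    and positive, and no more. *)
Record lift (h hp g : R -> R) : Prop := Lift {
  lift_deriv : forall x : R, is_derive x 1 h (hp x);
  lift_cont : continuous hp;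
  lift_pos : forall x, 0 < hp x;
  lift_hgK : cancel h g;
  lift_ghK : cancel g h;
  lift_shift : forall x, h (x + 2 * pi) = h x + 2 * pi }.

Section LiftSubstitution.
Variables (h hp g : R -> R).
Hypothesis hl : lift h hp g.

Lemma lift_mono : {mono h : x y / x <= y}.
Proof.
have hlt x y : x < y -> h x < h y.
  move=> xy; have [|c _] := @MVT R h hp x y xy (fun z _ => lift_deriv hl z).
    by apply: continuous_subspaceT; exact: is_derive_cont (lift_deriv hl).
  by move=> e; rewrite -subr_gt0 e mulr_gt0 ?lift_pos// ?subr_gt0// (lift_pos hl).
by apply: le_mono => x y; apply: hlt.
Qed.

Lemma lift_deriv_periodic : periodic2pi hp.
Proof.
move=> x; have d1 := lift_deriv hl (x + 2 * pi).
have ds : is_derive x 1 (fun y : R => y + 2 * pi) 1.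
  by apply: is_derive_eq; rewrite addr0.
have := @is_derive1_comp _ h (fun y : R => y + 2 * pi) x _ _ d1 ds; rewrite mulr1 => -[_ <-].
have -> : h \o (fun y => y + 2 * pi) = (fun y => h y + 2 * pi).
  by apply/funext => y /=; exact: (lift_shift hl).
have : is_derive x 1 (fun y => h y + 2 * pi) (hp x).
  by have := lift_deriv hl x => dx; apply: is_derive_eq; rewrite addr0.
by case.
Qed.

Lemma lift_subst_ge0 (f : R -> R) :
  measurable_fun [set: R] f -> (forall x, 0 <= f x) -> periodic2pi f ->
  (\int[mu]_(x in D0) (f (h x) * hp x)%:E = \int[mu]_(x in D0) (f x)%:E)%E.
Proof.
move=> mf f0 pf.
rewrite -(change_of_variables_itv (lift_deriv hl) (lift_cont hl) _ lift_mono
  (lift_ghK hl))//; last by move=> x; exact: ltW (lift_pos hl x).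
by have := lift_shift hl 0; rewrite add0r => ->; rewrite ge0_integral_period.
Qed.

Lemma lift_measurable : measurable_fun [set: R] h.
Proof. by apply: continuous_measurable_fun; apply: is_derive_cont (lift_deriv hl). Qed.

(** The nonnegative case, on the positive and the negative part. *)
Lemma lift_subst (f : R -> R) :
  measurable_fun [set: R] f -> periodic2pi f -> integrable_on_period f ->
  integrable_on_period (fun x => f (h x) * hp x) /\
  \int[mu]_(x in D0) (f (h x) * hp x) = \int[mu]_(x in D0) f x.
Proof.
move=> mf pf fi.
have mhp : measurable_fun [set: R] hp by exact: continuous_measurable_fun (lift_cont hl).
have mfh : measurable_fun [set: R] (fun x => f (h x) * hp x).
  by apply: measurable_funM => //; apply: measurableT_comp => //; exact: lift_measurable.
have hp0 x : 0 <= hp x by exact: ltW (lift_pos hl x).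
split.
  apply/integrableP; split.
    by apply: measurable_funTS; exact/measurable_EFinP.
  have /integrableP[_] := fi; apply: le_lt_trans.
  rewrite -(@lift_subst_ge0 (fun x => `|f x|))//.
  - rewrite le_eqVlt; apply/orP; left; apply/eqP; apply: eq_integral => x _ /=.
    by rewrite normrM (ger0_norm (hp0 x)).
  - exact: measurableT_comp.
  - by move=> x; rewrite pf.
rewrite /Rintegral; congr fine; rewrite integralE [RHS]integralE; congr (_ - _)%E.
  under [RHS]eq_integral do rewrite funeposE /= -EFin_max.
  rewrite -(@lift_subst_ge0 (fun x => Num.max (f x) 0)).
  - apply: eq_integral => x _; rewrite funeposE /= -EFin_max; congr _%:E.
    by rewrite maxr_pMl// mul0r.
  - exact: measurable_maxr.
  - by move=> x; rewrite le_max lexx orbT.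
  - by move=> x; rewrite pf.
under [RHS]eq_integral do rewrite funenegE /= -EFin_max.
rewrite -(@lift_subst_ge0 (fun x => Num.max (- f x) 0)).
- apply: eq_integral => x _; rewrite funenegE /= -EFin_max; congr _%:E.
  by rewrite maxr_pMl// mul0r mulNr.
- by apply: measurable_maxr => //; exact: measurableT_comp.
- by move=> x; rewrite le_max lexx orbT.
- by move=> x; rewrite pf.
Qed.

End LiftSubstitution.

(** ** Linearity and size of the complex circle integral *)

Lemma cintegrableD f g : cintegrable f -> cintegrable g ->
  cintegrable (fun x => f x + g x).
Proof.
move=> [f1 f2] [g1 g2]; split; rewrite /integrable_on_period.
  apply: (@eq_integrable _ _ _ mu D0 (measurable_itv _)
    ((EFin \o (fun x => Re_ (f x))) \+ (EFin \o (fun x => Re_ (g x)))))%E.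
    by move=> x _ /=; rewrite Re_D EFinD.
  exact: integrableD.
apply: (@eq_integrable _ _ _ mu D0 (measurable_itv _)
    ((EFin \o (fun x => Im_ (f x))) \+ (EFin \o (fun x => Im_ (g x)))))%E.
  by move=> x _ /=; rewrite Im_D EFinD.
exact: integrableD.
Qed.

Lemma cintegrableM f g : cintegrable f -> ccont g ->
  cintegrable (fun x => f x * g x).
Proof.
move=> [f1 f2] [g1 g2]; split; rewrite /integrable_on_period.
  apply: (@eq_integrable _ _ _ mu D0 (measurable_itv _)
    ((EFin \o (fun x => Re_ (f x) * Re_ (g x)))%R \-
     (EFin \o (fun x => Im_ (f x) * Im_ (g x)))%R)%E).
    by move=> x _ /=; rewrite Re_M EFinB.
  by apply: integrableB => //; apply: integrableM_continuous.
apply: (@eq_integrable _ _ _ mu D0 (measurable_itv _)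
    ((EFin \o (fun x => Re_ (f x) * Im_ (g x)))%R \+
     (EFin \o (fun x => Im_ (f x) * Re_ (g x)))%R)%E).
  by move=> x _ /=; rewrite Im_M EFinD.
by apply: integrableD => //; apply: integrableM_continuous.
Qed.

Lemma cintegrableZ (c : R[i]) f : cintegrable f -> cintegrable (fun x => c * f x).
Proof.
move=> hf; have := cintegrableM hf (ccont_cst c).
by under eq_fun do rewrite mulrC.
Qed.

Lemma circle_intD f g : cintegrable f -> cintegrable g ->
  circle_int (fun x => f x + g x) = circle_int f + circle_int g.
Proof.
move=> [f1 f2] [g1 g2]; apply: complex_ext; rewrite ?Re_D ?Im_D /=.
  by under eq_Rintegral do rewrite Re_D; rewrite RintegralD.
by under eq_Rintegral do rewrite Im_D; rewrite RintegralD.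
Qed.

Lemma circle_intZ (c : R[i]) f : cintegrable f ->
  circle_int (fun x => c * f x) = c * circle_int f.
Proof.
move=> [f1 f2]; have hc (k : R) (F : R -> R) : mu.-integrable D0 (EFin \o F) ->
    mu.-integrable D0 (EFin \o (fun x => k * F x)).
  by move=> hF; have := @integrableZl _ _ _ mu _ (measurable_itv _) k _ hF; apply: eq_integrable.
apply: complex_ext; rewrite ?Re_M ?Im_M /=.
  under eq_Rintegral do rewrite Re_M.
  by rewrite RintegralB ?RintegralZl//; apply: hc.
under eq_Rintegral do rewrite Im_M.
by rewrite RintegralD ?RintegralZl//; apply: hc.
Qed.

Lemma circle_int0 : circle_int (fun=> 0 : R[i]) = 0.
Proof.
by apply: complex_ext; rewrite /= /Rintegral integral0_eq.
Qed.

Lemma cintegrable0 : cintegrable (fun=> 0).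
Proof. exact: ccont_cintegrable (ccont_cst 0). Qed.

Lemma cintegrable_sum (I : Type) (r : seq I) (F : I -> R -> R[i]) :
  (forall i, cintegrable (F i)) -> cintegrable (fun x => \sum_(i <- r) F i x).
Proof.
move=> h; elim: r => [|i r IH].
  by under eq_fun do rewrite big_nil; apply: cintegrable0.
by under eq_fun do rewrite big_cons; apply: cintegrableD.
Qed.

Lemma circle_int_sum (I : Type) (r : seq I) (F : I -> R -> R[i]) :
  (forall i, cintegrable (F i)) ->
  circle_int (fun x => \sum_(i <- r) F i x) = \sum_(i <- r) circle_int (F i).
Proof.
move=> h; elim: r => [|i r IH].
  by under eq_fun do rewrite big_nil; rewrite big_nil circle_int0.
under eq_fun do rewrite big_cons.
by rewrite big_cons circle_intD ?IH//; apply: cintegrable_sum.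
Qed.

Lemma cintegrableN f : cintegrable f -> cintegrable (fun x => - f x).
Proof. by move=> h; under eq_fun do rewrite -mulN1r; apply: cintegrableZ. Qed.

Lemma cintegrableB f g : cintegrable f -> cintegrable g ->
  cintegrable (fun x => f x - g x).
Proof. by move=> h1 h2; apply: cintegrableD => //; apply: cintegrableN. Qed.

Lemma circle_intB f g : cintegrable f -> cintegrable g ->
  circle_int (fun x => f x - g x) = circle_int f - circle_int g.
Proof.
move=> h1 h2; rewrite circle_intD ?cintegrableN//; last exact: cintegrableN.
by under [X in _ + circle_int X]eq_fun do rewrite -mulN1r; rewrite circle_intZ// mulN1r.
Qed.

(** The factor 2 comes from estimating the real and the imaginary part
    separately. *)
Lemma circle_int_le f (k : R -> R) : cintegrable f -> integrable_on_period k ->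
  (forall x, normc (f x) <= k x) ->
  normc (circle_int f) <= 2 * \int[mu]_(x in D0) k x.
Proof.
move=> [f1 f2] ki fk; apply: (le_trans (normc_le_ReIm _)) => /=.
have h (F : R -> R) : integrable_on_period F -> (forall x, `|F x| <= k x) ->
    `|\int[mu]_(x in D0) F x| <= \int[mu]_(x in D0) k x.
  move=> Fi Fk; apply: (le_trans (le_normr_Rintegral _ Fi)) => //.
  by apply: le_Rintegral => //; apply: integrable_norm.
rewrite [leRHS]mulr_natl mulr2n; apply: lerD; apply: h => // x.
  exact: le_trans (Re_le_normc _) (fk x).
exact: le_trans (Im_le_normc _) (fk x).
Qed.

Lemma circle_int_bound f (B : R) : cintegrable f ->
  (forall x, normc (f x) <= B) -> normc (circle_int f) <= 2 * pi * (2 * B).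
Proof.
move=> fi fB; have := @circle_int_le f (fun=> B) fi (continuous_integrable _ _ (@cst_continuous _ _ _)) fB.
move/le_trans; apply; rewrite Rintegral_cst//= lebesgue_measure_itv /= lte_fin twopi_gt0 /=.
by rewrite subr0 le_eqVlt; apply/orP; left; apply/eqP; ring.
Qed.

Lemma circle_int_periodic_deriv f f' : cderiv f f' -> ccont f' -> periodic2pi f ->
  circle_int f' = 0.
Proof.
move=> df [c1 c2] pf; have f0 : f (2 * pi) = f 0 by rewrite -[2 * pi]add0r pf.
have pi2 := ltW twopi_gt0.
have [d1 d2] : (forall x : R, is_derive x 1 (fun x => Re_ (f x)) (Re_ (f' x))) /\
    (forall x : R, is_derive x 1 (fun x => Im_ (f x)) (Im_ (f' x))).
  by split=> x; case: (df x).
by apply: complex_ext; rewrite /= /Rintegral ?(FTC_global pi2 d1)// ?(FTC_global pi2 d2)//= f0 subrr.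
Qed.

Lemma circle_int_by_parts f g f' g' : cderiv f f' -> cderiv g g' ->
  ccont f' -> ccont g' -> periodic2pi f -> periodic2pi g ->
  circle_int (fun x => f' x * g x) = - circle_int (fun x => f x * g' x).
Proof.
move=> df dg cf' cg' pf pg.
have cf := cderiv_cont df; have cg := cderiv_cont dg.
have i1 : cintegrable (fun x => f' x * g x) by apply/ccont_cintegrable/ccontM.
have i2 : cintegrable (fun x => f x * g' x) by apply/ccont_cintegrable/ccontM.
apply/eqP; rewrite -subr_eq0 opprK -circle_intD//; apply/eqP.
apply: (circle_int_periodic_deriv (cderivM df dg)).
  by apply: ccontD; apply: ccontM.
by move=> x; rewrite pf pg.
Qed.

Lemma lift_csubst (h hp g : R -> R) (f : R -> R[i]) : lift h hp g ->
  measurable_fun [set: R] (fun x => Re_ (f x)) ->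
  measurable_fun [set: R] (fun x => Im_ (f x)) -> periodic2pi f ->
  cintegrable f ->
  cintegrable (fun x => f (h x) * (hp x)%:C) /\
  circle_int (fun x => f (h x) * (hp x)%:C) = circle_int f.
Proof.
move=> hl m1 m2 pf [i1 i2].
have [j1 e1] := lift_subst hl m1 (fun x => congr1 (@Re_ R) (pf x)) i1.
have [j2 e2] := lift_subst hl m2 (fun x => congr1 (@Im_ R) (pf x)) i2.
have r1 : (fun x => Re_ (f (h x) * (hp x)%:C)) = (fun x => Re_ (f (h x)) * hp x).
  by apply/funext => x; rewrite [LHS]Re_M /= mulr0 subr0.
have r2 : (fun x => Im_ (f (h x) * (hp x)%:C)) = (fun x => Im_ (f (h x)) * hp x).
  by apply/funext => x; rewrite [LHS]Im_M /= mulr0 add0r.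
split; first by split; rewrite ?r1 ?r2.
by apply: complex_ext; rewrite /= ?r1 ?r2.
Qed.

End CircleIntegral.

(** * Fourier coefficients *)
Section FourierBasics.
Variable R : realType.
Local Notation mu := (@lebesgue_measure R).
Local Notation D0 := (`[(0:R), (2 * pi)%R]%classic).
Implicit Types (f g u : R -> R[i]) (c : int -> R[i]) (n k : int).

Definition chi (n : int) (x : R) : R[i] := expi (n%:~R * x).
Definition cmean f : R[i] := ((2 * pi)^-1)%:C * circle_int f.

Lemma chi_periodic n : periodic2pi (chi n).
Proof. by move=> x; rewrite /chi mulrDr expi_periodic. Qed.

Lemma is_derive_linear (a x : R) : is_derive x 1 (fun y : R => a * y) a.
Proof.
by have := @is_deriveZ _ _ _ id a x 1 1 (is_derive_id x 1); rewrite /GRing.scale /= mulr1.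
Qed.

Lemma cderiv_chi n : cderiv (chi n) (fun x => 'i * (n%:~R)%:C * chi n x).
Proof. by apply: cderiv_expi => x; apply: is_derive_linear. Qed.

Lemma ccont_chi n : ccont (chi n).
Proof. exact: cderiv_cont (cderiv_chi n). Qed.

Lemma chiD n k x : chi (n + k) x = chi n x * chi k x.
Proof. by rewrite /chi intrD mulrDl expiD. Qed.

Lemma chi0 x : chi 0 x = 1.
Proof. by rewrite /chi mul0r expi0. Qed.

Lemma chiN n x : chi (- n) x = expi (- (n%:~R * x)).
Proof. by rewrite /chi mulrNz mulNr. Qed.

Lemma normc_chi n x : normc (chi n x) = 1.
Proof. exact: normc_expi. Qed.

Lemma fourierE u n : fourier u n = cmean (fun x => u x * chi (- n) x).
Proof.
by rewrite /fourier /cmean; under [in RHS]eq_fun do rewrite chiN.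
Qed.

Lemma cintegrable_chi u n : cintegrable u -> cintegrable (fun x => u x * chi n x).
Proof. by move=> h; apply: cintegrableM => //; exact: ccont_chi. Qed.

Lemma cmean_chi n : cmean (chi n) = (n == 0)%:R.
Proof.
have [->|n0] := eqVneq n 0.
  rewrite /cmean (_ : chi 0 = fun=> 1); last by apply/funext => x; exact: chi0.
  have -> : circle_int (fun=> 1 : R[i]) = (2 * pi)%:C :> R[i].
    apply: complex_ext; rewrite /= Rintegral_cst//= ?mul0r//.
    by rewrite lebesgue_measure_itv /= lte_fin twopi_gt0 /= subr0 mul1r.
  by rewrite -rmorphM /= mulVf// gt_eqF// twopi_gt0.
have /(congr1 (fun z => z / ('i * (n%:~R)%:C))) :=
  circle_int_periodic_deriv (cderiv_chi n) (ccontM (ccont_cst _) (ccont_chi n)) (chi_periodic n).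
rewrite circle_intZ ?mul0r; last exact: ccont_cintegrable (ccont_chi n).
rewrite mulrC mulKf; first by rewrite /cmean => ->; rewrite mulr0.
rewrite mulf_neq0//; first by rewrite eq_complex /= oner_eq0 andbF.
by rewrite -[0]/(0%:C) (inj_eq (@complexI _)) intr_eq0.
Qed.

Lemma cmeanD f g : cintegrable f -> cintegrable g ->
  cmean (fun x => f x + g x) = cmean f + cmean g.
Proof. by move=> h1 h2; rewrite /cmean circle_intD// mulrDr. Qed.

Lemma cmeanB f g : cintegrable f -> cintegrable g ->
  cmean (fun x => f x - g x) = cmean f - cmean g.
Proof. by move=> h1 h2; rewrite /cmean circle_intB// mulrBr. Qed.

Lemma cmeanZ (z : R[i]) f : cintegrable f ->
  cmean (fun x => z * f x) = z * cmean f.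
Proof. by move=> h; rewrite /cmean circle_intZ// mulrCA. Qed.

Lemma cmean_sum (I : Type) (r : seq I) (F : I -> R -> R[i]) :
  (forall i, cintegrable (F i)) ->
  cmean (fun x => \sum_(i <- r) F i x) = \sum_(i <- r) cmean (F i).
Proof. by move=> h; rewrite /cmean circle_int_sum// mulr_sumr. Qed.

Lemma cmean_bound f (B : R) : cintegrable f -> (forall x, normc (f x) <= B) ->
  normc (cmean f) <= 2 * B.
Proof.
move=> fi fB; rewrite /cmean Normc.normcM normc_real ger0_norm; last first.
  by rewrite invr_ge0 ltW// twopi_gt0.
rewrite mulrC ler_pdivrMr ?twopi_gt0// mulrC; exact: circle_int_bound.
Qed.

Lemma fourierD u v n : cintegrable u -> cintegrable v ->
  fourier (fun x => u x + v x) n = fourier u n + fourier v n.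
Proof.
move=> hu hv; rewrite !fourierE; under eq_fun do rewrite mulrDl.
by rewrite cmeanD//; apply: cintegrable_chi.
Qed.

Lemma fourierB u v n : cintegrable u -> cintegrable v ->
  fourier (fun x => u x - v x) n = fourier u n - fourier v n.
Proof.
move=> hu hv; rewrite !fourierE; under eq_fun do rewrite mulrBl.
by rewrite cmeanB//; apply: cintegrable_chi.
Qed.

Lemma fourierZ (z : R[i]) u n : cintegrable u ->
  fourier (fun x => z * u x) n = z * fourier u n.
Proof.
move=> hu; rewrite !fourierE; under eq_fun do rewrite -mulrA.
by rewrite cmeanZ//; apply: cintegrable_chi.
Qed.

Lemma fourier_sum (I : Type) (r : seq I) (F : I -> R -> R[i]) n :
  (forall i, cintegrable (F i)) ->
  fourier (fun x => \sum_(i <- r) F i x) n = \sum_(i <- r) fourier (F i) n.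
Proof.
move=> h; rewrite fourierE; under eq_fun do rewrite mulr_suml.
rewrite cmean_sum; first by under eq_bigr do rewrite -fourierE.
by move=> i; apply: cintegrable_chi.
Qed.

Lemma fourier_chi k n : fourier (chi k) n = (k == n)%:R.
Proof.
rewrite fourierE; under eq_fun do rewrite -chiD.
by rewrite cmean_chi subr_eq0.
Qed.

Lemma fourier_mul_chi u k n : fourier (fun x => u x * chi k x) n = fourier u (n - k).
Proof.
rewrite !fourierE; congr cmean; apply/funext => x.
by rewrite -mulrA -chiD opprB.
Qed.

Lemma fourier_bound u n (B : R) : cintegrable u ->
  (forall x, normc (u x) <= B) -> normc (fourier u n) <= 2 * B.
Proof.
move=> ui uB; rewrite fourierE; apply: cmean_bound; first exact: cintegrable_chi.
by move=> x; rewrite Normc.normcM normc_chi mulr1.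
Qed.

Lemma ccont_bounded f : ccont f -> periodic2pi f ->
  exists2 B, 0 < B & forall x, normc (f x) <= B.
Proof.
move=> [c1 c2] pf.
have [B1 B10 h1] := continuous_bounded_segment 0 (2 * pi) c1.
have [B2 B20 h2] := continuous_bounded_segment 0 (2 * pi) c2.
exists (B1 + B2); first by rewrite addr_gt0.
move=> x; set k : int := Num.floor (x / (2 * pi)).
have -> : x = (x - k%:~R * (2 * pi)) + k%:~R * (2 * pi) by rewrite subrK.
rewrite (periodic_shift _ _ pf).
have x0 : 0 <= x - k%:~R * (2 * pi) <= 2 * pi.
  rewrite subr_ge0 -ler_pdivlMr ?twopi_gt0// floor_le /=.
  rewrite lerBlDr -{1}[2 * pi]mul1r -mulrDl -ler_pdivrMr ?twopi_gt0//.
  by rewrite ltW// addrC -[1]/(1%:~R) -intrD floorD1_gt.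
by apply: (le_trans (normc_le_ReIm _)); apply: lerD; [apply: h1|apply: h2].
Qed.

Lemma cderiv_periodic f f' : cderiv f f' -> periodic2pi f -> periodic2pi f'.
Proof.
move=> df pf x.
have ds : is_derive x 1 (fun y : R => y + 2 * pi) 1.
  by apply: is_derive_eq; rewrite addr0.
have [d1 d2] := df (x + 2 * pi); have [e1 e2] := df x.
apply: complex_ext.
  have := @is_derive1_comp _ (fun y => Re_ (f y)) (fun y : R => y + 2 * pi) x _ _ d1 ds.
  rewrite mulr1 (_ : _ \o _ = fun y => Re_ (f y)) => [[_ <-]|]; first by case: e1.
  by apply/funext => y /=; rewrite pf.
have := @is_derive1_comp _ (fun y => Im_ (f y)) (fun y : R => y + 2 * pi) x _ _ d2 ds.
rewrite mulr1 (_ : _ \o _ = fun y => Im_ (f y)) => [[_ <-]|]; first by case: e2.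
by apply/funext => y /=; rewrite pf.
Qed.

Lemma fourier_deriv f f' n : cderiv f f' -> ccont f' -> periodic2pi f ->
  fourier f' n = 'i * (n%:~R)%:C * fourier f n.
Proof.
move=> df cf' pf; rewrite !fourierE /cmean.
have cf := cderiv_cont df.
rewrite (circle_int_by_parts df (cderiv_chi (- n)) cf')//; last first.
- exact: chi_periodic.
- by apply: ccontM; [exact: ccont_cst|exact: ccont_chi].
under eq_fun do rewrite mulrCA.
rewrite circle_intZ; last by apply/ccont_cintegrable/ccontM => //; exact: ccont_chi.
rewrite mulrNz; set z := circle_int _.
have -> : (- (n%:~R : R))%:C = - (n%:~R)%:C :> R[i] by rewrite rmorphN.
by ring.
Qed.

(** ** Symmetric partial sums and uniformly convergent Fourier series *)

(** The frequencies [n] and [- n] are added together, as in the square norm of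
    H^{1/2}. *)
Definition symsum (N : nat) (F : int -> R[i]) : R[i] :=
  F 0 + \sum_(1 <= n < N) (F n%:Z + F (- n%:Z)).

Definition fsum c (N : nat) (x : R) : R[i] := symsum N (fun n => c n * chi n x).

Definition uniform_series f c := forall e : R, 0 < e ->
  exists N0, forall N, (N0 <= N)%N -> forall x, normc (f x - fsum c N x) <= e.

Lemma symsum_ext N (F G : int -> R[i]) : F =1 G -> symsum N F = symsum N G.
Proof. by move=> h; rewrite /symsum h; under eq_bigr do rewrite !h. Qed.

Lemma ccont_fsum c N : ccont (fsum c N).
Proof.
have h n : ccont (fun x => c n * chi n x).
  by apply: ccontM; [exact: ccont_cst|exact: ccont_chi].
by apply: ccontD => //; apply: ccont_sum => n; apply: ccontD.
Qed.

Lemma fsum_periodic c N : periodic2pi (fsum c N).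
Proof. by move=> x; apply: symsum_ext => n; rewrite chi_periodic. Qed.

Lemma cmean_mul_fsum u c N : cintegrable u ->
  cmean (fun x => u x * fsum c N x) = symsum N (fun k => c k * fourier u (- k)).
Proof.
move=> ui.
have h n : cintegrable (fun x => u x * (c n * chi n x)).
  by apply: cintegrableM => //; apply: ccontM; [exact: ccont_cst|exact: ccont_chi].
have hE n : cmean (fun x => u x * (c n * chi n x)) = c n * fourier u (- n).
  rewrite fourierE opprK; under eq_fun do rewrite mulrCA.
  by rewrite cmeanZ//; apply: cintegrable_chi.
have -> : (fun x => u x * fsum c N x) = (fun x => u x * (c 0 * chi 0 x) +
    \sum_(1 <= n < N) (u x * (c n%:Z * chi n%:Z x) + u x * (c (- n%:Z) * chi (- n%:Z) x))).
  apply/funext => x; rewrite /fsum /symsum mulrDr mulr_sumr; congr (_ + _).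
  by apply: eq_bigr => n _; rewrite mulrDr.
rewrite cmeanD//; last by apply: cintegrable_sum => n; exact: cintegrableD.
rewrite cmean_sum; last by move=> n; exact: cintegrableD.
rewrite hE; congr (_ + _); apply: eq_bigr => n _.
by rewrite cmeanD// !hE.
Qed.

Lemma symsum_delta N (F : int -> R[i]) n : (`|n| < N)%N ->
  symsum N (fun k => F k * (k == n)%:R) = F n.
Proof.
move=> nN; rewrite /symsum.
have hsum (G : nat -> R[i]) (m : nat) : (0 < m)%N -> (m < N)%N ->
    \sum_(1 <= k < N) G k * (k == m)%:R = G m.
  move=> m0 mN; rewrite (bigD1_seq m)//=; last first.
  - exact: iota_uniq.
  - by rewrite mem_index_iota m0 mN.
  rewrite eqxx mulr1 big1 ?addr0// => k /negbTE ->; exact: mulr0.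
case: n nN => [[|m]|m] /= nN.
- rewrite mulr1 big_nat_cond big1 ?addr0// => k; rewrite andbT => /andP[k1 _].
  rewrite (_ : (k%:Z == _) = false) 1?(_ : (- k%:Z == _) = false) ?mulr0 ?addr0//; lia.
- rewrite mulr0 add0r -[RHS](hsum (fun k : nat => F (Posz k)) m.+1)//.
  apply: eq_big_nat => k /andP[k1 _].
  by rewrite (_ : (- k%:Z == _) = false) ?mulr0 ?addr0//; lia.
- rewrite mulr0 add0r -[RHS](hsum (fun k : nat => F (- Posz k)) m.+1)//.
  apply: eq_big_nat => k /andP[k1 _].
  rewrite mulr0 add0r.
  by rewrite (_ : (- k%:Z == Negz m) = (k == m.+1))//; lia.
Qed.

Lemma fourier_fsum c N n : (`|n| < N)%N -> fourier (fsum c N) n = c n.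
Proof.
move=> nN; rewrite fourierE.
have -> : (fun x => fsum c N x * chi (- n) x) = (fun x => chi (- n) x * fsum c N x).
  by apply/funext => x; rewrite mulrC.
rewrite cmean_mul_fsum; last exact: ccont_cintegrable (ccont_chi _).
rewrite -[RHS](symsum_delta c nN); apply: symsum_ext => k.
by rewrite fourier_chi eqr_opp eq_sym.
Qed.

Lemma uniform_series_ccont f c : uniform_series f c -> ccont f.
Proof.
have tri (z w z' w' : R[i]) (T : R[i] -> R) : (forall a, `|T a| <= normc a) ->
    (forall a b, T (a - b) = T a - T b) ->
    `|T z - T w| <= normc (z - z') + normc (w - w') + `|T z' - T w'|.
  move=> T1 T2; have -> : T z - T w = T (z - z') - T (w - w') + (T z' - T w').
    by rewrite !T2; ring.
  apply: (le_trans (ler_normD _ _)); apply: lerD => //.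
  by apply: (le_trans (ler_normB _ _)); apply: lerD.
move=> hf.
have main (T : R[i] -> R) : (forall a, `|T a| <= normc a) ->
    (forall a b, T (a - b) = T a - T b) ->
    (forall N, continuous (fun x => T (fsum c N x))) -> continuous (fun x => T (f x)).
  move=> T1 T2 T3 x; apply/cvgrPdist_le => e e0.
  have e3 : 0 < e / 3 by rewrite divr_gt0.
  have [N hN] := hf _ e3; have {}hN := hN N (leqnn N).
  have := T3 N x => /cvgrPdist_le/(_ _ e3); apply: filterS => y hy.
  apply: (le_trans (tri _ _ (fsum c N x) (fsum c N y) T T1 T2)).
  have -> : e = e / 3 + e / 3 + e / 3 by field.
  by apply: lerD => //; apply: lerD.
split; apply: main.
- exact: Re_le_normc.
- by move=> a b; rewrite Re_D Re_N.
- by move=> N; case: (ccont_fsum c N).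
- exact: Im_le_normc.
- by move=> a b; rewrite Im_D Im_N.
- by move=> N; case: (ccont_fsum c N).
Qed.

Lemma uniform_series_periodic f c : uniform_series f c -> periodic2pi f.
Proof.
move=> hf x; apply/eqP; rewrite -subr_eq0; apply/eqP; apply: normc_eq0P.
apply/ler_addgt0Pr => e e0; rewrite add0r.
have e2 : 0 < e / 2 by rewrite divr_gt0.
have [N hN] := hf _ e2; have {}hN := hN N (leqnn N).
have -> : f (x + 2 * pi) - f x = (f (x + 2 * pi) - fsum c N (x + 2 * pi)) -
    (f x - fsum c N x) by rewrite fsum_periodic; ring.
by rewrite [e]splitr; apply: (le_trans (normcB _ _)); apply: lerD.
Qed.

Lemma uniform_series_fourier f c n : uniform_series f c -> fourier f n = c n.
Proof.
move=> hf; have cf := uniform_series_ccont hf.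
apply/eqP; rewrite -subr_eq0; apply/eqP; apply: normc_eq0P.
apply/ler_addgt0Pr => e e0; rewrite add0r.
have e2 : 0 < e / 2 by rewrite divr_gt0.
have [N hN] := hf _ e2; have {}hN := hN (maxn N `|n|.+1) (leq_maxl _ _).
rewrite -(@fourier_fsum c (maxn N `|n|.+1)); last by rewrite leq_max ltnSn orbT.
rewrite -fourierB; [|exact: ccont_cintegrable|exact/ccont_cintegrable/ccont_fsum].
have -> : e = 2 * (e / 2) by field.
apply: fourier_bound => //; apply: cintegrableB.
  exact: ccont_cintegrable.
exact/ccont_cintegrable/ccont_fsum.
Qed.

(** Replacing [f] by a partial sum changes the mean by at most their uniform
    distance times the integral of [|u|]. *)
Lemma cmean_mul_series u f c : cintegrable u -> uniform_series f c ->
  ccvg (fun N => symsum N (fun k => c k * fourier u (- k)))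
       (cmean (fun x => u x * f x)).
Proof.
move=> ui hf e e0; have cf := uniform_series_ccont hf.
pose k x := `|Re_ (u x)| + `|Im_ (u x)|.
have ki : integrable_on_period k.
  case: ui => i1 i2; apply: (@eq_integrable _ _ _ mu D0 (measurable_itv _)
    ((EFin \o (fun x => `|Re_ (u x)|)%R) \+ (EFin \o (fun x => `|Im_ (u x)|)%R))%E).
    by move=> x _ /=; rewrite EFinD.
  by apply: integrableD => //; apply: integrable_norm.
pose I := \int[mu]_(x in D0) k x.
have I0 : 0 <= I by apply: Rintegral_ge0 => x _; rewrite addr_ge0.
pose e' := e / (I + 1).
have I1 : 0 < I + 1 by rewrite ltr_wpDl.
have e'0 : 0 < e' by rewrite divr_gt0.
have [N0 hN] := hf _ e'0; exists N0 => N /hN {}hN.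
rewrite -cmean_mul_fsum// -cmeanB; last first.
- by apply: cintegrableM.
- by apply: cintegrableM => //; exact: ccont_fsum.
under eq_fun do rewrite -mulrBr.
have ci : cintegrable (fun x => u x * (fsum c N x - f x)).
  apply: cintegrableM => //; apply: ccontD; first exact: ccont_fsum.
  exact: ccontN.
have ke : integrable_on_period (fun x => e' * k x).
  by have := @integrableZl _ _ _ mu _ (measurable_itv _) e' _ ki; apply: eq_integrable.
have := circle_int_le ci ke; rewrite RintegralZl// -/I => h.
rewrite /cmean Normc.normcM normc_real ger0_norm; last first.
  by rewrite invr_ge0 ltW// twopi_gt0.
rewrite mulrC ler_pdivrMr ?twopi_gt0//.
apply: (le_trans (h _)) => [x|].
  rewrite Normc.normcM mulrC ler_pM ?normc_ge0//; last exact: normc_le_ReIm.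
  by rewrite -normcN opprB.
have h1 : e' * I <= e.
  have eE : e' * (I + 1) = e by rewrite divfK ?gt_eqF.
  by rewrite -[leRHS]eE ler_wpM2l ?ltW// ltrDl.
apply: (@le_trans _ _ (2 * e)); first by rewrite ler_wpM2l.
have := pi_ge2 R; nra.
Qed.

(** ** Summability of inverse squares, and construction of series *)

(** Comparison with the telescoping sum of [2 / n - 2 / (n + 1)]. *)
Lemma sum_inv_sq (N M : nat) : (0 < N)%N ->
  \sum_(N <= n < M) (n%:R ^- 2 : R) <= 2 / N%:R.
Proof.
move=> N0; have [NM|MN] := leqP N M; last first.
  by rewrite big_geq ?divr_ge0// ltnW.
apply: (@le_trans _ _ (\sum_(N <= n < M) (- (2 / n.+1%:R) - - (2 / n%:R)))).
  rewrite big_nat_cond [leRHS]big_nat_cond; apply: ler_sum => n; rewrite andbT => /andP[Nn _].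
  have n0 : (0 : R) < n%:R by rewrite ltr0n (leq_trans N0).
  have n1 : (1 : R) <= n%:R by rewrite ler1n (leq_trans N0).
  rewrite -[n.+1%:R]natr1; move: (n%:R : R) n0 n1 => x x0 x1.
  rewrite -subr_ge0.
  have -> : - (2 / (x + 1)) - - (2 / x) - x ^- 2 = (x - 1) / (x ^+ 2 * (x + 1)).
    by field; apply/andP; split; apply/eqP; lra.
  by rewrite divr_ge0 ?subr_ge0// mulr_ge0 ?exprn_ge0 ?addr_ge0 ?ltW.
rewrite telescope_sumr// opprK addrC lerBlDr lerDl divr_ge0//.
Qed.

Lemma real_cauchy_limit (s : nat -> R) (K : R) : 0 <= K ->
  (forall N M, (0 < N)%N -> (N <= M)%N -> `|s M - s N| <= K / N%:R) ->
  exists l, forall N, (0 < N)%N -> `|s N - l| <= K / N%:R.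
Proof.
move=> K0 h.
have cs : cvg (s @ \oo).
  apply/cauchy_cvgP/cauchy_exP => e e0.
  have [N [N0 hN]] : exists N, (0 < N)%N /\ K / N%:R < e.
    exists (Num.truncn (K / e)).+1; split => //.
    rewrite ltr_pdivrMr ?ltr0n// mulrC -ltr_pdivrMr//.
    exact: Num.Theory.truncnS_gt.
  exists (s N); exists N => // M /= NM.
  by rewrite /ball /= distrC; apply: (le_lt_trans (h _ _ N0 NM)).
exists (limn s) => N N0; rewrite distrC.
have : (fun M => `|s M - s N|) @ \oo --> `|limn s - s N|.
  by apply: cvg_norm; apply: cvgB => //; exact: cvg_cst.
move=> hc; rewrite -(cvg_lim _ hc)//; apply: limr_le; first by apply/cvg_ex; exists (`|limn s - s N|).
by exists N => // M /= NM; apply: h.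
Qed.

Lemma complex_cauchy_limit (s : nat -> R[i]) (K : R) : 0 <= K ->
  (forall N M, (0 < N)%N -> (N <= M)%N -> normc (s M - s N) <= K / N%:R) ->
  exists l, forall N, (0 < N)%N -> normc (s N - l) <= 2 * K / N%:R.
Proof.
move=> K0 h.
have [a ha] : exists a, forall N, (0 < N)%N -> `|Re_ (s N) - a| <= K / N%:R.
  apply: real_cauchy_limit => // N M N0 NM; apply: le_trans (h N M N0 NM).
  by rewrite -Re_N -Re_D; exact: Re_le_normc.
have [b hb] : exists b, forall N, (0 < N)%N -> `|Im_ (s N) - b| <= K / N%:R.
  apply: real_cauchy_limit => // N M N0 NM; apply: le_trans (h N M N0 NM).
  by rewrite -Im_N -Im_D; exact: Im_le_normc.
exists (a +i* b) => N N0; apply: (le_trans (normc_le_ReIm _)).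
rewrite Re_D Im_D Re_N Im_N -mulrA mulr_natl mulr2n; apply: lerD;
  [exact: ha|exact: hb].
Qed.

Definition sq_decay (C : R) c := forall n : nat, (0 < n)%N ->
  normc (c n%:Z) <= C / n%:R ^+ 2 /\ normc (c (- n%:Z)) <= C / n%:R ^+ 2.

Lemma fsum_cauchy (C : R) c x N M : sq_decay C c -> (0 < N)%N -> (N <= M)%N ->
  normc (fsum c M x - fsum c N x) <= 4 * C / N%:R.
Proof.
move=> hc N0 NM.
have C0 : 0 <= C by have [/(le_trans (normc_ge0 _))] := hc 1%N isT; rewrite expr1n divr1.
rewrite /fsum /symsum (@big_cat_nat _ _ _ N 1 M)//=.
rewrite addrA [_ + \sum_(N <= _ < _) _]addrC addrK.
apply: (le_trans (normc_sum _ _ _)).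
apply: (@le_trans _ _ (\sum_(N <= n < M) (2 * C) * n%:R ^- 2)).
  rewrite big_nat_cond [leRHS]big_nat_cond; apply: ler_sum => n; rewrite andbT => /andP[Nn _].
  have [h1 h2] := hc n (leq_trans N0 Nn).
  apply: (le_trans (le_normcD _ _)); rewrite !Normc.normcM !normc_chi !mulr1.
  by rewrite -mulrA mulr_natl mulr2n; apply: lerD.
rewrite -mulr_sumr; apply: (le_trans (ler_wpM2l _ (sum_inv_sq M N0))).
  by rewrite mulr_ge0.
by rewrite le_eqVlt; apply/orP; left; apply/eqP; field; rewrite pnatr_eq0 -lt0n.
Qed.

Lemma uniform_series_exists (C : R) c : sq_decay C c -> exists f, uniform_series f c.
Proof.
move=> hc.
have C0 : 0 <= C by have [/(le_trans (normc_ge0 _))] := hc 1%N isT; rewrite expr1n divr1.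
have C4 : 0 <= 4 * C by rewrite mulr_ge0.
have hx x : exists l : R[i], forall N, (0 < N)%N -> normc (l - fsum c N x) <= 2 * (4 * C) / N%:R.
  have [l hl] := complex_cauchy_limit C4 (fun N M => fsum_cauchy x hc).
  by exists l => N /hl; rewrite -normcN opprB.
have [f hf] := choice hx; exists f => e e0.
exists (Num.truncn (2 * (4 * C) / e)).+1 => N hN x.
have N0 : (0 < N)%N by apply: leq_trans hN.
apply: (le_trans (hf x N N0)); rewrite ler_pdivrMr ?ltr0n// [leRHS]mulrC -ler_pdivrMr//.
by apply: ltW; apply: (lt_le_trans (Num.Theory.truncnS_gt _)); rewrite ler_nat.
Qed.

(** Two differentiations multiply the coefficient of frequency [n] by [- n^2],
    and the coefficients of the second derivative are bounded. *)
Lemma C2_sq_decay f f1 f2 : cderiv f f1 -> cderiv f1 f2 -> ccont f2 ->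
  periodic2pi f -> exists C, sq_decay C (fourier f).
Proof.
move=> d1 d2 c2 pf.
have p1 := cderiv_periodic d1 pf; have p2 := cderiv_periodic d2 p1.
have [B B0 hB] := ccont_bounded c2 p2.
have c1 := cderiv_cont d2.
exists (2 * B).
have h (n : int) : (`|n|%N != 0)%N -> normc (fourier f n) <= 2 * B / `|n|%N%:R ^+ 2.
  move=> n0; have := fourier_bound n (ccont_cintegrable c2) hB.
  rewrite (fourier_deriv _ d2 c2 p1) (fourier_deriv _ d1 c1 pf) !Normc.normcM.
  rewrite normc_i normc_real !mul1r mulrA -expr2.
  have -> : `|n%:~R| = `|n|%N%:R :> R by rewrite -intr_norm -abszE -pmulrn.
  by rewrite ler_pdivlMr 1?mulrC// exprn_gt0// ltr0n lt0n.
by move=> n n0; split; [have := h n%:Z|have := h (- n%:Z)]; rewrite ?abszN !absz_nat -lt0n; apply.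
Qed.

End FourierBasics.

(** * A periodic integrable function is determined by its Fourier coefficients *)
Section Uniqueness.
Variable R : realType.
Local Notation mu := (@lebesgue_measure R).
Local Notation D0 := (`[(0:R), (2 * pi)%R]%classic).
Implicit Types (f g u : R -> R[i]).

(** This class is stable under products with trigonometric polynomials, which is
    how information on integrals over intervals is extracted from it. *)
Definition no_frequency f := cintegrable f /\ forall n, fourier f n = 0.

Lemma no_frequencyD f g : no_frequency f -> no_frequency g ->
  no_frequency (fun x => f x + g x).
Proof.
move=> [f1 f2] [g1 g2]; split; first exact: cintegrableD.
by move=> n; rewrite fourierD// f2 g2 addr0.
Qed.

Lemma no_frequencyZ (z : R[i]) f : no_frequency f -> no_frequency (fun x => z * f x).
Proof.
move=> [f1 f2]; split; first exact: cintegrableZ.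
by move=> n; rewrite fourierZ// f2 mulr0.
Qed.

Lemma no_frequency_chi k f : no_frequency f -> no_frequency (fun x => f x * chi k x).
Proof.
move=> [f1 f2]; split; first exact: cintegrable_chi.
by move=> n; rewrite fourier_mul_chi f2.
Qed.

(** A trigonometric polynomial of degree one with values in [0, 1], below 1/2
    exactly on the interval ]a, b[ of the period. *)
Definition window (a b x : R) : R := 1 / 2 - sin ((x - a) / 2) * sin ((b - x) / 2) / 2.

Lemma windowE a b x : (window a b x)%:C =
  ((1 / 2 + cos ((b - a) / 2) / 4)%:C - (8^-1)%:C * (expi (- ((a + b) / 2)) * chi 1 x
    + expi ((a + b) / 2) * chi (-1) x)) :> R[i].
Proof.
have e1 : expi (- ((a + b) / 2)) * chi 1 x = expi (x - (a + b) / 2).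
  by rewrite /chi mul1r mulrC -expiD.
have e2 : expi ((a + b) / 2) * chi (-1) x = expi (- (x - (a + b) / 2)).
  by rewrite /chi mulN1r -expiD opprB.
rewrite e1 e2 expiN.
have -> : x - (a + b) / 2 = (x - a) / 2 - (b - x) / 2 by field.
have -> : (b - a) / 2 = (x - a) / 2 + (b - x) / 2 by field.
apply: complex_ext; rewrite /window.
  rewrite !Re_D !Re_N !Re_M !Re_D !Im_D /= cosD cosB.
  by field.
rewrite !Im_D !Im_N !Im_M !Re_D !Im_D /=.
by ring.
Qed.

Lemma no_frequency_window a b f : no_frequency f ->
  no_frequency (fun x => f x * (window a b x)%:C).
Proof.
move=> hf; under eq_fun do rewrite windowE.
have -> : (fun x => f x * ((1 / 2 + cos ((b - a) / 2) / 4)%:C - (8^-1)%:C *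
   (expi (- ((a + b) / 2)) * chi 1 x + expi ((a + b) / 2) * chi (-1) x))) =
  (fun x => (1 / 2 + cos ((b - a) / 2) / 4)%:C * f x +
    (- ((8^-1)%:C * expi (- ((a + b) / 2))) * (f x * chi 1 x) +
     - ((8^-1)%:C * expi ((a + b) / 2)) * (f x * chi (-1) x))).
  by apply/funext => x; ring.
by apply: no_frequencyD; [|apply: no_frequencyD]; apply: no_frequencyZ => //;
  exact: no_frequency_chi.
Qed.

Lemma no_frequency_iter (T : R -> R) k f :
  (forall g, no_frequency g -> no_frequency (fun x => g x * (T x)%:C)) ->
  no_frequency f -> no_frequency (fun x => f x * (T x ^+ k)%:C).
Proof.
move=> h hf; elim: k => [|k IH].
  by under eq_fun do rewrite expr0 mulr1.
by under eq_fun do rewrite exprSr rmorphM mulrA; exact: h.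
Qed.

(** A trigonometric polynomial with values in [0, 1]; by Bernoulli's inequality it
    tends to 1 where [window < 1/2] and to 0 where [window > 1/2]. *)
Definition bump (a b : R) (n : nat) (x : R) : R := (1 - window a b x ^+ n) ^+ (2 ^ n).

Lemma no_frequency_bump a b n f : no_frequency f ->
  no_frequency (fun x => f x * (bump a b n x)%:C).
Proof.
apply: no_frequency_iter => g hg.
under eq_fun do rewrite rmorphB mulrBr mulr1 -mulN1r.
apply: no_frequencyD => //; apply: no_frequencyZ.
by apply: no_frequency_iter => // k; exact: no_frequency_window.
Qed.

Lemma window_itv a b x : 0 <= window a b x <= 1.
Proof.
have h (s t : R) : -1 <= s <= 1 -> -1 <= t <= 1 -> -1 <= s * t <= 1.
  by move=> /andP[s1 s2] /andP[t1 t2]; apply/andP; split; nra.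
have hs (t : R) : -1 <= sin t <= 1 by rewrite sin_geN1 sin_le1.
have /andP[h1 h2] := h _ _ (hs ((x - a) / 2)) (hs ((b - x) / 2)).
by rewrite /window; apply/andP; split; lra.
Qed.

Lemma window_inside a b x : 0 <= a -> b <= 2 * pi -> a < x < b ->
  window a b x < 1 / 2.
Proof.
move=> a0 b2 /andP[ax xb].
have h1 : 0 < sin ((x - a) / 2) by apply: sin_gt0_pi; apply/andP; split; lra.
have h2 : 0 < sin ((b - x) / 2) by apply: sin_gt0_pi; apply/andP; split; lra.
by have := mulr_gt0 h1 h2; rewrite /window => h; lra.
Qed.

Lemma window_outside a b x : 0 <= a -> a <= b -> b <= 2 * pi -> 0 < x < 2 * pi ->
  (x < a) || (b < x) -> 1 / 2 < window a b x.
Proof.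
move=> a0 ab b2 /andP[x0 x2] /orP[xa|bx].
  have h1 : 0 < sin ((a - x) / 2) by apply: sin_gt0_pi; apply/andP; split; lra.
  have h2 : 0 < sin ((b - x) / 2) by apply: sin_gt0_pi; apply/andP; split; lra.
  have -> : window a b x = 1 / 2 + sin ((a - x) / 2) * sin ((b - x) / 2) / 2.
    rewrite /window; have -> : (x - a) / 2 = - ((a - x) / 2) by field.
    by rewrite sinN; ring.
  by have := mulr_gt0 h1 h2; lra.
have h1 : 0 < sin ((x - a) / 2) by apply: sin_gt0_pi; apply/andP; split; lra.
have h2 : 0 < sin ((x - b) / 2) by apply: sin_gt0_pi; apply/andP; split; lra.
have -> : window a b x = 1 / 2 + sin ((x - a) / 2) * sin ((x - b) / 2) / 2.
  rewrite /window; have -> : (b - x) / 2 = - ((x - b) / 2) by field.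
  by rewrite sinN; ring.
by have := mulr_gt0 h1 h2; lra.
Qed.

Lemma bernoulli (s : R) k : 0 <= s <= 1 -> 1 - k%:R * s <= (1 - s) ^+ k.
Proof.
move=> /andP[s0 s1]; elim: k => [|k IH]; first by rewrite mul0r subr0 expr0.
rewrite exprS -natr1; have k0 : (0 : R) <= k%:R by [].
have := ler_wpM2l (_ : 0 <= 1 - s) IH; rewrite subr_ge0 => /(_ s1).
by apply: le_trans; move: (k%:R : R) k0 => y y0; nra.
Qed.

Lemma bernoulli_add (s : R) k : 0 <= s -> 1 + k%:R * s <= (1 + s) ^+ k.
Proof.
move=> s0; elim: k => [|k IH]; first by rewrite mul0r addr0 expr0.
rewrite exprS -natr1; have k0 : (0 : R) <= k%:R by [].
have := ler_wpM2l (_ : 0 <= 1 + s) IH; rewrite addr_ge0// => /(_ isT).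
by apply: le_trans; move: (k%:R : R) k0 => y y0; nra.
Qed.

Lemma pow2_mul (t : R) n : (2 ^ n)%:R * t ^+ n = (2 * t) ^+ n.
Proof. by rewrite exprMn natrX. Qed.

Lemma bump_itv a b n x : 0 <= bump a b n x <= 1.
Proof.
have /andP[w0 w1] := window_itv a b x.
have h0 : 0 <= window a b x ^+ n <= 1 by rewrite exprn_ge0// exprn_ile1.
have h1 : 0 <= 1 - window a b x ^+ n <= 1 by lra.
by move: h1 => /andP[h1 h2]; rewrite /bump exprn_ge0// exprn_ile1.
Qed.

Lemma bump_inside a b x : 0 <= a -> b <= 2 * pi -> a < x < b ->
  bump a b n x @[n --> \oo] --> (1 : R).
Proof.
move=> a0 b2 xab; have wx := window_inside a0 b2 xab.
have /andP[w0 w1] := window_itv a b x.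
apply: (@squeeze_cvgr _ _ _ _ (fun n => 1 - (2 * window a b x) ^+ n) (fun=> 1)).
- apply: nearW => n; have /andP[_ ->] := bump_itv a b n x; rewrite andbT.
  rewrite -pow2_mul; apply: bernoulli; rewrite exprn_ge0//=; exact: exprn_ile1.
- rewrite -[X in _ --> X]subr0; apply: cvgB; first exact: cvg_cst.
  by apply: cvg_expr; rewrite ger0_norm; lra.
- exact: cvg_cst.
Qed.

Lemma bump_outside a b x : 0 <= a -> a <= b -> b <= 2 * pi -> 0 < x < 2 * pi ->
  (x < a) || (b < x) -> bump a b n x @[n --> \oo] --> (0 : R).
Proof.
move=> a0 ab b2 x02 xab; have wx := window_outside a0 ab b2 x02 xab.
have /andP[w0 w1] := window_itv a b x.
have w2 : 0 < 2 * window a b x by lra.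
apply: (@squeeze_cvgr _ _ _ _ (fun=> 0) (fun n => (2 * window a b x)^-1 ^+ n)).
- apply: nearW => n; have /andP[-> _] := bump_itv a b n x => /=.
  set s := window a b x ^+ n.
  have s0 : 0 <= s by rewrite exprn_ge0.
  have s1 : s <= 1 by rewrite exprn_ile1.
  (* (1 - s)^(2^n) <= (1 + s)^-(2^n) <= (1 + 2^n s)^-1, where [2^n s = (2 window)^n]. *)
  have p : (1 - s) ^+ (2 ^ n) * (1 + s) ^+ (2 ^ n) <= 1.
    by rewrite -exprMn exprn_ile1//; nra.
  have q : (2 * window a b x) ^+ n <= (1 + s) ^+ (2 ^ n).
    by rewrite -pow2_mul; apply: le_trans (bernoulli_add (2 ^ n) s0); rewrite lerDr.
  rewrite exprVn -[leRHS]mul1r ler_pdivlMr ?exprn_gt0//.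
  apply: le_trans p; rewrite ler_wpM2l// /bump exprn_ge0// subr_ge0//.
- exact: cvg_cst.
- by apply: cvg_expr; rewrite ger0_norm ?invr_ge0 ?ltW// invf_cp1//; lra.
Qed.

Lemma aeS (P Q : R -> Prop) : (forall x, P x -> Q x) ->
  {ae mu, forall x, P x} -> {ae mu, forall x, Q x}.
Proof. by move=> PQ; apply: filterS => //; exact: (ae_filter_ringOfSetsType mu). Qed.

Lemma aeI (P Q : R -> Prop) : {ae mu, forall x, P x} -> {ae mu, forall x, Q x} ->
  {ae mu, forall x, P x /\ Q x}.
Proof. by move=> h1 h2; apply: filterI => //; exact: (ae_filter_ringOfSetsType mu). Qed.

Lemma ae_neq (c : R) : {ae mu, forall x, x != c}.
Proof.
exists [set c]; split => //; first exact: lebesgue_measure_set1.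
by move=> x /= /negP; rewrite negbK => /eqP.
Qed.

Lemma measurable_bump a b n : measurable_fun [set: R] (bump a b n).
Proof.
apply: continuous_measurable_fun => x.
have cw (y : R) : {for y, continuous (window a b)}.
  apply: cvgB; first exact: cvg_cst.
  apply: cvgM; last exact: cvg_cst.
  by apply: cvgM; (apply: continuous_comp; last exact: continuous_sin);
    apply: cvgM; try exact: cvg_cst; apply: cvgB; try exact: cvg_cst; exact: cvg_id.
have -> : bump a b n = (fun y => (1 - y ^+ n) ^+ (2 ^ n)) \o window a b by [].
apply: continuous_comp; first exact: cw.
have -> : (fun y : R => (1 - y ^+ n) ^+ (2 ^ n)) =
  (fun y => y ^+ (2 ^ n)) \o (fun y => 1 - y ^+ n) by [].
apply: continuous_comp; last exact: exprn_continuous.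
by apply: cvgB; [exact: cvg_cst|exact: exprn_continuous].
Qed.

(** Dominated convergence, the bumps tending to the indicator of the interval
    except at its ends and at the ends of the period. *)
Lemma interval_integral_eq0 (F : R -> R) a b : 0 <= a -> a <= b -> b <= 2 * pi ->
  integrable_on_period F ->
  (forall n, (\int[mu]_(x in D0) (F x * bump a b n x)%:E = 0)%E) ->
  (\int[mu]_(x in `[a, b]) (F x)%:E = 0)%E.
Proof.
move=> a0 ab b2 Fi h0.
have mF : measurable_fun D0 F by apply/measurable_EFinP; case/integrableP: Fi.
pose X : set R := `]a, b[%classic.
have mX : measurable X by exact: measurable_itv.
have mn n : measurable_fun D0 (fun x => (F x * bump a b n x)%:E).
  apply/measurable_EFinP; apply: measurable_funM => //.
  by apply: measurable_funTS; exact: measurable_bump.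
have ml : measurable_fun D0 (fun x => (F x * \1_X x)%:E).
  by apply/measurable_EFinP; apply: measurable_funM => //; exact: measurable_indic.
have cv : {ae mu, forall x, D0 x -> (F x * bump a b n x)%:E @[n --> \oo] --> (F x * \1_X x)%:E}.
  have := aeI (aeI (ae_neq 0) (ae_neq (2 * pi))) (aeI (ae_neq a) (ae_neq b)).
  apply: aeS => x [[/eqP x0 /eqP x2] [/eqP xa /eqP xb]] /=; rewrite in_itv/= => /andP[x0' x2'].
  have x02 : 0 < x < 2 * pi by apply/andP; split; lra.
  apply: cvg_EFin; first by apply: nearW.
  apply: cvgM; first exact: cvg_cst.
  rewrite indicE; have [xX|xX] := boolP (a < x < b).
    rewrite mem_set; first exact: bump_inside.
    by rewrite /X /= in_itv.
  rewrite memNset; last by rewrite /X /= in_itv /=; exact/negP.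
  apply: bump_outside => //; move: xX; rewrite negb_and -!leNgt => /orP[h|h].
    by apply/orP; left; lra.
  by apply/orP; right; lra.
have dom : {ae mu, forall x n, D0 x -> (`|(F x * bump a b n x)%:E| <= `|F x|%:E)%E}.
  apply: aeW => x n _ /=; rewrite lee_fin normrM; have /andP[b0 b1] := bump_itv a b n x.
  by rewrite (ger0_norm b0) ler_piMr.
have nF : mu.-integrable D0 (fun x => `|F x|%:E) by exact: integrable_norm.
have [_ _] := @dominated_convergence _ _ _ mu D0 (measurable_itv _) _ _ _ mn ml cv nF dom.
rewrite /=; under eq_fun do rewrite h0.
move=> /cvg_lim hl.
have : (\int[mu]_(x in D0) (F x * \1_X x)%:E = 0)%E.
  by rewrite -hl// lim_cst.
move=> <-.
have mFab : measurable_fun `]a, b[ (EFin \o F).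
  apply/measurable_EFinP; apply: measurable_funS mF => //.
  by apply: subset_itvScc => //=; rewrite bnd_simp.
rewrite (integral_itv_bndoo true false mFab).
rewrite integral_mkcond [RHS]integral_mkcond; apply: eq_integral => x _.
rewrite !patchE indicE -/X; have [xX|xX] := boolP (x \in X).
  rewrite mulr1 mem_set//; move: xX; rewrite inE /X /= !in_itv/= => /andP[ax xb].
  by apply/andP; split; lra.
by rewrite mulr0; case: ifP.
Qed.

(** The primitive vanishes identically, and its derivative is almost everywhere
    the function. *)
Lemma ae_zero_on_period (F : R -> R) : integrable_on_period F ->
  (forall a b, 0 <= a -> a <= b -> b <= 2 * pi ->
    (\int[mu]_(x in `[a, b]) (F x)%:E = 0)%E) ->
  (\int[mu]_(x in D0) `|F x|%:E = 0)%E.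
Proof.
move=> Fi h0; have mD : measurable D0 by exact: measurable_itv.
pose G := F \_ D0.
have GiT : mu.-integrable setT (EFin \o G).
  by rewrite /G -restrict_EFin; apply/integrable_restrict => //; rewrite setTI.
have Gy (y : R) : mu.-integrable `]-oo, y] (EFin \o G).
  exact: integrableS GiT.
have Gloc : locally_integrable setT G by apply: integrable_locally_restrict.
have F0 y : \int[mu]_(t in `]-oo, y]) G t = 0.
  rewrite /Rintegral /G; under eq_integral do rewrite -[(_ \_ _) _]/(patch _ _ _ _).
  have -> : (\int[mu]_(x in `]-oo, y]) ((F \_ D0) x)%:E =
     \int[mu]_(x in `]-oo, y] `&` D0) (F x)%:E)%E.
    rewrite integral_mkcondr; apply: eq_integral => x _.
    by rewrite !patchE; case: ifP.
  have [y0|y0] := ltP y 0.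
    rewrite (_ : _ `&` _ = set0) ?integral_set0//; apply/seteqP; split => x //= [].
    by rewrite !in_itv /= => xy /andP[x0 _]; lra.
  have [y2|y2] := leP y (2 * pi).
    rewrite (_ : _ `&` _ = `[0, y]%classic) ?h0//; apply/seteqP; split => x /=.
      by rewrite !in_itv /= => -[-> /andP[-> _]].
    by rewrite !in_itv /= => /andP[-> xy]; rewrite xy; split=> //; exact: le_trans xy y2.
  have p0 : 0 <= 2 * pi :> R by rewrite ltW ?twopi_gt0.
  rewrite (_ : _ `&` _ = D0) ?h0//; apply/seteqP; split => x /=; first by case.
  rewrite !in_itv /= => /andP[x0 x2]; split; last by apply/andP.
  exact: le_trans x2 (ltW y2).
have := FTC1Ny Gy Gloc => /= hae.
have : ae_eq mu D0 (EFin \o F) (cst 0%E).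
  apply: aeS hae => x [_ +] xD.
  rewrite (_ : (fun x => _) = cst 0); last by apply/funext => y; exact: F0.
  by rewrite derive1_cst /G patchE mem_set// => e /=; rewrite -e.
have mF : measurable_fun D0 (EFin \o F) by case/integrableP: Fi.
by move/(ae_eq_integral_abs mu mD mF).
Qed.

Lemma ae_zero_everywhere (F : R -> R) : measurable_fun [set: R] F -> periodic2pi F ->
  (\int[mu]_(x in D0) `|F x|%:E = 0)%E -> {ae mu, forall x, F x = 0}.
Proof.
move=> mF pF h0.
pose H x := `|F x|.
have mH : measurable_fun [set: R] H by exact: measurableT_comp.
have H0 x : 0 <= H x by rewrite normr_ge0.
have pH : periodic2pi H by move=> x; rewrite /H pF.
have hn (n : nat) : (\int[mu]_(x in `[(- (n%:R * (2 * pi)))%R, (n%:R * (2 * pi))%R]) (H x)%:E = 0)%E.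
  elim: n => [|n IH]; first by rewrite mul0r oppr0 set_itv1 integral_set1.
  have p0 : 0 <= n%:R * (2 * pi) :> R by rewrite mulr_ge0// ltW// twopi_gt0.
  have t0 := twopi_gt0 R.
  rewrite -natr1 mulrDl mul1r opprD.
  rewrite (@ge0_integral_split _ _ _ (- (n%:R * (2 * pi))))//; [|by lra|by lra].
  rewrite (@ge0_integral_split _ _ _ (n%:R * (2 * pi)))//; [|by lra|by lra].
  rewrite IH add0e ge0_integral_period//.
  have := @ge0_integral_period _ H (- (n%:R * (2 * pi)) - 2 * pi) mH H0 pH.
  by rewrite subrK => ->; rewrite h0 adde0.
have hN (n : nat) : {ae mu, forall x, `[(- (n%:R * (2 * pi)))%R, (n%:R * (2 * pi))%R]%classic x -> F x = 0}.
  have mFn : measurable_fun (`[(- (n%:R * (2 * pi)))%R, (n%:R * (2 * pi))%R]%classic : set R) (EFin \o F).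
    by apply: measurable_funTS; exact/measurable_EFinP.
  have := hn n; have /= hh := ae_eq_integral_abs mu (measurable_itv _) mFn.
  by move=> /hh; apply: aeS => x h /h [].
have := ae_foralln hN; apply: aeS => x hx.
apply: (hx (Num.truncn (`|x| / (2 * pi))).+1) => /=; rewrite in_itv /= -ler_norml.
rewrite -ler_pdivrMr ?twopi_gt0//; exact: ltW (Num.Theory.truncnS_gt _).
Qed.

(** Products with the bumps of an interval have mean zero, so the integral over
    every interval vanishes. *)
Theorem fourier_unique f :
  measurable_fun [set: R] (fun x => Re_ (f x)) ->
  measurable_fun [set: R] (fun x => Im_ (f x)) ->
  periodic2pi f -> cintegrable f -> (forall n, fourier f n = 0) ->
  {ae mu, forall x, f x = 0}.
Proof.
move=> m1 m2 pf fi f0; have hf : no_frequency f by [].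
have key a b n : circle_int (fun x => f x * (bump a b n x)%:C) = 0.
  have [gi g0] := no_frequency_bump a b n hf.
  have := g0 0; rewrite /fourier; under eq_fun do rewrite mul0r oppr0 expi0 mulr1.
  move/eqP; rewrite mulf_eq0 => /orP[|/eqP//].
  by rewrite eq_complex /= eqxx andbT invr_eq0 gt_eqF// twopi_gt0.
have fin0 (G : R -> R) : integrable_on_period G -> \int[mu]_(x in D0) G x = 0 ->
    (\int[mu]_(x in D0) (G x)%:E = 0)%E.
  move=> Gi; rewrite /Rintegral => h; rewrite -[LHS]fineK ?h//.
  exact: integrable_fin_num.
have r (a b : R) n : (fun x => Re_ (f x * (bump a b n x)%:C)) = (fun x => Re_ (f x) * bump a b n x).
  by apply/funext => x; rewrite Re_M /= mulr0 subr0.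
have i (a b : R) n : (fun x => Im_ (f x * (bump a b n x)%:C)) = (fun x => Im_ (f x) * bump a b n x).
  by apply/funext => x; rewrite Im_M /= mulr0 add0r.
have hRe : {ae mu, forall x, Re_ (f x) = 0}.
  apply: ae_zero_everywhere => //; first by move=> x; rewrite pf.
  case: (fi) => i1 i2; apply: ae_zero_on_period => // a b a0 ab b2.
  apply: interval_integral_eq0 => // n.
  have [[j1 j2] _] := no_frequency_bump a b n hf.
  have := congr1 (@Re_ R) (key a b n); rewrite /circle_int /=.
  by move: j1; rewrite r => j1 /(fin0 _ j1).
have hIm : {ae mu, forall x, Im_ (f x) = 0}.
  apply: ae_zero_everywhere => //; first by move=> x; rewrite pf.
  case: (fi) => i1 i2; apply: ae_zero_on_period => // a b a0 ab b2.
  apply: interval_integral_eq0 => // n.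
  have [[j1 j2] _] := no_frequency_bump a b n hf.
  have := congr1 (@Im_ R) (key a b n); rewrite /circle_int /=.
  by move: j2; rewrite i => j2 /(fin0 _ j2).
by have := aeI hRe hIm; apply: aeS => x [h1 h2]; apply: complex_ext.
Qed.

Lemma ae_zero_continuous (F : R -> R) : continuous F -> {ae mu, forall x, F x = 0} ->
  forall x, F x = 0.
Proof.
move=> cF [N [mN N0 hN]] x; apply: contrapT => /eqP Fx.
have Fx0 : 0 < `|F x| by rewrite normr_gt0.
have := cF x => /cvgrPdist_lt/(_ _ Fx0) [e /= e0 he].
have sub : ball x e `<=` N.
  move=> y /he h; apply: hN => /= Fy; move: h; rewrite Fy subr0; by rewrite ltxx.
have mb : measurable (ball x e : set R) by exact: measurable_ball.
have := le_measure mu (mem_set mb) (mem_set mN) sub.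
move=> hle; have : ((e *+ 2)%:E <= 0%:E)%E.
  by rewrite -(lebesgue_measure_ball x (ltW e0)) -(N0 : mu N = 0%:E).
rewrite lee_fin leNgt => /negP; apply.
by rewrite mulrn_wgt0.
Qed.

(** The difference vanishes almost everywhere, hence everywhere by continuity. *)
Lemma fourier_unique_continuous f g : ccont f -> ccont g -> periodic2pi f ->
  periodic2pi g -> (forall n, fourier f n = fourier g n) -> forall x, f x = g x.
Proof.
move=> cf cg pf pg e x; apply/eqP; rewrite -subr_eq0; apply/eqP.
have fi := ccont_cintegrable cf; have gi := ccont_cintegrable cg.
have [c1 c2] : ccont (fun x => f x - g x) by apply: ccontD => //; exact: ccontN.
have := @fourier_unique (fun x => f x - g x) (continuous_measurable_fun c1)
  (continuous_measurable_fun c2) _ (cintegrableB fi gi) _.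
case=> [y|n|N hN]; rewrite ?pf ?pg ?fourierB// ?e ?subrr//.
have ae0 : {ae mu, forall x, f x - g x = 0} by exists N.
apply: complex_ext.
  apply: (ae_zero_continuous c1); apply: aeS ae0 => y /= ->; exact: erefl.
apply: (ae_zero_continuous c2); apply: aeS ae0 => y /= ->; exact: erefl.
Qed.

(** The Fourier series converges uniformly because its coefficients decay like
    [n^-2]; its sum is continuous and has the same coefficients as [f]. *)
Lemma C2_uniform_series f f1 f2 : cderiv f f1 -> cderiv f1 f2 -> ccont f2 ->
  periodic2pi f -> uniform_series f (fourier f).
Proof.
move=> d1 d2 c2 pf; have [C hC] := C2_sq_decay d1 d2 c2 pf.
have [g hg] := uniform_series_exists hC.
have fg : f = g.
  apply/funext; apply: fourier_unique_continuous => //.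
  - exact: cderiv_cont d1.
  - exact: uniform_series_ccont hg.
  - exact: uniform_series_periodic hg.
  - by move=> n; rewrite (uniform_series_fourier n hg).
by rewrite {1}fg.
Qed.

End Uniqueness.

(** * The space H^{1/2}, read on Fourier coefficients *)
Section HalfSpaceKit.
Variable R : realType.
Local Notation mu := (@lebesgue_measure R).
Local Notation D0 := (`[(0:R), (2 * pi)%R]%classic).
Implicit Types (f g u v w : R -> R[i]) (F G : int -> R[i]).

Lemma measurable_absC2 u : measurable_fun [set: R] (fun x => Re_ (u x)) ->
  measurable_fun [set: R] (fun x => Im_ (u x)) ->
  measurable_fun [set: R] (fun x => absC2 (u x)).
Proof.
by move=> m1 m2; apply: measurable_funD; apply: measurable_funX.
Qed.

Lemma L2circle_cintegrable u : L2circle u -> cintegrable u.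
Proof.
move=> [pu m1 m2 fin].
have ai : mu.-integrable D0 (fun x => (absC2 (u x))%:E).
  apply/integrableP; split.
    by apply: measurable_funTS; apply/measurable_EFinP; exact: measurable_absC2.
  by under eq_integral do rewrite gee0_abs ?lee_fin ?absC2_ge0//.
have ci : mu.-integrable D0 (EFin \o (fun=> 1 : R)).
  by apply: continuous_integrable; exact: cst_continuous.
have ki := @integrableD _ _ _ mu D0 (measurable_itv _) _ _ ai ci.
have h (G : R -> R) : measurable_fun [set: R] G -> (forall x, G x ^+ 2 <= absC2 (u x)) ->
    integrable_on_period G.
  move=> mG GA; apply: le_integrable ki => //.
    by apply: measurable_funTS; exact/measurable_EFinP.
  move=> x _ /=; rewrite lee_fin.
  have a0 := absC2_ge0 (u x).
  have a1 : 0 <= absC2 (u x) + 1 by rewrite (le_trans a0)// lerDl.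
  rewrite (ger0_norm a1).
  have := GA x; rewrite -(real_normK (num_real (G x))).
  move: `|G x| (normr_ge0 (G x)) => t t0 ht; nra.
split; apply: h => // x; first by rewrite /absC2 lerDl sqr_ge0.
by rewrite /absC2 lerDr sqr_ge0.
Qed.

Lemma ccont_L2circle u : ccont u -> periodic2pi u -> L2circle u.
Proof.
move=> [c1 c2] pu; split => //; try exact: continuous_measurable_fun.
have : mu.-integrable D0 (EFin \o (fun x => absC2 (u x))).
  apply: continuous_integrable => x.
  apply: cvgD; [apply: (continuous_comp (c1 x) (@exprn_continuous _ 2 _))
               |apply: (continuous_comp (c2 x) (@exprn_continuous _ 2 _))].
move=> /integrableP[_]; apply: le_lt_trans; apply: ge0_le_integral => //.
- by move=> x _; rewrite lee_fin absC2_ge0.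
- by apply: measurable_funTS; apply/measurable_EFinP; apply: measurable_absC2;
    exact: continuous_measurable_fun.
- apply: measurable_funTS; apply: measurableT_comp => //; apply/measurable_EFinP.
  by apply: measurable_absC2; exact: continuous_measurable_fun.
- by move=> x _ /=; rewrite lee_fin ler_norm.
Qed.

Lemma absC2D (z w : R[i]) : absC2 (z + w) <= 2 * absC2 z + 2 * absC2 w.
Proof.
rewrite -subr_ge0 /absC2 Re_D Im_D.
rewrite (_ : _ - _ = (Re_ z - Re_ w) ^+ 2 + (Im_ z - Im_ w) ^+ 2); last by ring.
by rewrite addr_ge0 ?sqr_ge0.
Qed.

Lemma absC2M (z w : R[i]) : absC2 (z * w) = absC2 z * absC2 w.
Proof. by rewrite /absC2 Re_M Im_M; ring. Qed.

Lemma absC2N (z : R[i]) : absC2 (- z) = absC2 z.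
Proof. by rewrite /absC2 Re_N Im_N !sqrrN. Qed.

Lemma absC2_0 : absC2 (0 : R[i]) = 0.
Proof. by rewrite /absC2 /= expr0n addr0. Qed.

Lemma absC2_eq0 (z : R[i]) : absC2 z <= 0 -> z = 0.
Proof.
move=> h; apply: normc_eq0P; rewrite -(@ler_pXn2r _ 2) ?nnegrE ?normc_ge0//.
by rewrite -absC2E expr0n.
Qed.

Lemma L2circleD u v : L2circle u -> L2circle v -> L2circle (fun x => u x + v x).
Proof.
move=> [pu m1 m2 fu] [pv n1 n2 fv].
have mr : measurable_fun [set: R] (fun x => Re_ (u x + v x)).
  by under eq_fun do rewrite Re_D; exact: measurable_funD.
have mi : measurable_fun [set: R] (fun x => Im_ (u x + v x)).
  by under eq_fun do rewrite Im_D; exact: measurable_funD.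
split => //; first by move=> x; rewrite pu pv.
have ma := measurable_absC2 m1 m2; have mb := measurable_absC2 n1 n2.
have mE (G : R -> R) : measurable_fun [set: R] G -> measurable_fun D0 (fun x => (G x)%:E).
  by move=> mG; apply: measurable_funTS; exact/measurable_EFinP.
apply: (@le_lt_trans _ _ (\int[mu]_(x in D0) ((2%:E * (absC2 (u x))%:E) +
   (2%:E * (absC2 (v x))%:E)))%E).
  apply: ge0_le_integral => //.
  - by move=> x _; rewrite lee_fin absC2_ge0.
  - by apply: mE; exact: measurable_absC2.
  - by apply: emeasurable_funD; apply: emeasurable_funM => //; exact: mE.
  - by move=> x _; rewrite -!EFinM -EFinD lee_fin absC2D.
rewrite ge0_integralD//.
- rewrite !ge0_integralZl//; try exact: mE.
  + by rewrite lte_add_pinfty// lte_mul_pinfty.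
  + by move=> x _; rewrite lee_fin absC2_ge0.
  + by move=> x _; rewrite lee_fin absC2_ge0.
- by move=> x _; rewrite mule_ge0// lee_fin absC2_ge0.
- by apply: emeasurable_funM => //; exact: mE.
- by move=> x _; rewrite mule_ge0// lee_fin absC2_ge0.
- by apply: emeasurable_funM => //; exact: mE.
Qed.

Lemma L2circleZ (c : R[i]) u : L2circle u -> L2circle (fun x => c * u x).
Proof.
move=> [pu m1 m2 fu]; split.
- by move=> x; rewrite pu.
- under eq_fun do rewrite Re_M.
  by apply: measurable_funB; apply: measurable_funM.
- under eq_fun do rewrite Im_M.
  by apply: measurable_funD; apply: measurable_funM.
under eq_integral do rewrite absC2M EFinM.
rewrite ge0_integralZl//.
- by rewrite lte_mul_pinfty ?lee_fin ?absC2_ge0.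
- by apply: measurable_funTS; apply/measurable_EFinP; exact: measurable_absC2.
- by move=> x _; rewrite lee_fin absC2_ge0.
- by rewrite lee_fin absC2_ge0.
Qed.

Lemma L2circleB u v : L2circle u -> L2circle v -> L2circle (fun x => u x - v x).
Proof.
move=> hu hv; have := L2circleD hu (L2circleZ (-1) hv).
by under eq_fun do rewrite mulN1r.
Qed.

Lemma L2circle_lift u (h hp g : R -> R) : lift h hp g -> L2circle u -> L2circle (u \o h).
Proof.
move=> hl [pu m1 m2 fu].
have mh := lift_measurable hl.
have mr : measurable_fun [set: R] (fun x => Re_ ((u \o h) x)).
  exact: (measurableT_comp m1 mh).
have mi : measurable_fun [set: R] (fun x => Im_ ((u \o h) x)).
  exact: (measurableT_comp m2 mh).
split => //; first by move=> x /=; rewrite (lift_shift hl) pu.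
have cV : continuous (fun x => (hp x)^-1).
  by move=> x; apply: cvgV; [rewrite gt_eqF// (lift_pos hl)|exact: (lift_cont hl)].
have [M M0 hM] := continuous_bounded_segment 0 (2 * pi) cV.
have ma := measurable_absC2 m1 m2.
apply: (@le_lt_trans _ _ (\int[mu]_(x in D0) (M%:E * (absC2 (u (h x)) * hp x)%:E))%E).
  apply: ge0_le_integral => //.
  - by move=> x _; rewrite lee_fin absC2_ge0.
  - by apply: measurable_funTS; apply/measurable_EFinP; exact: (measurable_absC2 mr mi).
  - apply: measurable_funTS; apply: emeasurable_funM => //; apply/measurable_EFinP.
    apply: measurable_funM; first exact: (measurable_absC2 mr mi).
    exact: continuous_measurable_fun (lift_cont hl).
  - move=> x; rewrite /= in_itv/= => xD; rewrite -EFinM lee_fin mulrCA ler_peMr ?absC2_ge0//.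
    have hp0 := lift_pos hl x.
    rewrite -(@ler_pM2r _ (hp x)^-1) ?invr_gt0// mul1r -mulrA divff ?gt_eqF// mulr1.
    exact: le_trans (ler_norm _) (hM x xD).
rewrite ge0_integralZl//.
- rewrite (lift_subst_ge0 hl (f := fun x => absC2 (u x)))//.
  + by rewrite lte_mul_pinfty// lee_fin ltW.
  + by move=> x; exact: absC2_ge0.
  + by move=> x; rewrite pu.
- apply: measurable_funTS; apply/measurable_EFinP.
  apply: measurable_funM; first exact: (measurable_absC2 mr mi).
  exact: continuous_measurable_fun (lift_cont hl).
- by move=> x _; rewrite lee_fin mulr_ge0 ?absC2_ge0// ltW ?(lift_pos hl).
- by rewrite lee_fin ltW.
Qed.

(** ** Partial sums of the square norm *)

Definition wsum F (N : nat) : R :=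
  \sum_(1 <= n < N) n%:R * (absC2 (F n%:Z) + absC2 (F (- n%:Z))).

Lemma wsum_term_ge0 F (n : nat) : 0 <= n%:R * (absC2 (F n%:Z) + absC2 (F (- n%:Z))) :> R.
Proof. by rewrite mulr_ge0// addr_ge0// absC2_ge0. Qed.

Lemma wsum_ge0 F N : 0 <= wsum F N.
Proof. by apply: sumr_ge0 => n _; exact: wsum_term_ge0. Qed.

Lemma wsum_mono F N M : (N <= M)%N -> wsum F N <= wsum F M.
Proof.
move=> NM; have [N1|N1] := leqP 1 N.
  rewrite /wsum (@big_cat_nat _ _ _ N 1 M)//= lerDl.
  by apply: sumr_ge0 => n _; exact: wsum_term_ge0.
by rewrite /wsum big_geq ?wsum_ge0// ltnW.
Qed.

Lemma sqnormH_le u (K : R) :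
  (sqnormH u <= K%:E)%E <-> forall N, wsum (fourier u) N <= K.
Proof.
have e0 n : (0 <= (n%:R * (absC2 (fourier u n%:Z) + absC2 (fourier u (- n%:Z))))%:E)%E.
  by rewrite lee_fin wsum_term_ge0.
split => [h N|h].
  rewrite -lee_fin -sumEFin; apply: le_trans h.
  exact: nneseries_lim_ge.
apply: lime_le; first by apply: is_cvg_nneseries => n _ _.
by apply: nearW => N; rewrite sumEFin lee_fin; exact: h.
Qed.

Lemma sqnormH_ge0 u : (0 <= sqnormH u)%E.
Proof. by apply: nneseries_ge0 => n _ _; rewrite lee_fin wsum_term_ge0. Qed.

Lemma sqnormH_lty u : (sqnormH u < +oo)%E <-> exists K, forall N, wsum (fourier u) N <= K.
Proof.
split => [h|[K /sqnormH_le]]; last by move/le_lt_trans; apply; exact: ltry.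
exists (fine (sqnormH u)); apply/sqnormH_le.
by rewrite fineK// ge0_fin_numE// sqnormH_ge0.
Qed.

Lemma normH_le u (k : R) : 0 <= k ->
  (normH u <= k%:E)%E <-> forall N, wsum (fourier u) N <= k ^+ 2.
Proof.
move=> k0; rewrite -sqnormH_le /normH.
have [s0|] := boolP (sqnormH u == +oo%E).
  rewrite (eqP s0) /=; split => //.
rewrite -ltey => sy.
have sf : sqnormH u \is a fin_num by rewrite ge0_fin_numE// sqnormH_ge0.
rewrite -(fineK sf) /= !lee_fin.
have f0 : 0 <= fine (sqnormH u) by rewrite fine_ge0// sqnormH_ge0.
rewrite -{2}(sqr_sqrtr f0) ler_pXn2r ?nnegrE ?sqrtr_ge0//.
Qed.

(** [b = true] is the side of H^{1/2}_+, so that both signs are treated at once. *)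
Definition freq (b : bool) (n : nat) : int := if b then n%:Z else - n%:Z.

Definition trigpoly (b : bool) (N : nat) (c : nat -> R[i]) : R -> R[i] :=
  fun x => \sum_(1 <= n < N) c n * chi (freq b n) x.

Definition Hsgn (b : bool) u := Hhalf u /\ forall e : R, 0 < e ->
  exists N c, (normH (sub_fun u (trigpoly b N c)) < e%:E)%E.

Lemma HplusE : @Hplus R = Hsgn true. Proof. by []. Qed.

Lemma HminusE : @Hminus R = Hsgn false.
Proof.
have e : @trigpoly_minus R = trigpoly false.
  apply/funext => N; apply/funext => c; apply/funext => x.
  by apply: eq_bigr => n _; rewrite /= chiN.
by apply/funext => u; rewrite /Hminus e.
Qed.

Lemma ccont_trigpoly b N c : ccont (trigpoly b N c).
Proof.
by apply: ccont_sum => n; apply: ccontM; [exact: ccont_cst|exact: ccont_chi].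
Qed.

Lemma trigpoly_periodic b N c : periodic2pi (trigpoly b N c).
Proof. by move=> x; apply: eq_bigr => n _; rewrite chi_periodic. Qed.

Lemma fourier_trigpoly b N c k : fourier (trigpoly b N c) k =
  \sum_(1 <= n < N) c n * (freq b n == k)%:R.
Proof.
rewrite fourier_sum; last first.
  by move=> n; apply/ccont_cintegrable/ccontM; [exact: ccont_cst|exact: ccont_chi].
apply: eq_bigr => n _; rewrite fourierZ ?fourier_chi//.
exact/ccont_cintegrable/ccont_chi.
Qed.

Lemma fourier_trigpoly_same b N c (m : nat) : (0 < m)%N ->
  fourier (trigpoly b N c) (freq b m) = if (m < N)%N then c m else 0.
Proof.
move=> m0; rewrite fourier_trigpoly.
have e n : (freq b n == freq b m) = (n == m) by case: b => /=; lia.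
under eq_bigr do rewrite e.
case: ifP => mN.
  rewrite (bigD1_seq m)//= ?iota_uniq ?mem_index_iota ?m0 ?mN//.
  by rewrite eqxx mulr1 big1 ?addr0// => k /negbTE ->; exact: mulr0.
rewrite big_nat_cond big1 // => k; rewrite andbT => /andP[k1 kN].
by rewrite (_ : (k == m) = false) ?mulr0//; lia.
Qed.

Lemma fourier_trigpoly_opp b N c (m : nat) : (0 < m)%N ->
  fourier (trigpoly b N c) (freq (~~ b) m) = 0.
Proof.
move=> m0; rewrite fourier_trigpoly big_nat_cond big1 // => k; rewrite andbT => /andP[k1 kN].
by rewrite (_ : (_ == _) = false) ?mulr0//; case: b => /=; lia.
Qed.

Lemma Hhalf_cintegrable u : Hhalf u -> cintegrable u.
Proof. by case=> /L2circle_cintegrable. Qed.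

Lemma wsum_freq b F N : wsum F N =
  \sum_(1 <= n < N) n%:R * (absC2 (F (freq b n)) + absC2 (F (freq (~~ b) n))).
Proof. by apply: eq_bigr => n _; case: b => //=; rewrite addrC. Qed.

Lemma wsum_single F b (n : nat) : (0 < n)%N ->
  n%:R * absC2 (F (freq b n)) <= wsum F n.+1.
Proof.
move=> n0; rewrite (wsum_freq b) big_nat_recr//=.
set S := \sum_(_ <= _ < _) _.
have S0 : 0 <= S by apply: sumr_ge0 => k _; rewrite mulr_ge0// addr_ge0// absC2_ge0.
have n1 : (0 : R) <= n%:R by [].
move: (absC2_ge0 (F (freq (~~ b) n))) S0 n1.
by move: (absC2 (F (freq b n))) (absC2 _) S (n%:R : R) => x y s t y0 s0 t0; nra.
Qed.

Lemma bounded_sum_tail (a : nat -> R) (K : R) : (forall n, 0 <= a n) ->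
  (forall N, \sum_(1 <= n < N) a n <= K) -> forall e : R, 0 < e ->
  exists N, (0 < N)%N /\ forall M, \sum_(N <= n < M) a n <= e.
Proof.
move=> a0 aK e e0; pose S := [set \sum_(1 <= n < N) a n | N in [set: nat]].
have hS : has_sup S.
  split; first by exists (\sum_(1 <= n < 0) a n); exists 0%N.
  by exists K => _ [N _ <-].
have [_ [N _ <-] hN] := sup_adherent e0 hS.
exists N.+1; split => // M; have [NM|MN] := leqP N.+1 M; last by rewrite big_geq ?ltW// ltnW.
have hM : \sum_(1 <= n < M) a n <= sup S by apply: sup_upper_bound => //; exists M.
have hN' : \sum_(1 <= n < N) a n <= \sum_(1 <= n < N.+1) a n.
  case: (N) => [|N']; first by rewrite !big_geq.
  by rewrite [leRHS]big_nat_recr//= lerDl.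
move: hM; rewrite (@big_cat_nat _ _ _ N.+1 1 M)//= => hM.
move: hM hN hN'; move: (\sum_(_ <= _ < M) _) (\sum_(1 <= n < N) _) (\sum_(1 <= n < _) _) (sup S).
by move=> x y z s; lra.
Qed.

(** The distance from [u] to the trigonometric polynomials of one sign bounds every
    coefficient of the other sign. Conversely the truncations of [u] converge to
    [u], since the tails of its square norm tend to 0. *)
Lemma HsgnP b u : Hsgn b u <->
  Hhalf u /\ forall n : nat, (0 < n)%N -> fourier u (freq (~~ b) n) = 0.
Proof.
split=> -[hu h]; split => //.
  move=> n n0; apply: absC2_eq0; apply/ler_addgt0Pr => e e0; rewrite add0r.
  have es : 0 < Num.sqrt e by rewrite sqrtr_gt0.
  have [N [c /ltW]] := h _ es.
  move/(normH_le _ (ltW es)) => /(_ n.+1); rewrite (sqr_sqrtr (ltW e0)).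
  move=> hle; have := le_trans (wsum_single _ (~~ b) n0) hle.
  rewrite fourierB//; last 2 first.
  - exact: Hhalf_cintegrable.
  - exact/ccont_cintegrable/ccont_trigpoly.
  rewrite fourier_trigpoly_opp// subr0; apply: le_trans.
  by rewrite ler_peMl ?absC2_ge0// ler1n.
move=> e e0; have [_ /sqnormH_lty[K hK]] := hu.
have e2 : 0 < (e / 2) ^+ 2 by rewrite exprn_gt0// divr_gt0.
have [N [N0 hN]] := bounded_sum_tail (wsum_term_ge0 (fourier u)) hK e2.
exists N, (fun n => fourier u (freq b n)).
apply: (@le_lt_trans _ _ (e / 2)%:E); last by rewrite lte_fin ltr_pdivrMr// ltr_pMr// ltr1n.
apply/normH_le => [|M]; first by rewrite divr_ge0// ltW.
have fE k : fourier (sub_fun u (trigpoly b N (fun n => fourier u (freq b n)))) k =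
    fourier u k - fourier (trigpoly b N (fun n => fourier u (freq b n))) k.
  rewrite fourierB//; first exact: Hhalf_cintegrable.
  exact/ccont_cintegrable/ccont_trigpoly.
apply: (le_trans (wsum_mono _ (leq_maxr N M))).
rewrite (wsum_freq b) (@big_cat_nat _ _ _ N 1 (maxn N M)) ?leq_maxl//=.
rewrite big_nat_cond big1 ?add0r; last first.
  move=> n; rewrite andbT => /andP[n1 nN]; rewrite !fE fourier_trigpoly_same// nN.
  by rewrite subrr fourier_trigpoly_opp// h// subr0 absC2_0 addr0 mulr0.
apply: le_trans (hN (maxn N M)).
rewrite big_nat_cond [leRHS]big_nat_cond; apply: ler_sum => n; rewrite andbT => /andP[Nn _].
have n0 : (0 < n)%N by exact: leq_trans Nn.
rewrite !fE fourier_trigpoly_same// ltnNge Nn /= fourier_trigpoly_opp// !subr0.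
by case: (b) => //=; rewrite addrC.
Qed.

Lemma wsum_ext F G N : (forall n, n != 0 -> F n = G n) -> wsum F N = wsum G N.
Proof.
move=> h; rewrite /wsum big_nat_cond [RHS]big_nat_cond.
apply: eq_bigr => n; rewrite andbT => /andP[n1 _]; rewrite !h//; lia.
Qed.

Lemma wsumD F G N : wsum (fun n => F n + G n) N <= 2 * wsum F N + 2 * wsum G N.
Proof.
rewrite /wsum !mulr_sumr -big_split /=; apply: ler_sum => n _.
have n0 : (0 : R) <= n%:R by [].
have h1 := absC2D (F n%:Z) (G n%:Z); have h2 := absC2D (F (- n%:Z)) (G (- n%:Z)).
rewrite mulrCA [X in _ <= _ + X]mulrCA -mulrDr ler_wpM2l//; lra.
Qed.

Lemma wsumZ (c : R[i]) F N : wsum (fun n => c * F n) N = absC2 c * wsum F N.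
Proof.
by rewrite /wsum mulr_sumr; apply: eq_bigr => n _; rewrite !absC2M -mulrDr mulrCA.
Qed.

Lemma Hhalf_intro u (K : R) : L2circle u -> (forall N, wsum (fourier u) N <= K) -> Hhalf u.
Proof. by move=> hu hK; split => //; apply/sqnormH_lty; exists K. Qed.

Lemma HhalfP u : Hhalf u <-> L2circle u /\ exists K, forall N, wsum (fourier u) N <= K.
Proof. by rewrite /Hhalf; split=> -[h1 /sqnormH_lty]. Qed.

Lemma HhalfD u v : Hhalf u -> Hhalf v -> Hhalf (fun x => u x + v x).
Proof.
move=> /HhalfP[u2 [K hK]] /HhalfP[v2 [L hL]].
apply: (@Hhalf_intro _ (2 * K + 2 * L)); first exact: L2circleD.
move=> N; rewrite (wsum_ext (G := fun n => fourier u n + fourier v n)); last first.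
  by move=> n _; rewrite fourierD//; exact: L2circle_cintegrable.
by apply: le_trans (wsumD _ _ _) _; apply: lerD; rewrite ler_wpM2l.
Qed.

Lemma HhalfZ (c : R[i]) u : Hhalf u -> Hhalf (fun x => c * u x).
Proof.
move=> /HhalfP[u2 [K hK]].
apply: (@Hhalf_intro _ (absC2 c * K)); first exact: L2circleZ.
move=> N; rewrite (wsum_ext (G := fun n => c * fourier u n)); last first.
  by move=> n _; rewrite fourierZ//; exact: L2circle_cintegrable.
by rewrite wsumZ ler_wpM2l ?absC2_ge0.
Qed.

Lemma HhalfB u v : Hhalf u -> Hhalf v -> Hhalf (fun x => u x - v x).
Proof.
move=> hu hv; have := HhalfD hu (HhalfZ (-1) hv).
by under eq_fun do rewrite mulN1r.
Qed.

(** ** Equality in H^{1/2} *)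

Lemma ae_eq_circle_int f g : cintegrable f -> cintegrable g ->
  {ae mu, forall x, f x = g x} -> circle_int f = circle_int g.
Proof.
move=> [f1 f2] [g1 g2] h.
have key (T : R[i] -> R) : integrable_on_period (fun x => T (f x)) ->
    integrable_on_period (fun x => T (g x)) ->
    \int[mu]_(x in D0) T (f x) = \int[mu]_(x in D0) T (g x).
  move=> i1 i2; rewrite /Rintegral; congr fine.
  apply: ae_eq_integral => //; [by case/integrableP: i1|by case/integrableP: i2|].
  by apply: aeS h => x -> _.
by apply: complex_ext; rewrite /=; exact: key.
Qed.

Lemma eqH_fourier u v n : cintegrable u -> cintegrable v -> eqH u v -> n != 0 ->
  fourier u n = fourier v n.
Proof.
move=> iu iv [c h] n0.
have ic : cintegrable (fun=> c) by apply: ccont_cintegrable; exact: ccont_cst.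
have ivc : cintegrable (fun x => v x + c) by exact: cintegrableD.
rewrite !fourierE /cmean (ae_eq_circle_int (g := fun x => (v x + c) * chi (- n) x)).
- rewrite -/(cmean _) -fourierE fourierD// -[RHS]addr0; congr (_ + _).
    by rewrite fourierE.
  rewrite fourierE cmeanZ; last by apply: ccont_cintegrable; exact: ccont_chi.
  by rewrite cmean_chi oppr_eq0 (negbTE n0) mulr0.
- exact: cintegrable_chi.
- exact: cintegrable_chi.
- by apply: aeS h => x ->.
Qed.

(** Up to its mean, the difference has no frequency. *)
Lemma fourier_eqH u v : L2circle u -> L2circle v ->
  (forall n, n != 0 -> fourier u n = fourier v n) -> eqH u v.
Proof.
move=> hu hv e; pose c := fourier u 0 - fourier v 0; exists c.
have iu := L2circle_cintegrable hu; have iv := L2circle_cintegrable hv.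
have c2 : L2circle (fun=> c) by apply: ccont_L2circle => //; exact: ccont_cst.
have hd : L2circle (fun x => u x - (v x + c)) by apply: L2circleB => //; exact: L2circleD.
have [pd m1 m2 _] := hd.
have ic := L2circle_cintegrable c2.
have := fourier_unique m1 m2 pd (L2circle_cintegrable hd).
have fc n : fourier (fun=> c) n = c * (n == 0)%:R.
  rewrite fourierE cmeanZ; last by apply: ccont_cintegrable; exact: ccont_chi.
  by rewrite cmean_chi oppr_eq0.
case=> [n|N hN]; last first.
  have h : {ae mu, forall x, u x - (v x + c) = 0} by exists N.
  by apply: aeS h => x /eqP; rewrite subr_eq0 => /eqP.
rewrite fourierB//; last exact: cintegrableD.
rewrite fourierD// fc; have [->|n0] := eqVneq n 0.
  by rewrite mulr1 /c; ring.
by rewrite mulr0 addr0 e// subrr.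
Qed.

(** ** Orthogonal projections *)

Lemma freq_eq b n m : (freq b n == freq b m) = (n == m).
Proof. by case: b => /=; lia. Qed.

Lemma freq_opp b n m : (0 < n)%N -> (freq b n == freq (~~ b) m) = false.
Proof. by case: b => /=; lia. Qed.

Lemma inner_termE b u w n : inner_term u w n =
  n%:R * (fourier u (freq b n) * conjc (fourier w (freq b n)) +
          fourier u (freq (~~ b) n) * conjc (fourier w (freq (~~ b) n))).
Proof. by rewrite /inner_term; case: b => //=; rewrite addrC. Qed.

Lemma conj_eq0 (z : R[i]) : z = 0 -> conjc z = 0.
Proof. by move=> ->; apply: complex_ext; rewrite /= ?oppr0. Qed.

Lemma conj_eq1 (z : R[i]) : z = 1 -> conjc z = 1.
Proof. by move=> ->; apply: complex_ext; rewrite /= ?oppr0. Qed.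

Lemma innerH_zero u w : (forall n : nat, (0 < n)%N -> inner_term u w n = 0) ->
  innerH u w = 0.
Proof.
move=> h; rewrite /innerH.
have z (T : R[i] -> R) : T 0 = 0 ->
    (fun N => \sum_(1 <= n < N) T (inner_term u w n)) = (fun=> 0).
  move=> T0; apply/funext => N; rewrite big_nat_cond big1// => n.
  by rewrite andbT => /andP[n1 _]; rewrite h.
by rewrite (z (@Re_ R))// (z (@Im_ R))// !lim_cst.
Qed.

Lemma innerH_chi u b (k : nat) : (0 < k)%N ->
  innerH u (chi (freq b k)) = k%:R * fourier u (freq b k).
Proof.
move=> k0.
have t (n : nat) : (0 < n)%N -> inner_term u (chi (freq b k)) n =
    if n == k then k%:R * fourier u (freq b k) else 0.
  move=> n0; rewrite (inner_termE b) !fourier_chi freq_eq.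
  rewrite [X in _ + _ * X]conj_eq0; last by rewrite [freq b k == _]freq_opp.
  by rewrite mulr0 addr0 eq_sym; case: eqVneq => [->|nk];
    [rewrite conj_eq1 ?mulr1|rewrite conj_eq0 ?mulr0].
have z (T : R[i] -> R) : T 0 = 0 ->
    limn (fun N => \sum_(1 <= n < N) T (inner_term u (chi (freq b k)) n)) =
    T (k%:R * fourier u (freq b k)).
  move=> T0; apply/cvg_lim => //; apply: cvg_near_cst; exists k.+1 => // N /= kN.
  rewrite (bigD1_seq k)//= ?iota_uniq ?mem_index_iota ?k0// t// eqxx.
  rewrite big_seq_cond big1 ?addr0// => n /andP[]; rewrite mem_index_iota => /andP[n1 _] nk.
  by rewrite t// (negbTE nk).
by rewrite /innerH (z (@Re_ R))// (z (@Im_ R))//; apply: complex_ext.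
Qed.

Lemma Hsgn_chi b (k : nat) : (0 < k)%N -> Hsgn b (chi (freq b k)).
Proof.
move=> k0; apply/HsgnP; split; last first.
  by move=> n n0; rewrite fourier_chi (_ : (_ == _) = false)//; case: b => /=; lia.
apply: (@Hhalf_intro _ k%:R).
  by apply: ccont_L2circle; [exact: ccont_chi|exact: chi_periodic].
move=> N; apply: (le_trans (wsum_mono _ (leq_maxl N k.+1))).
rewrite (wsum_freq b) (bigD1_seq k)//= ?iota_uniq ?mem_index_iota ?k0 ?leq_maxr//.
rewrite !fourier_chi eqxx freq_opp//.
rewrite big_seq_cond big1 ?addr0.
  by rewrite absC2_0 addr0 /absC2 /= expr0n expr1n addr0 mulr1.
move=> n /andP[]; rewrite mem_index_iota => /andP[n1 _] nk; rewrite !fourier_chi.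
by rewrite freq_eq eq_sym (negbTE nk) freq_opp// absC2_0 addr0 mulr0.
Qed.

(** Pairing with characters reads off coefficients; any [v] with the required
    coefficients is a projection, which shows that the chosen one exists. *)
Lemma orth_projP b u v : cintegrable u -> Hsgn b v ->
  (forall n : nat, (0 < n)%N -> fourier v (freq b n) = fourier u (freq b n)) ->
  Hsgn b (orth_proj (Hsgn b) u) /\
  forall n : nat, (0 < n)%N -> fourier (orth_proj (Hsgn b) u) (freq b n) = fourier u (freq b n).
Proof.
move=> iu hv e; rewrite /orth_proj; set S := [set _ | _].
have Sv : S v.
  split => // w /HsgnP[hw w0]; apply: innerH_zero => n n0.
  have hz : fourier (sub_fun u v) (freq b n) = 0.
    rewrite fourierB//; first by rewrite e// subrr.
    by case: hv => /Hhalf_cintegrable.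
  by rewrite (inner_termE b) hz mul0r add0r conj_eq0 ?mulr0//; exact: w0.
have [hv' hp] : S (xget (@zero_fun R) S) by apply: xgetPex; exists v.
split; first exact: hv'.
move=> n n0; have := hp _ (Hsgn_chi b n0); rewrite innerH_chi//.
move/eqP; rewrite mulf_eq0 pnatr_eq0 -leqn0 leqNgt n0 /= fourierB//; last first.
  by case: hv' => /Hhalf_cintegrable.
by rewrite subr_eq0 => /eqP ->.
Qed.

End HalfSpaceKit.

(** * Composition with a circle diffeomorphism *)
Section Composition.
Variable R : realType.
Local Notation mu := (@lebesgue_measure R).
Local Notation D0 := (`[(0:R), (2 * pi)%R]%classic).
Implicit Types (f u v w : R -> R[i]) (F G : int -> R[i]) (h g a : R -> R).

(** ** Twice differentiable functions *)

Definition is_C2 f := exists f1 f2, [/\ cderiv f f1, cderiv f1 f2 & ccont f2].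

Lemma is_C2_uniform_series f : is_C2 f -> periodic2pi f -> uniform_series f (fourier f).
Proof. by move=> [f1 [f2 [d1 d2 c2]]]; exact: C2_uniform_series d1 d2 c2. Qed.

Lemma is_C2_chi n : is_C2 (@chi R n).
Proof.
exists (fun x => 'i * (n%:~R)%:C * chi n x).
exists (fun x => 'i * (n%:~R)%:C * ('i * (n%:~R)%:C * chi n x)); split.
- exact: cderiv_chi.
- by apply: cderivZ; exact: cderiv_chi.
- by do 2 (apply: ccontM; first exact: ccont_cst); exact: ccont_chi.
Qed.

Lemma is_C2D f v : is_C2 f -> is_C2 v -> is_C2 (fun x => f x + v x).
Proof.
move=> [f1 [f2 [d1 d2 c2]]] [v1 [v2 [e1 e2 k2]]].
exists (fun x => f1 x + v1 x), (fun x => f2 x + v2 x).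
by split; [exact: cderivD|exact: cderivD|exact: ccontD].
Qed.

Lemma is_C2M f v : is_C2 f -> is_C2 v -> is_C2 (fun x => f x * v x).
Proof.
move=> [f1 [f2 [d1 d2 c2]]] [v1 [v2 [e1 e2 k2]]].
exists (fun x => f1 x * v x + f x * v1 x).
exists (fun x => f2 x * v x + f1 x * v1 x + (f1 x * v1 x + f x * v2 x)); split.
- exact: cderivM.
- by apply: cderivD; exact: cderivM.
have cf := cderiv_cont d1; have cf1 := cderiv_cont d2.
have cv := cderiv_cont e1; have cv1 := cderiv_cont e2.
by apply: ccontD; apply: ccontD; apply: ccontM.
Qed.

Lemma is_C2_cst (c : R[i]) : is_C2 (fun=> c).
Proof.
exists (fun=> 0), (fun=> 0); split; [exact: cderiv_cst|exact: cderiv_cst|exact: ccont_cst].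
Qed.

Lemma is_C2_sum (I : Type) (r : seq I) (X : I -> R -> R[i]) :
  (forall i, is_C2 (X i)) -> is_C2 (fun x => \sum_(i <- r) X i x).
Proof.
move=> hX; elim: r => [|i r IH].
  by under eq_fun do rewrite big_nil; exact: is_C2_cst.
by under eq_fun do rewrite big_cons; exact: is_C2D.
Qed.

Lemma smooth_deriv a k (x : R) : smooth a ->
  is_derive x 1 (derive1n k a) (derive1n k.+1 a x).
Proof. by move=> sa; rewrite derive1nS derive1E; apply: DeriveDef => //; exact: sa. Qed.

Lemma smooth_continuous a k : smooth a -> continuous (derive1n k a).
Proof. by move=> sa; apply: is_derive_cont => x; exact: smooth_deriv. Qed.

Lemma smooth_cont a : smooth a -> continuous a.
Proof. exact: (@smooth_continuous a 0). Qed.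

Lemma is_C2_real a : smooth a -> is_C2 (fun x => (a x)%:C).
Proof.
move=> sa; exists (fun x => (derive1n 1 a x)%:C), (fun x => (derive1n 2 a x)%:C); split.
- by apply: cderiv_real => x; exact: (smooth_deriv 0).
- by apply: cderiv_real => x; exact: (smooth_deriv 1).
- by apply: ccont_real; exact: smooth_continuous.
Qed.

Lemma smooth_derive1 a : smooth a -> smooth (derive1n 1 a).
Proof. by move=> sa k x; rewrite -derive1Sn; exact: sa. Qed.

Lemma cderiv_comp f f' h hp : cderiv f f' -> (forall x : R, is_derive x 1 h (hp x)) ->
  cderiv (fun x => f (h x)) (fun x => f' (h x) * (hp x)%:C).
Proof.
move=> df dh x; have [d1 d2] := df (h x); split.
  rewrite Re_M /= mulr0 subr0.
  exact: (@is_derive1_comp _ (fun y => Re_ (f y)) h x _ _ d1 (dh x)).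
rewrite Im_M /= mulr0 add0r.
exact: (@is_derive1_comp _ (fun y => Im_ (f y)) h x _ _ d2 (dh x)).
Qed.

Lemma is_C2_comp f h : is_C2 f -> smooth h -> is_C2 (fun x => f (h x)).
Proof.
move=> [f1 [f2 [d1 d2 c2]]] sh.
have dh k x := smooth_deriv k x sh.
exists (fun x => f1 (h x) * (derive1n 1 h x)%:C).
exists (fun x => f2 (h x) * (derive1n 1 h x)%:C * (derive1n 1 h x)%:C +
  f1 (h x) * (derive1n 2 h x)%:C); split.
- exact: cderiv_comp (dh 0).
- apply: cderivM; first exact: cderiv_comp (dh 0).
  by apply: cderiv_real => x; exact: dh.
have ch := smooth_cont sh.
have c1 := ccont_real (@smooth_continuous _ 1 sh).
have c3 := ccont_real (@smooth_continuous _ 2 sh).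
apply: ccontD; last by apply: ccontM => //; exact: ccont_comp (cderiv_cont d2) ch.
by do 2 (apply: ccontM => //); exact: ccont_comp.
Qed.

(** The Cauchy inequality with the weights [n] of the square norm; the factor 2
    bounds the sum of the [n^-2]. *)
Lemma sum_weighted_cauchy (K : R) (E w : nat -> R[i]) N :
  0 <= K -> (forall n, (0 < n)%N -> absC2 (E n) <= K / n%:R) ->
  absC2 (\sum_(1 <= n < N) E n * w n) <= 2 * K * \sum_(1 <= n < N) n%:R * absC2 (w n).
Proof.
move=> K0 hE.
pose a n := normc (E n) ^+ 2 / n%:R; pose b n := n%:R * absC2 (w n).
have CS (x y : nat -> R) M : (forall n, 0 <= x n) -> (forall n, 0 <= y n) ->
    (\sum_(1 <= n < M) Num.sqrt (x n) * Num.sqrt (y n)) ^+ 2 <=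
    (\sum_(1 <= n < M) x n) * (\sum_(1 <= n < M) y n).
  move=> x0 y0; elim: M => [|M IH]; first by rewrite !big_geq// mulr0 expr0n.
  have [M1|M1] := leqP 1 M; last by rewrite !big_geq ?mulr0 ?expr0n.
  rewrite !big_nat_recr//=.
  have X0 : 0 <= \sum_(1 <= n < M) x n by apply: sumr_ge0.
  have Y0 : 0 <= \sum_(1 <= n < M) y n by apply: sumr_ge0.
  have S0 : 0 <= \sum_(1 <= n < M) Num.sqrt (x n) * Num.sqrt (y n).
    by apply: sumr_ge0 => n _; rewrite mulr_ge0// sqrtr_ge0.
  move: IH X0 Y0 S0 (sqr_sqrtr (x0 M)) (sqr_sqrtr (y0 M)) (sqrtr_ge0 (x M)) (sqrtr_ge0 (y M)).
  move: (\sum_(1 <= n < M) Num.sqrt (x n) * Num.sqrt (y n)) (\sum_(1 <= n < M) x n) (\sum_(1 <= n < M) y n) => S X Y.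
  move: (Num.sqrt (x M)) (Num.sqrt (y M)) => p q IH X0 Y0 S0 <- <- p0 q0.
  have h : 2 * S * (p * q) <= X * q ^+ 2 + p ^+ 2 * Y.
    have s2 : (2 * S * (p * q)) ^+ 2 <= (X * q ^+ 2 + p ^+ 2 * Y) ^+ 2.
      have e1 : (2 * S * (p * q)) ^+ 2 = 4 * (p * q) ^+ 2 * S ^+ 2 by ring.
      have e2 : (X * q ^+ 2 + p ^+ 2 * Y) ^+ 2 =
        (X * q ^+ 2 - p ^+ 2 * Y) ^+ 2 + 4 * (p * q) ^+ 2 * (X * Y) by ring.
      rewrite e1 e2 -[leLHS]add0r lerD ?sqr_ge0// ler_wpM2l// mulr_ge0// sqr_ge0//.
    rewrite -(@ler_pXn2r _ 2)// nnegrE; first by rewrite !mulr_ge0.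
    by rewrite addr_ge0// mulr_ge0// exprn_ge0.
  by move: IH h; rewrite sqrrD mulrDl !mulrDr exprMn; lra.
have a0 n : 0 <= a n by rewrite divr_ge0// exprn_ge0// normc_ge0.
have b0 n : 0 <= b n by rewrite mulr_ge0// absC2_ge0.
have le1 : normc (\sum_(1 <= n < N) E n * w n) <=
    \sum_(1 <= n < N) Num.sqrt (a n) * Num.sqrt (b n).
  apply: (le_trans (normc_sum _ _ _)); rewrite big_nat_cond [leRHS]big_nat_cond.
  apply: ler_sum => n; rewrite andbT => /andP[n1 _].
  rewrite -sqrtrM// /a /b absC2E mulrA divfK ?pnatr_eq0 -?lt0n// -exprMn sqrtr_sqr.
  by rewrite Normc.normcM ger0_norm// mulr_ge0// normc_ge0.
rewrite absC2E; apply: (@le_trans _ _ ((\sum_(1 <= n < N) a n) * \sum_(1 <= n < N) b n)).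
  apply: le_trans (CS a b N a0 b0).
  by rewrite ler_pXn2r ?nnegrE ?normc_ge0// sumr_ge0// => n _; rewrite mulr_ge0// sqrtr_ge0.
apply: ler_wpM2r; first by apply: sumr_ge0.
apply: (@le_trans _ _ (K * \sum_(1 <= n < N) n%:R ^- 2)).
  rewrite mulr_sumr big_nat_cond [leRHS]big_nat_cond; apply: ler_sum => n; rewrite andbT => /andP[n1 _].
  rewrite /a -absC2E; apply: (le_trans (ler_wpM2r _ (hE n n1))); first by rewrite invr_ge0.
  by rewrite -mulrA -invfM -expr2.
by rewrite mulrC ler_wpM2r//; have := @sum_inv_sq R 1 N isT; rewrite divr1.
Qed.

(** ** Smooth lifts *)

(** Keeping the inverse in the data makes the notion symmetric in [h] and [g]. *)
Record slift h g : Prop := SLift {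
  sl_h : smooth h; sl_g : smooth g; sl_hg : cancel h g; sl_gh : cancel g h;
  sl_shift : forall x, h (x + 2 * pi) = h x + 2 * pi }.

Lemma slift_sym h g : slift h g -> slift g h.
Proof.
move=> hl; split; try by case: hl.
by move=> x; rewrite -{1}(sl_gh hl x) -(sl_shift hl) (sl_hg hl).
Qed.

Lemma diffeo_slift h : diffeo_lift h -> exists g, slift h g.
Proof. by move=> [sh hs [g [sg hg gh]]]; exists g. Qed.

Lemma slift_deriv_mul h g x : slift h g -> derive1n 1 g (h x) * derive1n 1 h x = 1.
Proof.
move=> hl; have d := @is_derive1_comp _ g h x _ _ (smooth_deriv 0 (h x) (sl_g hl))
  (smooth_deriv 0 x (sl_h hl)).
have e : g \o h = id by apply/funext => y; exact: (sl_hg hl).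
by case: d => _; rewrite e derive_id => <-.
Qed.

(** The derivative does not vanish and has mean 1 over a period, so it is
    positive. *)
Lemma slift_deriv_pos h g x : slift h g -> 0 < derive1n 1 h x.
Proof.
move=> hl; set hp := derive1n 1 h.
have nz y : hp y != 0.
  apply/eqP => e; have := slift_deriv_mul y hl; rewrite -/hp e mulr0 => /eqP.
  by rewrite eq_sym oner_eq0.
have dh (y : R) : is_derive y 1 h (hp y) := smooth_deriv 0 y (sl_h hl).
have chp : continuous hp := smooth_continuous (sl_h hl).
have [|c _ hc] := @MVT R h hp 0 (2 * pi) (twopi_gt0 R) (fun z _ => dh z).
  by apply: continuous_subspaceT; exact: is_derive_cont dh.
have hpc : hp c = 1.
  have := sl_shift hl 0; rewrite add0r => e; move: hc; rewrite e addrAC subrr add0r subr0.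
  by move=> /esym/(canRL (mulfK (lt0r_neq0 (twopi_gt0 R)))); rewrite divff ?gt_eqF ?twopi_gt0.
rewrite lt0r nz /= leNgt; apply/negP => xneg.
have [xc|cx] := leP x c.
  have [||z _ hz] := @IVT R hp x c 0 xc.
  - exact: continuous_subspaceT.
  - by rewrite hpc ge_min ltW//= le_max ler01 orbT.
  by have := nz z; rewrite hz eqxx.
have [||z _ hz] := @IVT R hp c x 0 (ltW cx).
- exact: continuous_subspaceT.
- by rewrite hpc ge_min (ltW xneg) orbT/= le_max ler01.
by have := nz z; rewrite hz eqxx.
Qed.

Lemma slift_lift h g : slift h g -> lift h (derive1n 1 h) g.
Proof.
move=> hl; split; try by case: hl.
- by move=> x; exact: smooth_deriv 0 x (sl_h hl).
- exact: smooth_continuous (sl_h hl).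
- by move=> x; exact: slift_deriv_pos hl.
Qed.

Section FixedLift.
Variables (h g : R -> R).
Hypothesis hl : slift h g.
Local Notation hp := (derive1n 1 h).
Local Notation gp := (derive1n 1 g).

Lemma comp_periodic u : periodic2pi u -> periodic2pi (u \o h).
Proof. by move=> pu x /=; rewrite (sl_shift hl) pu. Qed.

Lemma comp_L2circle u : L2circle u -> L2circle (u \o h).
Proof. exact: L2circle_lift (slift_lift hl). Qed.

(** Substitution of [g y] for [x], which moves the diffeomorphism from [u] to the
    smooth factor. *)
Lemma cmean_comp u v : L2circle u -> ccont v -> periodic2pi v ->
  cmean (fun x => u (h x) * v x) = cmean (fun y => u y * (v (g y) * (gp y)%:C)).
Proof.
move=> u2 cv pv; have [pu m1 m2 _] := u2.
have cg : continuous g := smooth_cont (sl_g hl).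
have cgp : ccont (fun y => (gp y)%:C) := ccont_real (smooth_continuous (sl_g hl)).
have ck : ccont (fun y => v (g y) * (gp y)%:C) by apply: ccontM => //; exact: ccont_comp.
have [k1 k2] := ck.
have mk1 := continuous_measurable_fun k1; have mk2 := continuous_measurable_fun k2.
have hl' := slift_lift (slift_sym hl).
have pk : periodic2pi (fun y => u y * (v (g y) * (gp y)%:C)).
  move=> y; rewrite pu (sl_shift (slift_sym hl)) pv.
  by rewrite (lift_deriv_periodic hl').
have ik : cintegrable (fun y => u y * (v (g y) * (gp y)%:C)).
  by apply: cintegrableM => //; exact: L2circle_cintegrable.
rewrite /cmean.
have [|| _ <-] := lift_csubst (slift_lift hl) _ _ pk ik.
- under eq_fun do rewrite Re_M.
  by apply: measurable_funB; apply: measurable_funM.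
- under eq_fun do rewrite Im_M.
  by apply: measurable_funD; apply: measurable_funM.
congr (_ * circle_int _); apply/funext => x.
by rewrite (sl_hg hl) -!mulrA -rmorphM /= (slift_deriv_mul x hl) mulr1.
Qed.

(** The matrix of the composition operator in the basis of characters. *)
Definition cmx (m k : int) : R[i] := fourier (fun x => chi k (h x)) m.

Lemma comp_chi_L2 k : L2circle (fun x => chi k (h x)).
Proof.
apply: (@comp_L2circle (chi k)); apply: ccont_L2circle; first exact: ccont_chi.
exact: chi_periodic.
Qed.

Lemma cmx_cst m : m != 0 -> cmx m 0 = 0.
Proof.
move=> m0; rewrite /cmx; under eq_fun do rewrite chi0.
by rewrite -[X in fourier X](_ : chi 0 = _) ?fourier_chi 1?eq_sym ?(negbTE m0)//;
  apply/funext => x; rewrite chi0.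
Qed.

Lemma symsum_opp N F : symsum N F = symsum N (fun n => F (- n)).
Proof.
by rewrite /symsum oppr0; congr (_ + _); apply: eq_bigr => n _; rewrite opprK addrC.
Qed.

(** After the substitution [x = g y] the coefficient is the mean of [u] times a
    smooth function, whose Fourier series can be integrated term by term. *)
Lemma fourier_comp u m : L2circle u ->
  ccvg (fun N => symsum N (fun k => fourier u k * cmx m k)) (fourier (u \o h) m).
Proof.
move=> u2; pose psi y : R[i] := chi (- m) (g y) * (gp y)%:C.
have c2 : is_C2 psi.
  apply: is_C2M; last exact: is_C2_real (smooth_derive1 (sl_g hl)).
  exact: is_C2_comp (is_C2_chi _) (sl_g hl).
have ppsi : periodic2pi psi.
  move=> y; rewrite /psi (sl_shift (slift_sym hl)) chi_periodic.
  by rewrite (lift_deriv_periodic (slift_lift (slift_sym hl))).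
rewrite fourierE.
have -> : cmean (fun x => (u \o h) x * chi (- m) x) = cmean (fun y => u y * psi y).
  by apply: cmean_comp => //; [exact: ccont_chi|exact: chi_periodic].
have := cmean_mul_series (L2circle_cintegrable u2) (is_C2_uniform_series c2 ppsi).
apply: ccvg_ext => N; rewrite symsum_opp; apply: symsum_ext => k.
rewrite opprK mulrC; congr (_ * _).
rewrite /cmx !fourierE opprK.
rewrite (@cmean_comp (chi k)); last exact: chi_periodic.
- by congr cmean; apply/funext => y; rewrite mulrC.
- by apply: ccont_L2circle; [exact: ccont_chi|exact: chi_periodic].
- exact: ccont_chi.
Qed.

(** ** Invariance of the symplectic form *)

(** Partial sums of the symplectic form of H^{1/2}, the mean of
    [- i f' conj f]. *)
Definition ssum F (N : nat) : R :=
  \sum_(1 <= n < N) n%:R * (absC2 (F n%:Z) - absC2 (F (- n%:Z))).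

Lemma circle_int_conj u : cintegrable u ->
  circle_int (fun x => conjc (u x)) = conjc (circle_int u).
Proof.
move=> [i1 i2]; rewrite /circle_int.
have -> : (fun x => Re_ (conjc (u x))) = (fun x => Re_ (u x)) by apply/funext => x; case: (u x).
have -> : (fun x => Im_ (conjc (u x))) = (fun x => -1 * Im_ (u x)).
  by apply/funext => x; case: (u x) => p q; rewrite mulN1r.
by rewrite RintegralZl// mulN1r.
Qed.

Lemma fourier_conj u n : cintegrable u ->
  fourier (fun x => conjc (u x)) n = conjc (fourier u (- n)).
Proof.
move=> iu; rewrite !fourierE /cmean opprK rmorphM; congr (_ * _).
  by apply: complex_ext; rewrite /= ?oppr0.
rewrite -[RHS]/(conjc (circle_int _)) -circle_int_conj; last exact: cintegrable_chi.
congr circle_int; apply/funext => x; rewrite rmorphM /=; congr (_ * _).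
by rewrite chiN expiN.
Qed.

Lemma is_C2_conj f : is_C2 f -> is_C2 (fun x => conjc (f x)).
Proof.
have cd u u' : cderiv u u' -> cderiv (fun x => conjc (u x)) (fun x => conjc (u' x)).
  move=> d x; have [d1 d2] := d x; split.
    have -> : (fun y => Re_ (conjc (u y))) = (fun y => Re_ (u y)).
      by apply/funext => y; case: (u y).
    by case: (u' x) d1.
  have -> : (fun y => Im_ (conjc (u y))) = (fun y => - Im_ (u y)).
    by apply/funext => y; case: (u y).
  have -> : Im_ (conjc (u' x)) = - Im_ (u' x) by case: (u' x).
  exact: is_deriveN.
move=> [f1 [f2 [d1 d2 [c1 c2]]]].
exists (fun x => conjc (f1 x)), (fun x => conjc (f2 x)); split; try exact: cd.
split => x.
  have -> : (fun y => Re_ (conjc (f2 y))) = (fun y => Re_ (f2 y)).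
    by apply/funext => y; case: (f2 y).
  exact: c1.
have -> : (fun y => Im_ (conjc (f2 y))) = (fun y => - Im_ (f2 y)).
  by apply/funext => y; case: (f2 y).
by apply: cvgN; exact: c2.
Qed.

Lemma mulc_conj (z : R[i]) : conjc z * z = (absC2 z)%:C.
Proof. by case: z => p q; apply: complex_ext; rewrite /absC2 /=; ring. Qed.

Lemma ssum_ccvg f f1 f2 : cderiv f f1 -> cderiv f1 f2 -> ccont f2 -> periodic2pi f ->
  ccvg (fun N => 'i * (ssum (fourier f) N)%:C) (cmean (fun x => f1 x * conjc (f x))).
Proof.
move=> d1 d2 c2 pf; have c1 := cderiv_cont d2.
have if1 := ccont_cintegrable c1; have iff := ccont_cintegrable (cderiv_cont d1).
have cj : is_C2 (fun x => conjc (f x)) by apply: is_C2_conj; exists f1, f2.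
have pj : periodic2pi (fun x => conjc (f x)) by move=> x; rewrite pf.
have := cmean_mul_series if1 (is_C2_uniform_series cj pj).
apply: ccvg_ext => N; rewrite symsum_opp /symsum.
rewrite oppr0 (fourier_deriv _ d1 c1 pf) mulr0 mul0r mulr0 add0r.
rewrite /ssum rmorph_sum mulr_sumr; apply: eq_bigr => n _ /=.
rewrite !fourier_conj// !(fourier_deriv _ d1 c1 pf) !opprK.
rewrite [conjc _ * _]mulrCA mulc_conj [conjc (fourier f (- _)) * _]mulrCA mulc_conj.
rewrite rmorphM rmorphB /= -pmulrn mulrNz -pmulrn.
have -> : (- (n%:R : R))%:C = - (n%:R)%:C :> R[i] by rewrite rmorphN.
by ring.
Qed.

(** The mean of [f' conj f] is the integral of a one-form, hence does not change
    under a substitution. *)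
Lemma ssum_comp f : is_C2 f -> periodic2pi f -> exists l, forall e : R, 0 < e ->
  exists N0, forall N, (N0 <= N)%N ->
    `|ssum (fourier f) N - l| <= e /\ `|ssum (fourier (f \o h)) N - l| <= e.
Proof.
move=> Cf pf; have [f1 [f2 [d1 d2 c2]]] := Cf.
have h1 := ssum_ccvg d1 d2 c2 pf.
have [k2 e2 c3] : exists2 k, cderiv (fun x => f1 (h x) * (derive1n 1 h x)%:C) k & ccont k.
  have ch := smooth_cont (sl_h hl).
  exists (fun x => f2 (h x) * (derive1n 1 h x)%:C * (derive1n 1 h x)%:C +
    f1 (h x) * (derive1n 2 h x)%:C).
    apply: cderivM; first by apply: cderiv_comp => // x; exact: (smooth_deriv 0 x (sl_h hl)).
    by apply: cderiv_real => x; exact: (smooth_deriv 1 x (sl_h hl)).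
  have r1 := ccont_real (@smooth_continuous _ 1 (sl_h hl)).
  have r2 := ccont_real (@smooth_continuous _ 2 (sl_h hl)).
  apply: ccontD; last by apply: ccontM => //; exact: ccont_comp (cderiv_cont d2) ch.
  by do 2 (apply: ccontM => //); exact: ccont_comp.
have e1 : cderiv (f \o h) (fun x => f1 (h x) * (derive1n 1 h x)%:C).
  by apply: cderiv_comp => // x; exact: (smooth_deriv 0 x (sl_h hl)).
have h2 := ssum_ccvg e1 e2 c3 (comp_periodic pf).
have eL : cmean (fun x => f1 (h x) * (derive1n 1 h x)%:C * conjc ((f \o h) x)) =
    cmean (fun x => f1 x * conjc (f x)).
  have [j1 [j2 [dj _ _]]] := is_C2_conj Cf.
  have ck : ccont (fun x => f1 x * conjc (f x)).
    by apply: ccontM; [exact: cderiv_cont d2|exact: cderiv_cont dj].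
  have [k1 k2'] := ck.
  have pk : periodic2pi (fun x => f1 x * conjc (f x)).
    by move=> x; rewrite (cderiv_periodic d1 pf) pf.
  have [_ e] := lift_csubst (slift_lift hl) (continuous_measurable_fun k1)
    (continuous_measurable_fun k2') pk (ccont_cintegrable ck).
  by rewrite /cmean -e; congr (_ * circle_int _); apply/funext => x /=; rewrite mulrAC.
rewrite eL in h2; set L := cmean _ in h1 h2; exists (Im_ L) => e e0.
have [N1 hN1] := h1 e e0; have [N2 hN2] := h2 e e0.
exists (maxn N1 N2) => N; rewrite geq_max => /andP[/hN1 a1 /hN2 a2].
have key x : normc ('i * x%:C - L) <= e -> `|x - Im_ L| <= e.
  apply: le_trans; apply: le_trans (Im_le_normc _).
  have -> : 'i * x%:C = 0 +i* x by apply: complex_ext; rewrite ?Re_M ?Im_M /=; ring.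
  by rewrite Im_D Im_N.
by split; [exact: key a1|exact: key a2].
Qed.

Definition psum b F (N : nat) : R := \sum_(1 <= n < N) n%:R * absC2 (F (freq b n)).

Lemma psum_term_ge0 b F n : 0 <= n%:R * absC2 (F (freq b n)) :> R.
Proof. by rewrite mulr_ge0// absC2_ge0. Qed.

Lemma psum_ge0 b F N : 0 <= psum b F N.
Proof. by apply: sumr_ge0 => n _; exact: psum_term_ge0. Qed.

Lemma psum_mono b F N M : (N <= M)%N -> psum b F N <= psum b F M.
Proof.
move=> NM; have [N1|N1] := leqP 1 N.
  rewrite /psum (@big_cat_nat _ _ _ N 1 M)//= lerDl.
  by apply: sumr_ge0 => n _; exact: psum_term_ge0.
by rewrite /psum big_geq ?psum_ge0// ltnW.
Qed.

Lemma wsum_psum b F N : wsum F N = psum b F N + psum (~~ b) F N.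
Proof. by rewrite (wsum_freq b) -big_split; apply: eq_bigr => n _ /=; rewrite mulrDr. Qed.

Lemma ssum_psum F N : ssum F N = psum true F N - psum false F N.
Proof. by rewrite -sumrB; apply: eq_bigr => n _ /=; rewrite mulrBr. Qed.

(** By invariance of the symplectic form, the positive part of the square norm of
    [T \o h] minus its negative part is the square norm of [T]. *)
Lemma trigpoly_comp_norm N c (S := psum true (fourier (trigpoly true N c)) N)
    (F := fourier (trigpoly true N c \o h)) :
  (forall q, (forall M, psum false F M <= q) -> forall M, psum true F M <= S + q) /\
  (forall p, (forall M, psum true F M <= p) -> S <= p).
Proof.
have C2T : is_C2 (trigpoly true N c).
  by apply: is_C2_sum => n; apply: is_C2M; [exact: is_C2_cst|exact: is_C2_chi].
have [l hl'] := ssum_comp C2T (trigpoly_periodic _ _ _).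
have ST M : (N <= M)%N -> ssum (fourier (trigpoly true N c)) M = S.
  move=> NM; rewrite ssum_psum [X in _ - X](_ : _ = 0); last first.
    rewrite /psum big_nat_cond big1// => n; rewrite andbT => /andP[n1 _].
    by rewrite (fourier_trigpoly_opp true)// absC2_0 mulr0.
  rewrite subr0 /S; have [N1|N1] := leqP 1 N.
    rewrite /psum (@big_cat_nat _ _ _ N 1 M)//= [X in _ + X](_ : _ = 0) ?addr0//.
    rewrite big_nat_cond big1// => n; rewrite andbT => /andP[Nn _]; rewrite (fourier_trigpoly_same true) ?(leq_trans N1)//.
    by rewrite ltnNge Nn absC2_0 mulr0.
  have N0 : N = 0%N by case: (N) N1.
  rewrite /psum N0 [RHS]big_geq// big_nat_cond big1// => n; rewrite andbT => /andP[n1 _].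
  by rewrite (fourier_trigpoly_same true)// absC2_0 mulr0.
have lS : l = S.
  apply/eqP; rewrite -subr_eq0 -normr_le0; apply/ler_addgt0Pr => e e0; rewrite add0r distrC.
  have [N0 hN0] := hl' e e0; have [+ _] := hN0 (maxn N0 N) (leq_maxl _ _).
  by rewrite ST ?leq_maxr.
(* The partial sums of the symplectic form of the composition tend to [S]. *)
have near e : 0 < e -> exists N0, forall M, (N0 <= M)%N ->
    `|psum true F M - psum false F M - S| <= e.
  move=> e0; have [N0 hN0] := hl' e e0; exists N0 => M /hN0[_].
  by rewrite lS ssum_psum.
split=> [q hq M|p hp].
  apply/ler_addgt0Pr => e e0; have [N0 hN0] := near e e0.
  apply: (le_trans (psum_mono true F (leq_maxl M N0))).
  have := hN0 (maxn M N0) (leq_maxr _ _); have := hq (maxn M N0).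
  rewrite ler_norml; move: (psum true _ _) (psum false _ _) => x y yq /andP[_ h2]; lra.
apply/ler_addgt0Pr => e e0; have [N0 hN0] := near e e0.
have := hN0 N0 (leqnn _); have := hp N0; have := psum_ge0 false F N0.
rewrite ler_norml; move: (psum true _ _) (psum false _ _) => x y xp y0 /andP[h1 _]; lra.
Qed.

(** ** Boundedness on H^{1/2}_+ *)

Definition mixing_le (C : R) := forall m k : nat, (0 < m)%N -> (0 < k)%N ->
  absC2 (cmx (- m%:Z) k%:Z) <= C / m%:R ^+ 4 / k%:R.

Lemma fourier_trigpoly_comp N c j : fourier (trigpoly true N c \o h) j =
  \sum_(1 <= n < N) cmx j n%:Z * c n.
Proof.
have ic n : cintegrable (fun x => c n * chi (freq true n) (h x)).
  by apply: cintegrableZ; apply: L2circle_cintegrable; exact: comp_chi_L2.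
rewrite (_ : _ \o h = fun x => \sum_(1 <= n < N) c n * chi (freq true n) (h x))//.
rewrite fourier_sum//; apply: eq_bigr => n _.
by rewrite fourierZ; [rewrite mulrC|apply: L2circle_cintegrable; exact: comp_chi_L2].
Qed.

Lemma psum_trigpoly N c :
  psum true (fourier (trigpoly true N c)) N = \sum_(1 <= n < N) n%:R * absC2 (c n).
Proof.
rewrite /psum big_nat_cond [RHS]big_nat_cond; apply: eq_bigr => n.
by rewrite andbT => /andP[n1 nN]; rewrite (fourier_trigpoly_same true)// nN.
Qed.

Lemma weighted_tail_le F b (K : R) M : 0 <= K ->
  (forall m : nat, (0 < m)%N -> absC2 (F (freq b m)) <= K / m%:R ^+ 3) ->
  psum b F M <= 2 * K.
Proof.
move=> K0 hF; apply: (@le_trans _ _ (K * \sum_(1 <= n < M) n%:R ^- 2)).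
  rewrite mulr_sumr /psum big_nat_cond [leRHS]big_nat_cond; apply: ler_sum => n.
  rewrite andbT => /andP[n1 _].
  have n0 : (0 : R) < n%:R by rewrite ltr0n.
  apply: (le_trans (ler_wpM2l (ltW n0) (hF n n1))).
  by rewrite le_eqVlt; apply/orP; left; apply/eqP; field; rewrite gt_eqF.
by rewrite mulrC ler_wpM2r//; have := @sum_inv_sq R 1 M isT; rewrite divr1.
Qed.

Lemma trigpoly_comp_anti (C : R) N c M : 0 <= C -> mixing_le C ->
  psum false (fourier (trigpoly true N c \o h)) M <=
  4 * C * psum true (fourier (trigpoly true N c)) N.
Proof.
move=> C0 hC; rewrite psum_trigpoly; set S := \sum_(_ <= _ < _) _.
have S0 : 0 <= S by apply: sumr_ge0 => n _; rewrite mulr_ge0// absC2_ge0.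
have -> : 4 * C * S = 2 * (2 * C * S) by ring.
apply: weighted_tail_le; first by rewrite !mulr_ge0.
move=> m m0; rewrite fourier_trigpoly_comp.
have m1 : (1 : R) <= m%:R by rewrite ler1n.
have m4 : 0 < m%:R ^+ 4 :> R by rewrite exprn_gt0// ltr0n.
have K0 : 0 <= C / m%:R ^+ 4 by rewrite divr_ge0// ltW.
apply: (le_trans (sum_weighted_cauchy _ N K0 (fun k k0 => hC m k m0 k0))).
rewrite -/S mulrA mulrAC ler_wpM2l//; first by rewrite !mulr_ge0.
by rewrite lef_pV2 ?posrE ?exprn_gt0 ?ltr0n// ler_weXn2l.
Qed.

Lemma ccvg_absC2 (s : nat -> R[i]) l : ccvg s l -> absC2 (s N) @[N --> \oo] --> absC2 l.
Proof.
move=> hs.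
have key (T : R[i] -> R) : (forall a : R[i], `|T a| <= normc a) ->
    (forall a b : R[i], T (a - b) = T a - T b) -> T (s N) @[N --> \oo] --> T l.
  move=> T1 T2; apply/cvgrPdist_le => e e0; have [N0 hN] := hs e e0.
  exists N0 => // N /= /hN; rewrite distrC -T2; apply: le_trans; exact: T1.
have -> : (fun N => absC2 (s N)) =
    (fun N => Re_ (s N) * Re_ (s N) + Im_ (s N) * Im_ (s N)).
  by apply/funext => N; rewrite /absC2 !expr2.
rewrite [absC2 l]/absC2 !expr2.
have hR : Re_ (s N) @[N --> \oo] --> Re_ l.
  by apply: key; [exact: Re_le_normc|move=> a b; rewrite Re_D Re_N].
have hI : Im_ (s N) @[N --> \oo] --> Im_ l.
  by apply: key; [exact: Im_le_normc|move=> a b; rewrite Im_D Im_N].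
by apply: cvgD; apply: cvgM.
Qed.

Lemma psum_limit (X : nat -> int -> R[i]) F b M (K : R) :
  (forall j, j != 0 -> ccvg (fun N => X N j) (F j)) ->
  (forall N, psum b (X N) M <= K) -> psum b F M <= K.
Proof.
move=> hX hK.
have c : psum b (X N) M @[N --> \oo] --> psum b F M.
  rewrite /psum; elim: M {hK} => [|M IH].
    by under eq_fun do rewrite big_geq//; rewrite big_geq//; exact: cvg_cst.
  have [M1|M1] := leqP 1 M; last first.
    by under eq_fun do rewrite big_geq//; rewrite big_geq//; exact: cvg_cst.
  under eq_fun do rewrite big_nat_recr//=; rewrite big_nat_recr//=.
  apply: cvgD => //; apply: cvgM; first exact: cvg_cst.
  by apply: ccvg_absC2; apply: hX; case: (b) => /=; lia.
rewrite -(cvg_lim _ c)//; apply: limr_le; first by apply/cvg_ex; eexists; exact: c.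
exact: nearW.
Qed.

Lemma analytic_partial_sums u : Hsgn true u -> forall j, j != 0 ->
  ccvg (fun N => fourier (trigpoly true N (fun n => fourier u n%:Z) \o h) j) (fourier (u \o h) j).
Proof.
move=> /HsgnP[[u2 _] un] j j0; have := fourier_comp j u2; apply: ccvg_ext => N.
rewrite fourier_trigpoly_comp /symsum cmx_cst// mulr0 add0r.
rewrite big_nat_cond [RHS]big_nat_cond; apply: eq_bigr => n; rewrite andbT => /andP[n1 _].
by rewrite (un n n1) mul0r addr0 mulrC.
Qed.

Lemma psum_le_trans b F N M (K : R) : (N <= M)%N -> psum b F M <= K -> psum b F N <= K.
Proof. by move=> /(psum_mono b F) /le_trans; apply. Qed.

Lemma Hsgn_psum u : Hsgn true u -> exists2 K, 0 <= K & forall N, psum true (fourier u) N <= K.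
Proof.
move=> [/HhalfP[_ [K hK]] _].
have hK' N : psum true (fourier u) N <= K.
  by apply: le_trans (hK N); rewrite (wsum_psum true) lerDl psum_ge0.
by exists K => //; exact: le_trans (psum_ge0 true _ 0) (hK' 0%N).
Qed.

(** On trigonometric polynomials the mixing entries bound the negative part, and
    the symplectic form then bounds the positive part; pass to the limit. *)
Lemma comp_bounded (C K : R) u : 0 <= C -> mixing_le C -> Hsgn true u ->
  (forall N, psum true (fourier u) N <= K) ->
  (forall M, psum true (fourier (u \o h)) M <= (1 + 4 * C) * K) /\
  (forall M, psum false (fourier (u \o h)) M <= 4 * C * K).
Proof.
move=> C0 hC hu hK; have hX := analytic_partial_sums hu.
have SK N : psum true (fourier (trigpoly true N (fun n => fourier u n%:Z))) N <= K.
  by rewrite psum_trigpoly; exact: hK.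
have anti N M : psum false (fourier (trigpoly true N (fun n => fourier u n%:Z) \o h)) M <= 4 * C * K.
  apply: le_trans (trigpoly_comp_anti N _ M C0 hC) _.
  by rewrite ler_wpM2l// mulr_ge0.
split=> M; apply: (psum_limit hX) => N //.
rewrite mulrDl mul1r.
apply: le_trans ((trigpoly_comp_norm N _).1 _ (anti N) M) _.
by rewrite lerD2r.
Qed.

Lemma comp_Hhalf (C : R) u : 0 <= C -> mixing_le C -> Hsgn true u -> Hhalf (u \o h).
Proof.
move=> C0 hC hu; have [[u2 _] _] := hu; have [K K0 hK'] := Hsgn_psum hu.
have [h1 h2] := comp_bounded C0 hC hu hK'.
apply: (@Hhalf_intro _ _ ((1 + 4 * C) * K + 4 * C * K)); first exact: comp_L2circle.
by move=> N; rewrite (wsum_psum true) lerD.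
Qed.

(** For a trigonometric polynomial the symplectic form gives the bound [p], the
    negative part having the good sign. The factor 2 pays for the approximation. *)
Lemma comp_lower (C p : R) u : 0 <= C -> mixing_le C -> Hsgn true u ->
  (forall M, psum true (fourier (u \o h)) M <= p) ->
  forall N, psum true (fourier u) N <= 2 * p.
Proof.
move=> C0 hC hu hp N0; have [[u2 _] un] := (HsgnP _ _).1 hu.
have [K K0 hK'] := Hsgn_psum hu.
apply/ler_addgt0Pr => e e0; pose d := e / (2 * (1 + 4 * C)).
have C1 : 0 < 1 + 4 * C by rewrite ltr_wpDr// mulr_ge0.
have d0 : 0 < d by rewrite divr_gt0// mulr_gt0.
have [N1 [N10 tail]] := bounded_sum_tail (psum_term_ge0 true (fourier u)) hK' d0.
set N := maxn N0 N1; pose T := trigpoly true N (fun n => fourier u n%:Z).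
have iu := L2circle_cintegrable u2.
have T2 : L2circle T.
  by apply: ccont_L2circle; [exact: ccont_trigpoly|exact: trigpoly_periodic].
have iT := L2circle_cintegrable T2.
pose v x := u x - T x.
have v2 : L2circle v by exact: L2circleB.
have fv k : fourier v k = fourier u k - fourier T k by rewrite fourierB.
have vtail M : psum true (fourier v) M <= d.
  apply: (psum_le_trans (leq_maxr N M)).
  rewrite /psum (@big_cat_nat _ _ _ N 1 (maxn N M)) ?leq_maxl//=; last first.
    by rewrite (leq_trans N10)// leq_maxr.
  rewrite big_nat_cond big1 ?add0r; last first.
    move=> n; rewrite andbT => /andP[n1 nN]; rewrite fv /T (fourier_trigpoly_same true)// nN.
    by rewrite subrr absC2_0 mulr0.
  apply: le_trans (tail (maxn N M)).
  have NM : (N <= maxn N M)%N by exact: leq_maxl.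
  rewrite [leRHS](@big_cat_nat _ _ _ N N1 (maxn N M)) ?leq_maxr//=.
  rewrite -[leLHS]add0r; apply: lerD.
    by apply: sumr_ge0 => n _; rewrite mulr_ge0// absC2_ge0.
  rewrite big_nat_cond [leRHS]big_nat_cond; apply: ler_sum => n; rewrite andbT => /andP[Nn _].
  rewrite fv /T (fourier_trigpoly_same true); last by apply: leq_trans Nn; rewrite (leq_trans N10)// leq_maxr.
  by rewrite ltnNge Nn /= subr0.
have vH : Hsgn true v.
  apply/HsgnP; split.
    apply: HhalfB; first by case: hu.
    apply: (@Hhalf_intro _ _ (psum true (fourier T) N)) => // M.
    rewrite (wsum_psum true) [X in _ + X](_ : _ = 0) ?addr0; last first.
      rewrite /psum big_nat_cond big1// => n; rewrite andbT => /andP[n1 _].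
      by rewrite (fourier_trigpoly_opp true)// absC2_0 mulr0.
    apply: (le_trans (psum_mono true _ (leq_maxr N M))).
    rewrite /psum; have [N1'|N1'] := leqP 1 N; last by rewrite ltnS leqn0 in N1'; move: N1'; rewrite -leqn0 geq_max => /andP[_]; rewrite leqNgt N10.
    rewrite (@big_cat_nat _ _ _ N 1 (maxn N M)) ?leq_maxl//= [X in _ + X](_ : _ = 0) ?addr0//.
    rewrite big_nat_cond big1// => n; rewrite andbT => /andP[Nn _].
    by rewrite (fourier_trigpoly_same true) ?(leq_trans N1')// ltnNge Nn absC2_0 mulr0.
  by move=> n n0; rewrite fv un// (fourier_trigpoly_opp true)// subr0.
have [hv _] := comp_bounded C0 hC vH vtail.
have uh2 := comp_L2circle u2; have vh2 := comp_L2circle v2.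
have fT k : fourier (T \o h) k = fourier (u \o h) k + (-1) * fourier (v \o h) k.
  have vE y : T y = u y - v y by rewrite /v subKr.
  have -> : T \o h = fun x => (u \o h) x - (v \o h) x.
    by apply/funext => x; exact: vE.
  by rewrite mulN1r fourierB//; exact: L2circle_cintegrable.
have pT M : psum true (fourier (T \o h)) M <= 2 * p + e.
  apply: (@le_trans _ _ (2 * psum true (fourier (u \o h)) M + 2 * psum true (fourier (v \o h)) M)).
    rewrite /psum !mulr_sumr -big_split /=; apply: ler_sum => n _.
    have hD := absC2D (fourier (u \o h) n%:Z) (-1 * fourier (v \o h) n%:Z).
    have h1 : absC2 (-1 * fourier (v \o h) n%:Z) = absC2 (fourier (v \o h) n%:Z).
      by rewrite mulN1r absC2N.
    rewrite h1 in hD; rewrite fT; apply: le_trans (ler_wpM2l (ler0n _ n) hD) _.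
    by rewrite mulrDr mulrCA [X in _ + X <= _]mulrCA.
  apply: lerD; first by rewrite ler_wpM2l.
  have -> : e = 2 * ((1 + 4 * C) * d) by rewrite /d; field; rewrite gt_eqF.
  by rewrite ler_wpM2l.
have := (trigpoly_comp_norm N _).2 _ pT.
apply: le_trans; rewrite psum_trigpoly; apply: (psum_le_trans (leq_maxl N0 N1)).
exact: lexx.
Qed.

End FixedLift.

End Composition.

(** * Inverting the analytic part of a composition operator *)
Section Inversion.
Variable R : realType.
Implicit Types (u v w : R -> R[i]) (F G : int -> R[i]) (h g : R -> R)
  (b c z : nat -> R[i]).

(** ** Absolutely convergent sums *)

Definition csum z : R[i] := xget 0 [set l | ccvg (fun N => \sum_(1 <= n < N) z n) l].

Lemma csumP z (K : R) : (forall n, (0 < n)%N -> normc (z n) <= K / n%:R ^+ 2) ->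
  ccvg (fun N => \sum_(1 <= n < N) z n) (csum z) /\ normc (csum z) <= 2 * K.
Proof.
move=> hz.
have K0 : 0 <= K by have := le_trans (normc_ge0 _) (hz 1%N isT); rewrite expr1n divr1.
have part N M : (0 < N)%N -> normc (\sum_(N <= n < M) z n) <= 2 * K / N%:R.
  move=> N0; apply: (le_trans (normc_sum _ _ _)).
  apply: (@le_trans _ _ (K * \sum_(N <= n < M) n%:R ^- 2)).
    rewrite mulr_sumr big_nat_cond [leRHS]big_nat_cond; apply: ler_sum => n.
    by rewrite andbT => /andP[Nn _]; apply: hz; exact: leq_trans Nn.
  by rewrite [2 * K]mulrC -mulrA ler_wpM2l//; exact: sum_inv_sq.
have K2 : 0 <= 2 * K by rewrite mulr_ge0.
have [l hl] : exists l, forall N, (0 < N)%N ->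
    normc (\sum_(1 <= n < N) z n - l) <= 2 * (2 * K) / N%:R.
  apply: complex_cauchy_limit => // N M N0 NM.
  by rewrite (@big_cat_nat _ _ _ N 1 M)//= addrAC subrr add0r; exact: part.
have cl : ccvg (fun N => \sum_(1 <= n < N) z n) l.
  by apply: ccvg_squeeze hl; rewrite mulr_ge0.
have cs : ccvg (fun N => \sum_(1 <= n < N) z n) (csum z).
  have : [set l | ccvg (fun N => \sum_(1 <= n < N) z n) l] (csum z).
    by apply: xgetPex; exists l.
  by [].
split => //; apply: (@ccvg_le _ _ _ _ 1%N cs) => N N1.
by have := part 1%N N isT; rewrite divr1.
Qed.

Lemma csum_unique z l : ccvg (fun N => \sum_(1 <= n < N) z n) l -> csum z = l.
Proof.
move=> cl; have : [set l | ccvg (fun N => \sum_(1 <= n < N) z n) l] (csum z).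
  by apply: xgetPex; exists l.
by move=> /= cs; exact: ccvg_unique cs cl.
Qed.

Lemma csumB z z' (K K' : R) : (forall n, (0 < n)%N -> normc (z n) <= K / n%:R ^+ 2) ->
  (forall n, (0 < n)%N -> normc (z' n) <= K' / n%:R ^+ 2) ->
  csum z - csum z' = csum (fun n => z n - z' n).
Proof.
move=> /csumP[h _] /csumP[h' _]; apply/esym/csum_unique.
rewrite -mulN1r; have := ccvgD h (ccvgZ (-1) h'); apply: ccvg_ext => N.
by rewrite mulr_sumr -big_split; apply: eq_bigr => n _; rewrite mulN1r.
Qed.

(** ** A fixed point in the space of square-decaying sequences *)

Definition decay2 (K : R) b := forall m, (0 < m)%N -> normc (b m) <= K / m%:R ^+ 2.

Lemma half_pow_le n : (0 < n)%N -> (2^-1) ^+ n <= n%:R^-1 :> R.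
Proof.
move=> n0; rewrite exprVn lef_pV2 ?posrE ?exprn_gt0 ?ltr0n// -natrX ler_nat.
by rewrite ltnW// ltn_expl.
Qed.

(** The contraction principle for the norm [sup m^2 |b m|]. The successive
    differences of the iterates are halved at each step. *)
Lemma decay2_fixpoint (T : (nat -> R[i]) -> (nat -> R[i])) :
  (forall K b, 0 <= K -> decay2 K b -> exists2 K', 0 <= K' & decay2 K' (T b)) ->
  (forall K K' a b b', 0 <= K -> 0 <= K' -> 0 <= a -> decay2 K b -> decay2 K' b' ->
    decay2 a (fun m => b m - b' m) -> decay2 (a / 2) (fun m => T b m - T b' m)) ->
  exists K b, [/\ 0 <= K, decay2 K b & forall m, (0 < m)%N -> T b m = b m].
Proof.
move=> T1 T2; pose z : nat -> R[i] := fun=> 0.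
have d0 : decay2 0 z by move=> m _; rewrite Normc.normc0 mul0r.
have [a a0 ha] := T1 0 z (lexx 0) d0.
pose B j := iter j T z.
have dB j : exists2 K, 0 <= K & decay2 K (B j).
  elim: j => [|j [K K0 hK]]; first by exists 0.
  exact: T1 hK.
have step j : decay2 (a * (2^-1) ^+ j) (fun m => B j.+1 m - B j m).
  elim: j => [|j IH].
    by move=> m m0; rewrite expr0 mulr1 /B /= /z subr0; exact: ha.
  have [K K0 hK] := dB j; have [K' K'0 hK'] := dB j.+1.
  have := T2 _ _ _ _ _ K'0 K0 _ hK' hK IH.
  by rewrite exprSr mulrA; apply; rewrite mulr_ge0// exprn_ge0// invr_ge0.
have far j k : decay2 (2 * a * (2^-1) ^+ j) (fun m => B (j + k)%N m - B j m).
  elim: k j => [|k IH] j m m0.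
    rewrite addn0 subrr Normc.normc0 divr_ge0 ?exprn_ge0//.
    by rewrite mulr_ge0 ?mulr_ge0// exprn_ge0// invr_ge0.
  have -> : B (j + k.+1)%N m - B j m = (B (j.+1 + k)%N m - B j.+1 m) + (B j.+1 m - B j m).
    by rewrite addSnnS; ring.
  apply: (le_trans (le_normcD _ _)).
  have := IH j.+1 m m0; have := step j m m0.
  have -> : (2^-1) ^+ j.+1 = 2^-1 * (2^-1) ^+ j :> R by rewrite exprS.
  have p2 : 0 <= (m%:R ^+ 2)^-1 :> R by rewrite invr_ge0 exprn_ge0.
  move: (normc _) (normc _) p2 => x y p2 hx hy.
  apply: (le_trans (lerD hy hx)); rewrite -mulrDl ler_wpM2r//.
  by rewrite le_eqVlt; apply/orP; left; apply/eqP; field.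
have cauchy m : (0 < m)%N -> exists l, forall N, (0 < N)%N ->
    normc (B N m - l) <= 2 * (2 * a / m%:R ^+ 2) / N%:R.
  move=> m0; apply: complex_cauchy_limit.
    by rewrite divr_ge0 ?exprn_ge0// mulr_ge0.
  move=> N M N0 NM; have := far N (M - N)%N m m0; rewrite subnKC// => hN.
  apply: (le_trans hN); rewrite mulrAC ler_wpM2l//.
    by rewrite divr_ge0 ?exprn_ge0// mulr_ge0.
  exact: half_pow_le.
have [l hl] : exists l : nat -> R[i], forall m, (0 < m)%N -> forall N, (0 < N)%N ->
    normc (B N m - l m) <= 2 * (2 * a / m%:R ^+ 2) / N%:R.
  have [l hl] := choice (fun m => cauchy m.+1 isT).
  by exists (fun m => l m.-1) => -[|m]// _ N N0; exact: hl.
pose c := 4 * a; have c0 : 0 <= c by rewrite mulr_ge0.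
have dl N : (0 < N)%N -> decay2 (c / N%:R) (fun m => B N m - l m).
  move=> N0 m m0; apply: (le_trans (hl m m0 N N0)).
  by rewrite le_eqVlt /c; apply/orP; left; apply/eqP; field; rewrite !pnatr_eq0 -!lt0n m0 N0.
have dl' : exists2 K, 0 <= K & decay2 K l.
  have [K K0 hK] := dB 1%N; exists (K + c); first by rewrite addr_ge0.
  move=> m m0; have := dl 1%N isT m m0; rewrite divr1 => h1; have h2 := hK m m0.
  have -> : l m = B 1%N m - (B 1%N m - l m) by ring.
  by apply: (le_trans (normcB _ _)); rewrite mulrDl lerD.
have [L L0 hL] := dl'; exists L, l; split => // m m0.
apply/eqP; rewrite -subr_eq0; apply/eqP; apply: normc_eq0P.
have p2 : 0 <= (m%:R ^+ 2)^-1 :> R by rewrite invr_ge0 exprn_ge0.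
have bnd N : (0 < N)%N -> normc (T l m - l m) <= 2 * c / m%:R ^+ 2 / N%:R.
  move=> N0; have [K K0 hK] := dB N.
  have hd : decay2 (c / N%:R) (fun m => l m - B N m).
    by move=> k k0; rewrite -normcN opprB; exact: dl.
  have cN : 0 <= c / N%:R by rewrite divr_ge0.
  have h1 := T2 _ _ _ _ _ L0 K0 cN hL hK hd m m0.
  have h2 := dl N.+1 isT m m0.
  have -> : T l m - l m = (T l m - T (B N) m) + (B N.+1 m - l m) by rewrite /B /=; ring.
  apply: (le_trans (le_normcD _ _)); apply: (le_trans (lerD h1 h2)).
  rewrite -mulrDl [leRHS]mulrAC ler_wpM2r//.
  have h3 : c / N.+1%:R <= c / N%:R by rewrite ler_wpM2l// lef_pV2 ?posrE ?ltr0n// ler_nat.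
  rewrite [leRHS](_ : _ = c / N%:R + c / N%:R); last by ring.
  by move: (c / N%:R) (c / N.+1%:R) cN h3 => x y; lra.
apply/ler_addgt0Pr => e e0; rewrite add0r.
set Q := 2 * c / m%:R ^+ 2 in bnd.
have Q0 : 0 <= Q by rewrite divr_ge0 ?exprn_ge0 ?mulr_ge0.
apply: (le_trans (bnd (Num.truncn (Q / e)).+1 isT)).
rewrite ler_pdivrMr ?ltr0n// [leRHS]mulrC -ler_pdivrMr//.
by apply: ltW; exact: Num.Theory.truncnS_gt.
Qed.

(** ** One-sided series *)

(** The coefficients [b 1, b 2, ...] placed on the frequencies of sign [s], and 0
    at the frequency 0. *)
Definition onesided (s : bool) b (k : int) : R[i] :=
  match k with
  | Posz n => if s && (0 < n)%N then b n else 0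
  | Negz n => if s then 0 else b n.+1
  end.

Lemma onesided_same s b n : (0 < n)%N -> onesided s b (freq s n) = b n.
Proof. by case: s n => -[|n]. Qed.

Lemma onesided_opp s b n : (0 < n)%N -> onesided s b (freq (~~ s) n) = 0.
Proof. by case: s n => -[|n]. Qed.

Lemma onesided0 s b : onesided s b 0 = 0.
Proof. by case: s. Qed.

Lemma symsum_freq s N F : symsum N F = F 0 + \sum_(1 <= n < N) (F (freq s n) + F (freq (~~ s) n)).
Proof. by rewrite /symsum; congr (_ + _); apply: eq_bigr => n _; case: s => //=; rewrite addrC. Qed.

Lemma symsum_onesided s N b F :
  symsum N (fun k => onesided s b k * F k) = \sum_(1 <= n < N) b n * F (freq s n).
Proof.
rewrite (symsum_freq s) onesided0 mul0r add0r big_nat_cond [RHS]big_nat_cond.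
apply: eq_bigr => n; rewrite andbT => /andP[n1 _].
by rewrite onesided_same// onesided_opp// mul0r addr0.
Qed.

Lemma onesided_series s b (K : R) : 0 <= K -> decay2 K b ->
  exists f, uniform_series f (onesided s b).
Proof.
move=> K0 hb; apply: (@uniform_series_exists _ K) => n n0.
have K2 : 0 <= K / n%:R ^+ 2 by rewrite divr_ge0// exprn_ge0.
have h t : normc (onesided s b (freq t n)) <= K / n%:R ^+ 2.
  have [->|->] : t = s \/ t = ~~ s by case: t; case: (s); [left|right|right|left].
    by rewrite onesided_same//; exact: hb.
  by rewrite onesided_opp// Normc.normc0.
by split; [exact: (h true)|exact: (h false)].
Qed.

Lemma onesided_Hsgn s b (K : R) f : 0 <= K -> decay2 K b ->
  uniform_series f (onesided s b) -> Hsgn s f.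
Proof.
move=> K0 hb hf; have ff k := uniform_series_fourier k hf.
apply/HsgnP; split; last by move=> n n0; rewrite ff onesided_opp.
apply: (@Hhalf_intro _ _ (2 * K ^+ 2)).
  by apply: ccont_L2circle; [exact: uniform_series_ccont hf|exact: uniform_series_periodic hf].
move=> N; rewrite (wsum_psum s) [X in _ + X](_ : _ = 0) ?addr0; last first.
  rewrite /psum big_nat_cond big1// => n; rewrite andbT => /andP[n1 _].
  by rewrite ff onesided_opp// absC2_0 mulr0.
apply: weighted_tail_le; first by rewrite exprn_ge0.
move=> m m0; rewrite ff onesided_same// absC2E.
apply: (@le_trans _ _ ((K / m%:R ^+ 2) ^+ 2)).
  by rewrite ler_pXn2r ?nnegrE ?normc_ge0 ?divr_ge0 ?exprn_ge0//; exact: hb.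
rewrite expr_div_n ler_wpM2l ?exprn_ge0// -exprM.
by rewrite lef_pV2 ?posrE ?exprn_gt0 ?ltr0n// ler_weXn2l// ler1n.
Qed.

(** ** The two mixing blocks of a diffeomorphism and of its inverse *)

(** Both sides are means of [d(e_m o h)] times [e_n], computed once by the
    substitution [y = h x] and once by parts. *)
Lemma cmx_inverse h g (m n : nat) : slift h g -> (0 < m)%N ->
  m%:R * cmx g (- m%:Z) n%:Z = - (n%:R * cmx h (- n%:Z) m%:Z).
Proof.
move=> hl m0; have hg := slift_sym hl.
pose f x : R[i] := chi m%:Z (h x).
pose f' x : R[i] := 'i * (m%:Z%:~R)%:C * chi m%:Z (h x) * (derive1n 1 h x)%:C.
have df : cderiv f f'.
  exact: (cderiv_comp (cderiv_chi m%:Z) (fun x => smooth_deriv 0 x (sl_h hl))).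
have cf' : ccont f'.
  apply: ccontM; last exact: ccont_real (smooth_continuous (sl_h hl)).
  apply: ccontM; first exact: ccont_cst.
  by apply: ccont_comp; [exact: ccont_chi|exact: smooth_cont (sl_h hl)].
have pf : periodic2pi f by move=> x; rewrite /f (sl_shift hl) chi_periodic.
have dn := @cderiv_chi R n%:Z.
have cn' : ccont (fun x : R => 'i * (n%:Z%:~R)%:C * chi n%:Z x).
  by apply: ccontM; [exact: ccont_cst|exact: ccont_chi].
have bp := circle_int_by_parts df dn cf' cn' pf (@chi_periodic _ _).
have cfn : ccont (fun x => chi n%:Z x * f x).
  by apply: ccontM; [exact: ccont_chi|exact: cderiv_cont df].
have cfh : ccont (fun x => chi m%:Z (h x) * (derive1n 1 h x)%:C).
  apply: ccontM; last exact: ccont_real (smooth_continuous (sl_h hl)).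
  by apply: ccont_comp; [exact: ccont_chi|exact: smooth_cont (sl_h hl)].
have e1 : 'i * (m%:Z%:~R)%:C * cmx g (- m%:Z) n%:Z = cmean (fun x => f' x * chi n%:Z x).
  rewrite /cmx fourierE opprK (cmean_comp hg (u := chi n%:Z)); last exact: chi_periodic.
  - have ic : ccont (fun y => chi n%:Z y * (chi m%:Z (h y) * (derive1n 1 h y)%:C)).
      by apply: ccontM; [exact: ccont_chi|exact: cfh].
    rewrite -(cmeanZ _ (ccont_cintegrable ic)).
    by congr cmean; apply/funext => x; rewrite /f'; ring.
  - by apply: ccont_L2circle; [exact: ccont_chi|exact: chi_periodic].
  - exact: ccont_chi.
have e2 : cmean (fun x => f x * ('i * (n%:Z%:~R)%:C * chi n%:Z x)) =
    'i * (n%:Z%:~R)%:C * cmx h (- n%:Z) m%:Z.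
  rewrite /cmx fourierE opprK -cmeanZ; last first.
    by apply: ccont_cintegrable; under eq_fun do rewrite mulrC; exact: cfn.
  by congr cmean; apply/funext => x; rewrite /f; ring.
have e3 : 'i * (m%:Z%:~R)%:C * cmx g (- m%:Z) n%:Z =
    - ('i * (n%:Z%:~R)%:C * cmx h (- n%:Z) m%:Z).
  by rewrite e1 -e2 /cmean bp mulrN.
have i0 : 'i != 0 :> R[i] by rewrite eq_complex /= oner_eq0 andbF.
apply: (mulfI i0); move: e3; rewrite -!pmulrn !rmorph_nat.
by rewrite -!mulrA mulrN.
Qed.

Lemma cmx_conj h g (m n : int) : slift h g -> cmx h n (- m) = conjc (cmx h (- n) m).
Proof.
move=> hl; rewrite /cmx -fourier_conj; last by apply: L2circle_cintegrable; exact: comp_chi_L2 hl m.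
suff -> : (fun x => conjc (chi m (h x))) = (fun x => chi (- m) (h x)) by [].
by apply/funext => x; rewrite chiN expiN.
Qed.

(** Enough decay for the composition operator of [h]. *)
Definition mixing_small h (e : R) := forall m k : nat, (0 < m)%N -> (0 < k)%N ->
  normc (cmx h (- m%:Z) k%:Z) <= e / (m%:R ^+ 2 * k%:R).

(** Decay strong enough to give [mixing_small] for both [h] and its inverse. *)
Definition mixing_cube h (e : R) := forall m k : nat, (0 < m)%N -> (0 < k)%N ->
  normc (cmx h (- m%:Z) k%:Z) <= e / (m%:R + k%:R) ^+ 3.

Lemma mixing_cube_small h e : 0 <= e -> mixing_cube h e -> mixing_small h e.
Proof.
move=> e0 hh m k m0 k0; apply: (le_trans (hh m k m0 k0)); rewrite ler_wpM2l//.
have m1 : (0 : R) < m%:R by rewrite ltr0n.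
have k1 : (0 : R) < k%:R by rewrite ltr0n.
rewrite lef_pV2 ?posrE ?mulr_gt0 ?exprn_gt0 ?addr_gt0//.
by rewrite !exprS expr0; move: (m%:R : R) (k%:R : R) m1 k1 => x y x0 y0; nra.
Qed.

(** By [cmx_inverse] the entries of the two diffeomorphisms are transposed up to
    the factor [n / m], and one of the three powers pays for it. *)
Lemma mixing_cube_inverse h g e : slift h g -> 0 <= e -> mixing_cube h e -> mixing_small g e.
Proof.
move=> hl e0 hh m k m0 k0.
have m1 : (0 : R) < m%:R by rewrite ltr0n.
have k1 : (0 : R) < k%:R by rewrite ltr0n.
have := congr1 (@normc R) (cmx_inverse k hl m0); have := hh k m k0 m0.
move: (cmx g _ _) (cmx h _ _) => A B hB.
rewrite normcN !Normc.normcM !normc_nat => eq.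
rewrite -(@ler_pM2l _ m%:R)// eq; apply: (le_trans (ler_wpM2l (ltW k1) hB)).
rewrite mulrCA [leRHS]mulrCA ler_wpM2l//.
rewrite ler_pdivrMr ?exprn_gt0 ?addr_gt0// mulrAC ler_pdivlMr ?mulr_gt0 ?exprn_gt0//.
by rewrite !exprS expr0; move: (m%:R : R) (k%:R : R) m1 k1 => x y x0 y0; nra.
Qed.

Lemma mixing_small_le h e : 0 <= e -> mixing_small h e -> mixing_le h (e ^+ 2).
Proof.
move=> e0 hh m k m0 k0; rewrite absC2E.
have m1 : (0 : R) < m%:R by rewrite ltr0n.
have k1 : (0 : R) < k%:R by rewrite ltr0n.
have k2 : (1 : R) <= k%:R by rewrite ler1n.
apply: (@le_trans _ _ ((e / (m%:R ^+ 2 * k%:R)) ^+ 2)).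
  rewrite ler_pXn2r ?nnegrE ?normc_ge0 ?divr_ge0 ?mulr_ge0 ?exprn_ge0//; exact: hh.
rewrite expr_div_n -mulrA ler_wpM2l ?exprn_ge0// -invfM.
rewrite lef_pV2 ?posrE ?mulr_gt0 ?exprn_gt0 ?mulr_gt0 ?exprn_gt0//.
by rewrite exprMn -exprM ler_wpM2l ?exprn_ge0// expr2 ler_peMl// ltW.
Qed.

(** ** Solving [P_+ (w \o h) = u] *)
Section Solve.
Variables (h g : R -> R) (e : R).
Hypothesis hl : slift h g.
Hypothesis e0 : 0 <= e.
Hypothesis e_small : e <= 1 / 4.
Hypothesis hcube : mixing_cube h e.

Let mixh : mixing_small h e := mixing_cube_small e0 hcube.
Let mixg : mixing_small g e := mixing_cube_inverse hl e0 hcube.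

Lemma comp_anti_decay h' g' u : slift h' g' -> mixing_small h' e -> Hsgn true u ->
  exists2 K, 0 <= K & decay2 K (fun m => fourier (u \o h') (- m%:Z)).
Proof.
move=> hl' mix hu; have [K K0 hK'] := Hsgn_psum hu.
exists (Num.sqrt (2 * e ^+ 2 * K)); first exact: sqrtr_ge0.
move=> m m0; have mz : - m%:Z != 0 :> int by lia.
apply: (@ccvg_le _ _ _ _ 0%N (analytic_partial_sums hl' hu mz)) => N _.
rewrite (fourier_trigpoly_comp hl').
have m1 : (0 : R) < m%:R by rewrite ltr0n.
have A0 : 0 <= e ^+ 2 / m%:R ^+ 4 by rewrite divr_ge0// exprn_ge0// ltW.
have := sum_weighted_cauchy (fun n => fourier u n%:Z) N A0
  (fun k k0 => mixing_small_le e0 mix m0 k0).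
rewrite absC2E => hs.
have S0 : 0 <= Num.sqrt (2 * e ^+ 2 * K) / m%:R ^+ 2.
  by rewrite divr_ge0 ?sqrtr_ge0 ?exprn_ge0 ?ler0n.
rewrite -(@ler_pXn2r _ 2)// ?nnegrE ?normc_ge0//.
have eK0 : 0 <= 2 * e ^+ 2 * K by rewrite mulr_ge0// mulr_ge0// exprn_ge0.
rewrite expr_div_n sqr_sqrtr// -exprM.
rewrite [leRHS]mulrAC -[2 * _ / _]mulrA; apply: (le_trans hs).
by apply: ler_wpM2l; [exact: mulr_ge0|exact: hK'].
Qed.

Let block b (n : nat) : R[i] := csum (fun m => b m * cmx h n%:Z (- m%:Z)).

Let block_term K b n m : 0 <= K -> decay2 K b -> (0 < n)%N -> (0 < m)%N ->
  normc (b m * cmx h n%:Z (- m%:Z)) <= e * K / n%:R ^+ 2 / m%:R ^+ 2.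
Proof.
move=> K0 hb n0 m0; rewrite Normc.normcM (cmx_conj _ _ hl) normc_conj.
have m1 : (1 : R) <= m%:R by rewrite ler1n.
have m2 : (0 : R) < m%:R by rewrite ltr0n.
have n2 : (0 : R) < n%:R by rewrite ltr0n.
apply: (le_trans (ler_pM (normc_ge0 _) (normc_ge0 _) (hb m m0) (mixh n0 m0))).
rewrite [leLHS](_ : _ = e * K / n%:R ^+ 2 / m%:R ^+ 2 * (m%:R)^-1); last first.
  by field; rewrite !gt_eqF.
by rewrite ler_piMr ?invf_le1// !divr_ge0 ?exprn_ge0 ?mulr_ge0.
Qed.

Let block_decay K b : 0 <= K -> decay2 K b -> decay2 (2 * e * K) (block b).
Proof.
move=> K0 hb n n0; have [_] := csumP (fun m m0 => block_term K0 hb n0 m0).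
by rewrite mulrA mulrA.
Qed.

Let gblock r (m : nat) : R[i] := csum (fun n => r n * cmx g (- m%:Z) n%:Z).

Let gblock_term K r m n : 0 <= K -> decay2 K r -> (0 < m)%N -> (0 < n)%N ->
  normc (r n * cmx g (- m%:Z) n%:Z) <= e * K / m%:R ^+ 2 / n%:R ^+ 2.
Proof.
move=> K0 hr m0 n0; rewrite Normc.normcM.
have m2 : (0 : R) < m%:R by rewrite ltr0n.
have n1 : (1 : R) <= n%:R by rewrite ler1n.
have n2 : (0 : R) < n%:R by rewrite ltr0n.
apply: (le_trans (ler_pM (normc_ge0 _) (normc_ge0 _) (hr n n0) (mixg m0 n0))).
rewrite [leLHS](_ : _ = e * K / m%:R ^+ 2 / n%:R ^+ 2 * (n%:R)^-1); last first.
  by field; rewrite !gt_eqF.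
by rewrite ler_piMr ?invf_le1// !divr_ge0 ?exprn_ge0 ?mulr_ge0.
Qed.

Let gblock_decay K r : 0 <= K -> decay2 K r -> decay2 (2 * e * K) (gblock r).
Proof.
move=> K0 hr n n0; have [_] := csumP (fun m m0 => gblock_term K0 hr n0 m0).
by rewrite mulrA mulrA.
Qed.

Let blockB K K' b b' n : 0 <= K -> 0 <= K' -> decay2 K b -> decay2 K' b' -> (0 < n)%N ->
  block b n - block b' n = block (fun m => b m - b' m) n.
Proof.
move=> K0 K'0 hb hb' n0; rewrite /block.
rewrite (csumB (fun m m0 => block_term K0 hb n0 m0) (fun m m0 => block_term K'0 hb' n0 m0)).
by congr csum; apply/funext => m; rewrite mulrBl.
Qed.

Let gblockB K K' b b' n : 0 <= K -> 0 <= K' -> decay2 K b -> decay2 K' b' -> (0 < n)%N ->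
  gblock b n - gblock b' n = gblock (fun m => b m - b' m) n.
Proof.
move=> K0 K'0 hb hb' n0; rewrite /gblock.
rewrite (csumB (fun m m0 => gblock_term K0 hb n0 m0) (fun m m0 => gblock_term K'0 hb' n0 m0)).
by congr csum; apply/funext => m; rewrite mulrBl.
Qed.

Let gblock_ext r r' m : (forall n, (0 < n)%N -> r n = r' n) -> gblock r m = gblock r' m.
Proof.
move=> hr; rewrite /gblock /csum; congr xget; apply/funext => l; congr (ccvg _ l).
apply/funext => N; rewrite big_nat_cond [RHS]big_nat_cond; apply: eq_bigr => n.
by rewrite andbT => /andP[n1 _]; rewrite hr.
Qed.

(** Applying the two mixing blocks in turn multiplies the norm by at most
    [(2 e)^2], so the equation for the antianalytic correction [b] is a
    contraction. *)
Let fixpoint u : Hsgn true u -> exists K b, [/\ 0 <= K, decay2 K b &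
  forall m, (0 < m)%N -> fourier (u \o g) (- m%:Z) + gblock (block b) m = b m].
Proof.
move=> hu; have [K K0 hK] := comp_anti_decay (slift_sym hl) mixg hu.
apply: (@decay2_fixpoint (fun b m => fourier (u \o g) (- m%:Z) + gblock (block b) m)).
  move=> L b L0 hb; exists (K + 2 * e * (2 * e * L)); first by rewrite addr_ge0// !mulr_ge0.
  move=> m m0; apply: (le_trans (le_normcD _ _)); rewrite mulrDl; apply: lerD; first exact: hK.
  by apply: gblock_decay => //; [rewrite !mulr_ge0|exact: block_decay].
move=> L L' a b b' L0 L'0 a0 hb hb' hd m m0.
have hB := block_decay L0 hb; have hB' := block_decay L'0 hb'.
have L2 : 0 <= 2 * e * L by rewrite !mulr_ge0.
have L2' : 0 <= 2 * e * L' by rewrite !mulr_ge0.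
rewrite opprD addrACA subrr add0r (gblockB L2 L2')//.
rewrite (gblock_ext m (fun n n0 => blockB L0 L'0 hb hb' n0)).
have a2 : 0 <= 2 * e * a by rewrite !mulr_ge0.
apply: (le_trans (gblock_decay a2 (block_decay a0 hd) m0)).
rewrite ler_wpM2r ?invr_ge0 ?exprn_ge0//.
have e2 : e * e <= 1 / 16 by move: e e0 e_small => x x0 x1; nra.
by have := ler_wpM2r a0 e2; lra.
Qed.

(** Look for [w = (u + r) \o g - b] with [r] analytic and [b] antianalytic. It is
    analytic as soon as [b] is the antianalytic part of [(u + r) \o g], and then
    [w \o h = u + r - b \o h] has analytic part [u] as soon as [r] is the
    analytic part of [b \o h]. Eliminating [r] gives the fixed point equation. *)
Lemma solve_analytic u : Hsgn true u -> exists2 w, Hsgn true w &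
  forall n : nat, (0 < n)%N -> fourier (w \o h) n%:Z = fourier u n%:Z.
Proof.
move=> hu; have [K [b [K0 hb fixb]]] := fixpoint hu.
have hr := block_decay K0 hb; have K2 : 0 <= 2 * e * K by rewrite !mulr_ge0.
have [rf hrf] := onesided_series true K2 hr.
have [bf hbf] := onesided_series false K0 hb.
have Hrf := onesided_Hsgn K2 hr hrf; have Hbf := onesided_Hsgn K0 hb hbf.
have [u2 r2 b2] : [/\ L2circle u, L2circle rf & L2circle bf].
  by split; [case: hu|case: Hrf|case: Hbf] => -[].
pose y x := u x + rf x.
have y2 : L2circle y by exact: L2circleD.
have hy : Hsgn true y.
  apply/HsgnP; split; first by apply: HhalfD; [case: hu|case: Hrf].
  move=> n n0; rewrite fourierD; try exact: L2circle_cintegrable.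
  have [_ ->//] := (HsgnP _ _).1 hu; have [_ ->//] := (HsgnP _ _).1 Hrf.
  by rewrite addr0.
pose w x := (y \o g) x - bf x.
have hg := slift_sym hl.
have yg2 : L2circle (y \o g) := comp_L2circle hg y2.
have w2 : L2circle w by exact: L2circleB.
have rg2 : L2circle (rf \o g) := comp_L2circle hg r2.
have ug2 : L2circle (u \o g) := comp_L2circle hg u2.
have bh2 : L2circle (bf \o h) := comp_L2circle hl b2.
exists w.
  apply/HsgnP; split.
    apply: HhalfB; last by case: Hbf.
    by apply: (comp_Hhalf hg (C := e ^+ 2)) => //; [exact: exprn_ge0|exact: mixing_small_le].
  move=> m m0; rewrite fourierB; try exact: L2circle_cintegrable.
  rewrite (uniform_series_fourier _ hbf) (onesided_same false)//.
  have -> : fourier (y \o g) (freq (~~ true) m) =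
      fourier (u \o g) (- m%:Z) + fourier (rf \o g) (- m%:Z).
    by rewrite -fourierD; try exact: L2circle_cintegrable.
  rewrite -(fixb m m0); apply/eqP; rewrite subr_eq0; apply/eqP; congr (_ + _).
  apply/esym/csum_unique; have := fourier_comp hg (- m%:Z) r2; apply: ccvg_ext => N.
  rewrite -(symsum_onesided true N (block b) (fun k => cmx g (- m%:Z) k)).
  by apply: symsum_ext => k; rewrite (uniform_series_fourier _ hrf).
move=> n n0.
have wE : w \o h = fun x => (u x + rf x) - (bf \o h) x.
  by apply/funext => x; rewrite /w /y /= (sl_hg hl).
rewrite wE fourierB ?fourierD; try exact: L2circle_cintegrable.
rewrite (uniform_series_fourier _ hrf) (onesided_same true)//.
suff -> : fourier (bf \o h) n%:Z = block b n by rewrite addrK.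
apply/esym/csum_unique; have := fourier_comp hl n%:Z b2; apply: ccvg_ext => N.
rewrite -(symsum_onesided false N b (fun k => cmx h n%:Z k)).
by apply: symsum_ext => k; rewrite (uniform_series_fourier _ hbf).
Qed.

(** The antianalytic part of [w \o h] has coefficients that decay like [m^-2], so
    it is a uniformly convergent series; subtracting it leaves the analytic part. *)
Lemma comp_projections w : Hsgn true w ->
  [/\ Hsgn true (Aop h w), Hsgn false (Bop h w),
      forall n : nat, (0 < n)%N -> fourier (Aop h w) n%:Z = fourier (w \o h) n%:Z &
      forall n : nat, (0 < n)%N -> fourier (Bop h w) (- n%:Z) = fourier (w \o h) (- n%:Z)].
Proof.
move=> hw; have [K K0 hK] := comp_anti_decay hl mixh hw.
have [bf hbf] := onesided_series false K0 hK.
have Hbf := onesided_Hsgn K0 hK hbf.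
have wh : Hhalf (w \o h).
  by apply: (comp_Hhalf hl (C := e ^+ 2)) => //; [exact: exprn_ge0|exact: mixing_small_le].
have iwh := Hhalf_cintegrable wh.
have ibf : cintegrable bf by case: Hbf => /Hhalf_cintegrable.
have fbf n : (0 < n)%N -> fourier bf (- n%:Z) = fourier (w \o h) (- n%:Z).
  by move=> n0; rewrite (uniform_series_fourier _ hbf) (onesided_same false).
have [h1 h2] := orth_projP (b := false) iwh Hbf fbf.
pose v x := (w \o h) x - bf x.
have hv : Hsgn true v.
  apply/HsgnP; split; first by apply: HhalfB; [exact: wh|case: Hbf].
  by move=> n n0; rewrite fourierB// [in X in _ - X]fbf// subrr.
have fv n : (0 < n)%N -> fourier v (freq true n) = fourier (w \o h) (freq true n).
  move=> n0; rewrite fourierB//; have [_ e1] := (HsgnP _ _).1 Hbf.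
  by have /= -> := e1 n n0; rewrite subr0.
have [h3 h4] := orth_projP (b := true) iwh hv fv.
rewrite /Aop /Bop /Pplus /Pminus HplusE HminusE /Vop.
by split.
Qed.

(** All that is needed of [Zop]: it is the antianalytic part of [w \o h], where
    the analytic part of [w \o h] is [u]. *)
Lemma Zop_spec u : Hplus u -> exists w, [/\ Hsgn true w,
  forall n : nat, (0 < n)%N -> fourier (w \o h) n%:Z = fourier u n%:Z,
  Hsgn false (Zop h u) &
  forall n : nat, (0 < n)%N -> fourier (Zop h u) (- n%:Z) = fourier (w \o h) (- n%:Z)].
Proof.
move=> hu; exists (Aop_inv h u).
pose S := [set w | Hplus w /\ eqH (Aop h w) u].
have [hw eqw] : S (Aop_inv h u).
  rewrite /Aop_inv -/S; apply: xgetPex.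
  have [w hw ew] := solve_analytic hu; exists w; split => //.
  have [hA _ eA _] := comp_projections hw.
  apply: fourier_eqH; [by case: hA => -[]|by case: hu => -[]|].
  case=> [[|n]|n] // _; first by rewrite eA// ew.
  rewrite NegzE; have [_ e1] := (HsgnP _ _).1 hA; have [_ e2] := (HsgnP _ _).1 (hu : Hsgn true u).
  by have /= -> := e1 n.+1 isT; have /= -> := e2 n.+1 isT.
have [hA hB eA eB] := comp_projections hw.
have iA : cintegrable (Aop h (Aop_inv h u)) by case: hA => /Hhalf_cintegrable.
have iu : cintegrable u by case: hu => /Hhalf_cintegrable.
split; [exact: hw| |exact: hB|exact: eB].
move=> n n0; rewrite -(eA n n0); apply: (eqH_fourier iA iu eqw).
by lia.
Qed.

End Solve.

End Inversion.

(** * Nonstationary phase *)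
Section Phase.
Variable R : realType.
Implicit Types (h g A : R -> R).

Lemma derive1n_seq (F : nat -> R -> R) :
  (forall k (x : R), is_derive x 1 (F k) (F k.+1 x)) ->
  forall k, derive1n k (F 0%N) = F k.
Proof.
move=> dF; elim=> [//|k IH]; rewrite derive1nS IH.
by apply/funext => x; rewrite derive1E; have [_ ->] := dF k x.
Qed.

Lemma normM_le (x y a b : R) : `|x| <= a -> `|y| <= b -> `|x * y| <= a * b.
Proof. by move=> xa yb; rewrite normrM; apply: ler_pM. Qed.

Lemma normD_le (x y a b : R) : `|x| <= a -> `|y| <= b -> `|x + y| <= a + b.
Proof. by move=> xa yb; apply: (le_trans (ler_normD _ _)); exact: lerD. Qed.

Lemma contM (f g : R -> R) : continuous f -> continuous g -> continuous (fun x => f x * g x).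
Proof. by move=> cf cg x; apply: cvgM; [apply: cf|apply: cg]. Qed.

Lemma contD (f g : R -> R) : continuous f -> continuous g -> continuous (fun x => f x + g x).
Proof. by move=> cf cg x; apply: cvgD; [apply: cf|apply: cg]. Qed.

Lemma contN (f : R -> R) : continuous f -> continuous (fun x => - f x).
Proof. by move=> cf x; apply: cvgN; apply: cf. Qed.

Lemma contZ (c : R) (f : R -> R) : continuous f -> continuous (fun x => c * f x).
Proof. by move=> cf x; apply: cvgM; [exact: cvg_cst|apply: cf]. Qed.

Lemma contX (f : R -> R) n : continuous f -> continuous (fun x => f x ^+ n).
Proof.
move=> cf; elim: n => [|n IH] x; first by apply: cvg_cst.
by under eq_fun do rewrite exprS; apply: cvgM; [apply: cf|apply: IH].
Qed.

(** An integration by parts trades the amplitude [phi' G] for [G']. *)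
Lemma nonstationary_step (phi psi : R -> R) (G G' : R -> R[i]) :
  (forall x : R, is_derive x 1 phi (psi x)) -> continuous psi ->
  cderiv G G' -> ccont G' -> periodic2pi (fun x => expi (phi x)) -> periodic2pi G ->
  cmean (fun x => expi (phi x) * ((psi x)%:C * G x)) =
  'i * cmean (fun x => expi (phi x) * G' x).
Proof.
move=> dphi cpsi dG cG' pe pG.
have ce : ccont (fun x => expi (phi x)) by apply: ccont_expi; exact: is_derive_cont dphi.
have cG := cderiv_cont dG.
have cE : ccont (fun x => 'i * (psi x)%:C * expi (phi x)).
  by apply: ccontM => //; apply: ccontM; [exact: ccont_cst|exact: ccont_real].
have bp := circle_int_by_parts (cderiv_expi dphi) dG cE cG' pe pG.
have i1 : cintegrable (fun x => expi (phi x) * ((psi x)%:C * G x)).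
  apply: ccont_cintegrable; apply: ccontM => //; apply: ccontM => //.
  exact: ccont_real.
have e1 : (fun x => 'i * (psi x)%:C * expi (phi x) * G x) =
          (fun x => 'i * (expi (phi x) * ((psi x)%:C * G x))).
  by apply/funext => x; rewrite -!mulrA; congr (_ * _); rewrite mulrCA.
move: bp; rewrite e1 circle_intZ// => bp.
have i2 : 'i * 'i = -1 :> R[i] by rewrite -expr2 sqr_i.
rewrite /cmean mulrCA; congr (_ * _); apply: (mulfI (x := 'i)).
  by rewrite eq_complex /= oner_eq0 andbF.
by rewrite bp mulrA i2 mulN1r.
Qed.

Section Triple.
Variables (phi a0 a1 a2 a3 : R -> R) (N k : R).
Hypothesis dphi : forall x : R, is_derive x 1 phi (a0 x).
Hypothesis da0 : forall x : R, is_derive x 1 a0 (a1 x).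
Hypothesis da1 : forall x : R, is_derive x 1 a1 (a2 x).
Hypothesis da2 : forall x : R, is_derive x 1 a2 (a3 x).
Hypothesis ca3 : continuous a3.
Hypothesis per_e : periodic2pi (fun x => expi (phi x)).
Hypothesis per_a : periodic2pi a0.
Hypothesis N0 : 0 < N.
Hypothesis k0 : 0 <= k.
Hypothesis k1 : k <= 2^-1.
Hypothesis a0N : forall x, N / 2 <= a0 x.
Hypothesis a1N : forall x, `|a1 x| <= N * k.
Hypothesis a2N : forall x, `|a2 x| <= N * k.
Hypothesis a3N : forall x, `|a3 x| <= N * k.

Let r x := (a0 x)^-1.
Let r1 x := - (a1 x * r x ^+ 2).
Let r2 x := - (a2 x * r x ^+ 2) + 2 * (a1 x ^+ 2 * r x ^+ 3).
Let r3 x := - (a3 x * r x ^+ 2) + 6 * (a1 x * a2 x * r x ^+ 3) - 6 * (a1 x ^+ 3 * r x ^+ 4).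

Let a0_neq0 x : a0 x != 0.
Proof. by rewrite gt_eqF// (lt_le_trans _ (a0N x))// divr_gt0. Qed.

Let dr (x : R) : is_derive x 1 r (r1 x).
Proof.
apply: (is_derive_eq (is_deriveV (a0_neq0 x) (da0 x))).
by rewrite /r1 /r /GRing.scale /= mulrC mulrN exprVn.
Qed.

Let dr1 (x : R) : is_derive x 1 r1 (r2 x).
Proof.
have d := dr x; have d1 := da1 x; rewrite /r1.
by apply: is_derive_eq; rewrite /r2 /r1 /GRing.scale /=; ring.
Qed.

Let dr2 (x : R) : is_derive x 1 r2 (r3 x).
Proof.
have d := dr x; have d1 := da1 x; have d2 := da2 x; rewrite /r2.
by apply: is_derive_eq; rewrite /r3 /r1 /GRing.scale /=; ring.
Qed.

Let cr : continuous r. Proof. exact: is_derive_cont dr. Qed.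
Let cr1 : continuous r1. Proof. exact: is_derive_cont dr1. Qed.
Let cr2 : continuous r2. Proof. exact: is_derive_cont dr2. Qed.

Let per_real (a b : R -> R) : (forall x : R, is_derive x 1 a (b x)) -> periodic2pi a -> periodic2pi b.
Proof.
move=> da pa x; have := cderiv_periodic (cderiv_real da).
suff pc : periodic2pi (fun x => (a x)%:C) by move=> /(_ pc x) [].
by move=> y; rewrite pa.
Qed.

Let pr : periodic2pi r. Proof. by move=> x; rewrite /r per_a. Qed.
Let pr1 : periodic2pi r1. Proof. exact: per_real dr pr. Qed.
Let pr2 : periodic2pi r2. Proof. exact: per_real dr1 pr1. Qed.

Let b2 x := r2 x * r x + r1 x ^+ 2.
Let b3 x := r3 x * r x ^+ 2 + 4 * (r x * r1 x * r2 x) + r1 x ^+ 3.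

Let step (G G' : R -> R) : (forall x : R, is_derive x 1 G (G' x)) -> continuous G' ->
  periodic2pi G ->
  cmean (fun x => expi (phi x) * (a0 x * G x)%:C) = 'i * cmean (fun x => expi (phi x) * (G' x)%:C).
Proof.
move=> dG cG' pG.
rewrite -(nonstationary_step dphi (is_derive_cont da0) (cderiv_real dG) (ccont_real cG') per_e).
  by congr cmean; apply/funext => x; rewrite rmorphM.
by move=> x; rewrite pG.
Qed.

Let r3E x : r3 x = - (a3 x * r x ^+ 2) + 6 * (a1 x * a2 x * r x ^+ 3) - 6 * (a1 x ^+ 3 * r x ^+ 4).
Proof. by []. Qed.

Let cr3 : continuous r3.
Proof.
have c1 := is_derive_cont da1; have c2 := is_derive_cont da2.
apply: contD; last by apply: contN; apply: contZ; apply: contM; exact: contX.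
apply: contD; first by apply: contN; apply: contM => //; exact: contX.
by apply: contZ; apply: contM; [exact: contM|exact: contX].
Qed.

Let cb3 : continuous b3.
Proof.
apply: contD; last exact: contX.
apply: contD; first by apply: contM; [exact: cr3|exact: contX].
by apply: contZ; apply: contM => //; exact: contM.
Qed.

(** The amplitudes are [1], [r'], [(r' r)'] and [((r' r)' r)']. *)
Lemma triple_by_parts : cmean (fun x => expi (phi x)) =
  'i ^+ 3 * cmean (fun x => expi (phi x) * (b3 x)%:C).
Proof.
have e1 : cmean (fun x => expi (phi x)) = 'i * cmean (fun x => expi (phi x) * (r1 x)%:C).
  rewrite -(step dr cr1 pr); congr cmean; apply/funext => x.
  by rewrite /r mulfV// mulr1.
have dG1 (x : R) : is_derive x 1 (fun y => r1 y * r y) (b2 x).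
  have d := dr x; have d1 := dr1 x.
  by apply: is_derive_eq; rewrite /b2 /GRing.scale /=; ring.
have cb2 : continuous b2.
  move=> x; apply: cvgD; first by apply: cvgM; [exact: cr2|exact: cr].
  by apply: cvgM; exact: cr1.
have pG1 : periodic2pi (fun y => r1 y * r y) by move=> x; rewrite pr pr1.
have e2 : cmean (fun x => expi (phi x) * (r1 x)%:C) = 'i * cmean (fun x => expi (phi x) * (b2 x)%:C).
  rewrite -(step dG1 cb2 pG1); congr cmean; apply/funext => x.
  by rewrite mulrCA /r mulfV// mulr1.
have dG2 (x : R) : is_derive x 1 (fun y => b2 y * r y) (b3 x).
  have d := dr x; have d1 := dr1 x; have d2 := dr2 x; rewrite /b2.
  by apply: is_derive_eq; rewrite /b3 /GRing.scale /=; ring.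
have pG2 : periodic2pi (fun y => b2 y * r y) by move=> x; rewrite /b2 pr pr1 pr2.
have e3 : cmean (fun x => expi (phi x) * (b2 x)%:C) = 'i * cmean (fun x => expi (phi x) * (b3 x)%:C).
  rewrite -(step dG2 cb3 pG2); congr cmean; apply/funext => x.
  by rewrite mulrCA /r mulfV// mulr1.
by rewrite e1 e2 e3 !exprS expr0 mulr1 !mulrA.
Qed.

Let b3_bound x : `|b3 x| <= 416 * k / N ^+ 3.
Proof.
(* Rescaled by powers of [N], all the quantities are of size one. *)
pose s := N * r x; pose c1 := a1 x / N; pose c2 := a2 x / N; pose c3 := a3 x / N.
have n0 : N != 0 by rewrite gt_eqF.
have bnd y : `|y| <= N * k -> `|y / N| <= k.
  by move=> hy; rewrite normrM normfV (gtr0_norm N0) ler_pdivrMr// mulrC.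
have hs : `|s| <= 2.
  rewrite /s /r normrM normfV (gtr0_norm N0) ler_pdivrMr ?normr_gt0//.
  by have := a0N x; have := ler_norm (a0 x); lra.
have h1 : `|c1| <= k := bnd _ (a1N x).
have h2 : `|c2| <= k := bnd _ (a2N x).
have h3 : `|c3| <= k := bnd _ (a3N x).
have k1' := k1.
have s2 := normM_le hs hs; have s3 := normM_le hs s2; have s4 := normM_le hs s3.
have n2 : `|2 : R| <= 2 by rewrite ger0_norm.
have n6 : `|6 : R| <= 6 by rewrite ger0_norm.
have n4 : `|4 : R| <= 4 by rewrite ger0_norm.
have kk : k * k <= k * 2^-1 by rewrite ler_wpM2l.
have kkk : k * (k * k) <= k * (k * 2^-1) by rewrite ler_wpM2l.
have R1 : `|c1 * (s * s)| <= 4 * k.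
  by apply: (le_trans (normM_le h1 s2)); lra.
have R2 : `|- (c2 * (s * s)) + 2 * (c1 * c1 * (s * (s * s)))| <= 12 * k.
  have t1 : `|- (c2 * (s * s))| <= k * (2 * 2) by rewrite normrN; exact: normM_le h2 s2.
  apply: (le_trans (normD_le t1 (normM_le n2 (normM_le (normM_le h1 h1) s3)))); lra.
have R3 : `|- (c3 * (s * s)) + 6 * (c1 * c2 * (s * (s * s))) +
    (- (6 * (c1 * (c1 * c1) * (s * (s * (s * s))))))| <= 52 * k.
  have t1 : `|- (c3 * (s * s))| <= k * (2 * 2) by rewrite normrN; exact: normM_le h3 s2.
  have t2 := normM_le n6 (normM_le (normM_le h1 (normM_le h1 h1)) s4).
  rewrite -normrN in t2.
  apply: (le_trans (normD_le (normD_le t1 (normM_le n6 (normM_le (normM_le h1 h2) s3))) t2)).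
  lra.
have eb : b3 x = ((- (c3 * (s * s)) + 6 * (c1 * c2 * (s * (s * s))) +
    (- (6 * (c1 * (c1 * c1) * (s * (s * (s * s))))))) * (s * s) +
    4 * (s * (- (c1 * (s * s))) * (- (c2 * (s * s)) + 2 * (c1 * c1 * (s * (s * s))))) +
    (- (c1 * (s * s))) * ((- (c1 * (s * s))) * (- (c1 * (s * s))))) / N ^+ 3.
  rewrite /b3 r3E /r2 /r1 /s /c1 /c2 /c3; move: (r x) => rr; field.
  by [].
rewrite -(normrN (c1 * _)) in R1.
rewrite eb normrM normfV (gtr0_norm (exprn_gt0 3 N0)) ler_wpM2r ?invr_ge0 ?exprn_ge0 ?(ltW N0)//.
apply: (le_trans (normD_le (normD_le (normM_le R3 s2)
  (normM_le n4 (normM_le (normM_le hs R1) R2))) (normM_le R1 (normM_le R1 R1)))).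
lra.
Qed.

(** Three integrations by parts gain [N^-3]. Every term of the last amplitude
    [b3] contains a derivative of [a0], whence the factor [k]. *)
Lemma phase_bound : normc (cmean (fun x => expi (phi x))) <= 832 * k / N ^+ 3.
Proof.
rewrite triple_by_parts Normc.normcM normcX normc_i expr1n mul1r.
have ce : ccont (fun x => expi (phi x)) by apply: ccont_expi; exact: is_derive_cont dphi.
have -> : 832 * k / N ^+ 3 = 2 * (416 * k / N ^+ 3) by rewrite !mulrA -natrM.
apply: cmean_bound.
  by apply: ccont_cintegrable; apply: ccontM => //; exact: ccont_real.
by move=> x; rewrite Normc.normcM normc_expi mul1r normc_real; exact: b3_bound.
Qed.

End Triple.

(** ** Lifts close to the identity *)

(** [C^4]-closeness of a lift to the identity. *)
Definition near_id h (k : R) := forall (i : nat) x, (i < 4)%N ->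
  `|derive1n i.+1 h x - (i == 0%N)%:R| <= k.

(** The phase [n h x + m x] has derivative at least [(m + n) / 2], and its higher
    derivatives are at most [n k]. *)
Lemma near_id_mixing h g k : slift h g -> 0 <= k -> k <= 2^-1 -> near_id h k ->
  mixing_cube h (832 * k).
Proof.
move=> hl k0 k1 hn m n m0 n0.
pose phi x := n%:R * h x + m%:R * x.
pose a i x := n%:R * derive1n i.+1 h x + (if i is 0%N then m%:R else 0).
have m1 : (0 : R) < m%:R by rewrite ltr0n.
have n1 : (0 : R) < n%:R by rewrite ltr0n.
have -> : cmx h (- m%:Z) n%:Z = cmean (fun x => expi (phi x)).
  rewrite /cmx fourierE opprK; congr cmean; apply/funext => x.
  by rewrite /phi expiD /chi -!pmulrn.
have da i (x : R) : is_derive x 1 (a i) (a i.+1 x).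
  have d := smooth_deriv i.+1 x (sl_h hl); rewrite /a.
  by apply: is_derive_eq; rewrite /GRing.scale /= !addr0.
have small i x : (0 < i < 4)%N -> `|a i x| <= (m%:R + n%:R) * k.
  case: i => [//|i] /= i4; rewrite /a addr0 normrM gtr0_norm//.
  have := hn i.+1 x i4; rewrite subr0 => h1.
  apply: (@le_trans _ _ (n%:R * k)); first by rewrite ler_wpM2l// ltW.
  by rewrite ler_wpM2r// lerDr ltW.
apply: (@phase_bound phi (a 0%N) (a 1%N) (a 2%N) (a 3%N)) => //.
- move=> x; have d := smooth_deriv 0 x (sl_h hl); rewrite /phi /a.
  by apply: is_derive_eq; rewrite /GRing.scale /= mulr1.
- exact: is_derive_cont (da 3%N).
- move=> x; rewrite /phi (sl_shift hl).
  have -> : n%:R * (h x + 2 * pi) + m%:R * (x + 2 * pi) =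
    n%:R * h x + m%:R * x + ((n + m)%N : int)%:~R * (2 * pi) :> R.
    by rewrite -pmulrn natrD; ring.
  exact: expi_periodic.
- move=> x; rewrite /a; congr (_ * _ + _).
  exact: (lift_deriv_periodic (slift_lift hl)).
- exact: addr_gt0.
- move=> x; rewrite /a; have := hn 0%N x isT; rewrite eqxx ler_norml => /andP[h1 _].
  have h2 : 2^-1 <= derive1n 1 h x by move: h1 k1; rewrite -[1%:R]/(1:R); lra.
  have := ler_wpM2l (ltW n1) h2; move: (n%:R * _) => y; lra.
- by move=> x; exact: small.
- by move=> x; exact: small.
- by move=> x; exact: small.
Qed.

(** Between frequencies of the same sign the phase may be stationary, but one
    integration by parts in [exp (i n h x)] still gains a factor [m / n]. *)
Lemma near_id_forward h g k (m n : nat) : slift h g -> 0 <= k -> k <= 2^-1 -> near_id h k ->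
  (0 < m)%N -> (0 < n)%N -> normc (cmx h m%:Z n%:Z) <= 8 * m%:R / n%:R.
Proof.
move=> hl k0 k1 hn m0 n0.
have m1 : (1 : R) <= m%:R by rewrite ler1n.
have n1 : (0 : R) < n%:R by rewrite ltr0n.
pose r x := (n%:R * derive1n 1 h x)^-1.
pose r1 x := - (n%:R * derive1n 2 h x * r x ^+ 2).
have h1 x : 2^-1 <= derive1n 1 h x.
  have := hn 0%N x isT; rewrite eqxx ler_norml => /andP[h1 _].
  by move: h1 k1; rewrite -[1%:R]/(1:R); lra.
have p0 x : 0 < n%:R * derive1n 1 h x by rewrite mulr_gt0// (lt_le_trans _ (h1 x))// invr_gt0.
have dphi (x : R) : is_derive x 1 (fun y => n%:R * h y) (n%:R * derive1n 1 h x).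
  have d := smooth_deriv 0 x (sl_h hl).
  by apply: is_derive_eq; rewrite /GRing.scale.
have dpsi (x : R) : is_derive x 1 (fun y => n%:R * derive1n 1 h y) (n%:R * derive1n 2 h x).
  have d := smooth_deriv 1 x (sl_h hl).
  by apply: is_derive_eq; rewrite /GRing.scale.
have dr (x : R) : is_derive x 1 r (r1 x).
  apply: (is_derive_eq (@is_deriveV _ (fun y => n%:R * derive1n 1 h y) x _ 1 (lt0r_neq0 (p0 x)) (dpsi x))).
  by rewrite /r1 /r /GRing.scale /= mulrC mulrN exprVn.
pose G x := chi (- m%:Z) x * (r x)%:C.
have dG := cderivM (cderiv_chi (- m%:Z)) (cderiv_real dr).
have cr := is_derive_cont dr.
have cr1 : continuous r1.
  apply: contN; apply: contM; last exact: contX.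
  by apply: contZ; exact: smooth_continuous (sl_h hl).
have c1 : ccont (fun x => 'i * ((- m%:Z)%:~R)%:C * chi (- m%:Z) x * (r x)%:C + chi (- m%:Z) x * (r1 x)%:C).
  apply: ccontD; apply: ccontM; try exact: ccont_real; try exact: ccont_chi.
  by apply: ccontM; [exact: ccont_cst|exact: ccont_chi].
have pe : periodic2pi (fun x : R => expi (n%:R * h x)).
  move=> x; rewrite (sl_shift hl) mulrDr.
  by have := expi_periodic (n%:R * h x) n; rewrite -pmulrn.
have pG : periodic2pi G.
  move=> x; rewrite /G chi_periodic; congr (_ * (_)%:C).
  by rewrite /r (lift_deriv_periodic (slift_lift hl)).
have st := nonstationary_step dphi (is_derive_cont dpsi) dG c1 pe pG.
have -> : cmx h m%:Z n%:Z = cmean (fun x => expi (n%:R * h x) * ((n%:R * derive1n 1 h x)%:C * G x)).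
  rewrite /cmx fourierE; congr cmean; apply/funext => x.
  rewrite /G [(_)%:C * _]mulrCA -rmorphM /r mulfV ?lt0r_neq0// mulr1.
  by rewrite /chi -!pmulrn.
rewrite st Normc.normcM normc_i mul1r.
have -> : 8 * m%:R / n%:R = 2 * (4 * m%:R / n%:R) :> R by ring.
apply: cmean_bound.
  by apply: ccont_cintegrable; apply: ccontM c1; apply: ccont_expi; exact: is_derive_cont dphi.
move=> x; rewrite Normc.normcM normc_expi mul1r.
have hr : `|r x| <= 2 / n%:R.
  rewrite /r normfV (gtr0_norm (p0 x)) -[2]invrK -invfM lef_pV2 ?posrE ?p0//; last by rewrite mulr_gt0 ?invr_gt0.
  by rewrite mulrC ler_wpM2l// ltW.
have hr1 : `|r1 x| <= 2 / n%:R.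
  rewrite /r1 normrN; have := hn 1%N x isT; rewrite subr0 => h2.
  have := normM_le (normM_le (lexx `|n%:R : R|) (le_trans h2 k1)) (normM_le hr hr).
  rewrite -expr2 (gtr0_norm n1) => h3; apply: (le_trans h3).
  rewrite le_eqVlt; apply/orP; left; apply/eqP; field; exact: lt0r_neq0.
apply: (le_trans (le_normcD _ _)); rewrite !Normc.normcM !normc_chi normc_i !mul1r mulr1 !normc_real.
have -> : `|(- m%:Z)%:~R| = m%:R :> R by rewrite mulrNz normrN -pmulrn normr_nat.
have := ler_wpM2l (le_trans ler01 m1) hr.
have : 2 / n%:R <= m%:R * (2 / n%:R) :> R by rewrite ler_peMl// divr_ge0// ltW.
rewrite -[4 * m%:R / n%:R](_ : 2 * (m%:R * (2 / n%:R)) = _); last by field; exact: lt0r_neq0.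
move: hr1; move: `|r1 x| `|r x| (2 / n%:R) => X Y Z h2 h3 h4.
by apply: (le_trans (lerD h4 (le_trans h2 h3))); lra.
Qed.

Lemma near0_lt (e : R) : 0 < e -> \forall t \near (0 : R), `|t| < e.
Proof. by move=> e0; exact: (@nbhs0_lt _ R^o). Qed.

(** ** Taylor bounds for the exponential *)

Lemma mean_value_bound (f f' : R -> R) (M s : R) : (forall x : R, is_derive x 1 f (f' x)) ->
  (forall y, `|y| <= `|s| -> `|f' y| <= M) -> `|f s - f 0| <= M * `|s|.
Proof.
move=> df hf; have cf := is_derive_cont df.
have cs a b : {within `[a, b], continuous f} by apply: continuous_subspaceT.
have [s0|s0] := leP 0 s.
  have [c /itvP hc ->] := MVT_segment s0 (fun x _ => df x) (cs _ _).
  by rewrite subr0; apply: normM_le => //; apply: hf; rewrite !ger0_norm ?hc.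
have [c /itvP hc e] := MVT_segment (ltW s0) (fun x _ => df x) (cs _ _).
rewrite distrC e sub0r; apply: normM_le; last by rewrite normrN.
by apply: hf; rewrite !ler0_norm ?lerN2 ?hc// ltW.
Qed.

Lemma sin_bound (s : R) : `|sin s| <= `|s|.
Proof.
have h : forall y : R, `|y| <= `|s| -> `|cos y| <= 1.
  by move=> y _; rewrite ler_norml cos_geN1 cos_le1.
by have := mean_value_bound (@is_derive_sin R) h; rewrite sin0 subr0 mul1r.
Qed.

Lemma cos_bound (s : R) : `|cos s - 1| <= `|s| * `|s|.
Proof.
have h : forall y : R, `|y| <= `|s| -> `|- sin y| <= `|s|.
  by move=> y ys; rewrite normrN; exact: le_trans (sin_bound y) ys.
by have := mean_value_bound (@is_derive_cos R) h; rewrite cos0.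
Qed.

Lemma cos_bound1 (s : R) : `|cos s - 1| <= `|s|.
Proof.
have h : forall y : R, `|y| <= `|s| -> `|- sin y| <= 1.
  by move=> y ys; rewrite normrN ler_norml sin_geN1 sin_le1.
by have := mean_value_bound (@is_derive_cos R) h; rewrite cos0 mul1r.
Qed.

Lemma sin_bound2 (s : R) : `|sin s - s| <= `|s| * `|s|.
Proof.
have d (x : R) : is_derive x 1 (fun y : R => sin y - y) (cos x - 1) by apply: is_derive_eq.
have h (y : R) : `|y| <= `|s| -> `|cos y - 1| <= `|s|.
  by move=> ys; exact: le_trans (cos_bound1 y) ys.
by have := mean_value_bound d h; rewrite sin0 !subr0.
Qed.

Lemma expi_bound1 (s : R) : normc (expi s - 1) <= 2 * `|s|.
Proof.
apply: (le_trans (normc_le_ReIm _)).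
by have := cos_bound1 s; have := sin_bound s; rewrite /= subr0; lra.
Qed.

Lemma expi_bound2 (s : R) : normc (expi s - 1 - 'i * s%:C) <= 2 * s ^+ 2.
Proof.
apply: (le_trans (normc_le_ReIm _)).
have := cos_bound s; have := sin_bound2 s; rewrite -normrM -expr2 (ger0_norm (sqr_ge0 s)) /=.
have -> : cos s - 1 - (0 * s - 1 * 0) = cos s - 1 by ring.
have -> : sin s - 0 - (0 * 0 + 1 * s) = sin s - s by ring.
by lra.
Qed.

Lemma chi_shift (l : int) (x y : R) : chi l y = chi l x * expi (l%:~R * (y - x)).
Proof. by rewrite /chi -expiD; congr expi; ring. Qed.

Lemma smooth_periodic_bounded (a : R -> R) : smooth a -> periodic2pi a ->
  forall i, exists2 B, 0 <= B & forall x, `|derive1n i a x| <= B.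
Proof.
move=> sa pa i.
have pi_ : periodic2pi (fun x => (derive1n i a x)%:C).
  elim: i => [|i IH]; first by move=> x; rewrite /= pa.
  by apply: cderiv_periodic IH; apply: cderiv_real => x; exact: smooth_deriv.
have [B B0 hB] := ccont_bounded (ccont_real (smooth_continuous (k := i) sa)) pi_.
by exists B; [exact: ltW|move=> x; rewrite -normc_real; exact: hB].
Qed.

(** ** Estimates along a path *)
Section Path.
Variables (p : R -> R -> R) (A : R -> R).
Hypothesis sp : smooth_path p.
Hypothesis ip : initial_field p A.
Hypothesis sA : smooth_circle A.

Lemma path_slift : \forall t \near (0 : R), exists g, slift (p t) g.
Proof.
have [_ [e e0 [hd _]]] := sp.
by near=> t; apply: diffeo_slift; apply: hd; near: t; exact: near0_lt.
Unshelve. all: by end_near. Qed.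

(** For [i < 4], the derivative of order [i + 1] of the remainder
    [p t y - y - t A y] is at most [|t|]. *)
Lemma path_near_id : exists2 C, 0 <= C & \forall t \near (0 : R), near_id (p t) (C * `|t|).
Proof.
have [s1 p1] := sA.
have hb i : exists B, 0 <= B /\ forall x, `|derive1n i A x| <= B.
  by have [B B0 hB] := smooth_periodic_bounded s1 p1 i; exists B.
have {hb} [B hB] := choice hb.
exists (1 + \sum_(i < 4) B i.+1).
  by rewrite addr_ge0// sumr_ge0// => i _; case: (hB i.+1).
near=> t => i x i4.
have [g hl] : exists g, slift (p t) g by near: t; exact: path_slift.
pose F k x := derive1n k (p t) x - (if k is k'.+1 then (k' == 0%N)%:R else x) - t * derive1n k A x.
have dF k (y : R) : is_derive y 1 (F k) (F k.+1 y).
  have d1 := smooth_deriv k y (sl_h hl); have d2 := smooth_deriv k y s1.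
  have d3 : is_derive y 1 (fun x : R => if k is k'.+1 then (k' == 0%N)%:R else x) (k == 0%N)%:R.
    by case: k {d1 d2} => [|k]; [exact: is_derive_id|exact: is_derive_cst].
  by apply: is_derive_eq; rewrite /F /GRing.scale.
have hF : `|F i.+1 x| <= 1 * `|t|.
  rewrite -(derive1n_seq dF) /F /=; move: x.
  have : forall j : 'I_4, forall x, `|derive1n j.+1 (fun y => p t y - y - t * A y) x| <= 1 * `|t|.
    by near: t; apply: filter_forall => j; exact: ip.
  by move=> /(_ (Ordinal i4)).
have := hF; rewrite /F mul1r => h1.
have -> : derive1n i.+1 (p t) x - (i == 0%N)%:R =
  (derive1n i.+1 (p t) x - (i == 0%N)%:R - t * derive1n i.+1 A x) + t * derive1n i.+1 A x by ring.
apply: (le_trans (ler_normD _ _)); rewrite mulrDl mul1r lerD//.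
rewrite normrM mulrC ler_wpM2r//.
rewrite (bigD1 (Ordinal i4))//=; have [_ /(_ x) h2] := hB i.+1.
apply: (le_trans h2); rewrite lerDl sumr_ge0// => j _; by case: (hB j.+1).
Unshelve. all: by end_near. Qed.

Lemma path_chi_close (l : int) : exists2 K, 0 <= K & \forall t \near (0 : R),
  forall x, normc (chi l (p t x) - chi l x) <= K * `|t|.
Proof.
have [s1 p1] := sA; have [B B0 hB] := smooth_periodic_bounded s1 p1 0.
exists (2 * (`|l%:~R| * (1 + B))); first by rewrite !mulr_ge0// addr_ge0.
near=> t => x.
have h : forall x, `|p t x - x - t * A x| <= 1 * `|t| by near: t; exact: (ip 0%N ltr01).
rewrite (chi_shift l x (p t x)) -[X in _ - X]mulr1 -mulrBr Normc.normcM normc_chi mul1r.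
apply: (le_trans (expi_bound1 _)); rewrite -mulrA ler_wpM2l// normrM -mulrA ler_wpM2l//.
have -> : p t x - x = (p t x - x - t * A x) + t * A x by ring.
apply: (le_trans (ler_normD _ _)); rewrite mulrDl lerD//.
by rewrite normrM mulrC ler_wpM2r//; exact: hB.
Unshelve. all: by end_near. Qed.

(** To first order the exponential is [1 + i l (p t x - x)], and [p t x - x] is
    [t A x] to first order. *)
Lemma path_chi_diff (l : int) (e : R) : 0 < e -> \forall t \near (0 : R), t != 0 ->
  forall x, normc ((t^-1)%:C * (chi l (p t x) - chi l x) -
                   'i * (l%:~R)%:C * (A x)%:C * chi l x) <= e.
Proof.
move=> e0; have [s1 p1] := sA; have [B B0 hB] := smooth_periodic_bounded s1 p1 0.
pose L := `|l%:~R : R|; have L0 : 0 <= L by exact: normr_ge0.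
pose d := e / (2 * (L + 1)); have d0 : 0 < d by rewrite divr_gt0// mulr_gt0// ltr_wpDl.
pose K := 2 * (L * (B + d)) ^+ 2.
have K0 : 0 <= K by rewrite mulr_ge0// exprn_ge0// mulr_ge0// addr_ge0// ltW.
have q0 : 0 < e / (2 * (K + 1)) by rewrite divr_gt0// mulr_gt0// ltr_wpDl.
near=> t => t0 x.
have h : `|p t x - x - t * A x| <= d * `|t|.
  by move: x; near: t; exact: (ip 0%N d0).
have tq : `|t| < e / (2 * (K + 1)) by near: t; exact: near0_lt.
have n0 : 0 < `|t| by rewrite normr_gt0.
set s := l%:~R * (p t x - x).
have hs : `|s| <= L * (B + d) * `|t|.
  rewrite /s normrM -mulrA ler_wpM2l//.
  have -> : p t x - x = (p t x - x - t * A x) + t * A x by ring.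
  apply: (le_trans (ler_normD _ _)); rewrite addrC mulrDl lerD//.
  by rewrite normrM mulrC ler_wpM2r//; exact: hB.
have -> : (t^-1)%:C * (chi l (p t x) - chi l x) - 'i * (l%:~R)%:C * (A x)%:C * chi l x =
  chi l x * ((t^-1)%:C * (expi s - 1 - 'i * s%:C) + 'i * (t^-1 * l%:~R * (p t x - x - t * A x))%:C).
  rewrite (chi_shift l x (p t x)) -/s.
  have -> : (t^-1 * l%:~R * (p t x - x - t * A x))%:C = (t^-1)%:C * s%:C - (l%:~R)%:C * (A x)%:C :> R[i].
    by rewrite -!rmorphM -rmorphB; congr (_)%:C; rewrite /s; field.
  by ring.
rewrite Normc.normcM normc_chi mul1r; apply: (le_trans (le_normcD _ _)).
rewrite !Normc.normcM normc_i mul1r !normc_real.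
have b1 : `|t^-1| * normc (expi s - 1 - 'i * s%:C) <= K * `|t|.
  rewrite normfV mulrC ler_pdivrMr//; apply: (le_trans (expi_bound2 s)).
  have Q0 : 0 <= L * (B + d) * `|t| by rewrite mulr_ge0// mulr_ge0// addr_ge0// ltW.
  have hs2 : `|s| ^+ 2 <= (L * (B + d) * `|t|) ^+ 2 by rewrite ler_pXn2r ?nnegrE.
  rewrite real_normK ?num_real// [in leRHS]exprMn in hs2.
  have -> : K * `|t| * `|t| = 2 * ((L * (B + d)) ^+ 2 * `|t| ^+ 2) by rewrite /K; ring.
  by rewrite ler_wpM2l.
have b2 : `|t^-1 * l%:~R * (p t x - x - t * A x)| <= L * d.
  rewrite !normrM normfV -/L mulrAC -[leRHS]mulrC mulrC.
  have := ler_wpM2l L0 h; rewrite mulrA [L * d]mulrC => h2.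
  have : (`|t|^-1) * (L * `|p t x - x - t * A x|) <= (`|t|^-1) * (d * L * `|t|).
    by rewrite ler_wpM2l// invr_ge0 ltW.
  have -> : (`|t|^-1) * (d * L * `|t|) = d * L by field; rewrite gt_eqF.
  by move=> h3; rewrite -mulrA [_ * L]mulrC.
apply: (le_trans (lerD b1 b2)).
have c1 : K * `|t| <= e / 2.
  have := ltW tq; rewrite ler_pdivlMr ?mulr_gt0 ?ltr_wpDl//.
  have := ltW n0; move: `|t| K0 => y K0; nra.
have c2 : L * d <= e / 2.
  rewrite /d mulrA ler_pdivrMr ?mulr_gt0 ?ltr_wpDl//.
  by have := mulr_ge0 (ltW e0) L0; have := e0; lra.
lra.
Unshelve. all: by end_near. Qed.

End Path.

End Phase.

(** * The derivative at the identity *)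
Section Derivative.
Variable R : realType.
Implicit Types (u v w : R -> R[i]) (F : int -> R[i]) (h g : R -> R) (b : bool) (z a : nat -> R[i]).

(** ** Sums and limits *)

Lemma ccvg_sum (X : nat -> nat -> R[i]) (L : nat -> R[i]) M :
  (forall n, (0 < n)%N -> ccvg (X n) (L n)) ->
  ccvg (fun N => \sum_(1 <= n < M) X n N) (\sum_(1 <= n < M) L n).
Proof.
move=> hX; elim: M => [|M IH].
  by rewrite big_geq//; apply: ccvg_ext (ccvg_cst _) => N; rewrite big_geq.
case: M IH => [|M] IH.
  by rewrite big_geq//; apply: ccvg_ext (ccvg_cst _) => N; rewrite big_geq.
rewrite big_nat_recr//=; apply: ccvg_ext (ccvgD IH (hX M.+1 isT)) => N.
by rewrite [RHS]big_nat_recr.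
Qed.

Lemma csum_tail z (K : R) M : (forall n, (0 < n)%N -> normc (z n) <= K / n%:R ^+ 2) ->
  (0 < M)%N -> normc (csum z - \sum_(1 <= n < M) z n) <= 2 * K / M%:R.
Proof.
move=> hz M0; have [cz _] := csumP hz.
have c1 : ccvg (fun N => \sum_(1 <= n < N) z n - \sum_(1 <= n < M) z n)
    (csum z - \sum_(1 <= n < M) z n) by apply: ccvgD cz (ccvg_cst _).
apply: (@ccvg_le _ _ _ _ M c1) => N MN.
rewrite (@big_cat_nat _ _ _ M 1 N)//= addrAC subrr add0r.
apply: (le_trans (normc_sum _ _ _)).
apply: (@le_trans _ _ (K * \sum_(M <= n < N) n%:R ^- 2)).
  rewrite mulr_sumr big_nat_cond [leRHS]big_nat_cond; apply: ler_sum => n.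
  by rewrite andbT => /andP[Mn _]; apply: hz; exact: leq_trans Mn.
have K0 : 0 <= K by have := le_trans (normc_ge0 _) (hz 1%N isT); rewrite expr1n divr1.
by rewrite [2 * K]mulrC -mulrA ler_wpM2l//; exact: sum_inv_sq.
Qed.

Lemma csum_dominated (zN : nat -> nat -> R[i]) z (K : R) : 0 <= K ->
  (forall N n, (0 < n)%N -> normc (zN N n) <= K / n%:R ^+ 2) ->
  (forall n, (0 < n)%N -> normc (z n) <= K / n%:R ^+ 2) ->
  (forall n, (0 < n)%N -> ccvg (fun N => zN N n) (z n)) ->
  ccvg (fun N => csum (zN N)) (csum z).
Proof.
(* Both tails beyond [M] are at most [2 K / M <= e / 4]. *)
move=> K0 hN hz cz e e0; pose M := (Num.truncn (8 * K / e)).+1.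
have M0 : (0 : R) < M%:R by rewrite ltr0n.
have hM : 2 * K / M%:R <= e / 4.
  rewrite ler_pdivrMr//.
  have : 8 * K / e <= M%:R by apply: ltW; exact: Num.Theory.truncnS_gt.
  by rewrite ler_pdivrMr//; lra.
have e2 : 0 < e / 2 by rewrite divr_gt0.
have [N0 h0] := ccvg_sum M cz e2; exists N0 => N N0N.
have t1 := csum_tail (hN N) (isT : (0 < M)%N); have t2 := csum_tail hz (isT : (0 < M)%N).
have := h0 N N0N; move: t1 t2; move: (\sum_(_ <= _ < _) _) (\sum_(_ <= _ < _) _) => y x t1 t2 t3.
have -> : csum (zN N) - csum z = (csum (zN N) - x) + (x - y) - (csum z - y) by ring.
apply: (le_trans (normcB _ _)); apply: (le_trans (lerD (le_normcD _ _) (lexx _))).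
by apply: (le_trans (lerD (lerD t1 t3) t2)); lra.
Qed.

Lemma csum_sum (X : nat -> nat -> R[i]) a (K : nat -> R) N :
  (forall l n, (0 < l)%N -> (0 < n)%N -> normc (X l n) <= K l / n%:R ^+ 2) ->
  csum (fun n => \sum_(1 <= l < N) X l n * a l) = \sum_(1 <= l < N) csum (X l) * a l.
Proof.
move=> hX; apply: csum_unique.
have c l : (0 < l)%N -> ccvg (fun M => a l * \sum_(1 <= n < M) X l n) (a l * csum (X l)).
  by move=> l0; apply: ccvgZ; have [] := csumP (fun n n0 => hX l n l0 n0).
have -> : \sum_(1 <= l < N) csum (X l) * a l = \sum_(1 <= l < N) a l * csum (X l).
  by apply: eq_bigr => l _; rewrite mulrC.
apply: ccvg_ext (ccvg_sum N c) => M; rewrite exchange_big.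
by apply: eq_bigr => l _; rewrite mulr_sumr; apply: eq_bigr => n _; rewrite mulrC.
Qed.

Lemma psum_coef b F (K : R) k : (forall N, psum b F N <= K) -> (0 < k)%N ->
  normc (F (freq b k)) <= Num.sqrt K.
Proof.
move=> hK k0; have : k%:R * absC2 (F (freq b k)) <= K.
  apply: le_trans (hK k.+1); rewrite /psum big_nat_recr//= lerDr.
  by apply: sumr_ge0 => n _; exact: psum_term_ge0.
rewrite normcE => h; apply: ler_wsqrtr; apply: le_trans h.
by rewrite ler_peMl ?absC2_ge0// ler1n.
Qed.

(** ** Operator norms *)

Lemma fourier_zero n : fourier (@zero_fun R) n = 0.
Proof.
have := @fourierZ R 0 (fun=> 0) n (@cintegrable0 R).
rewrite [RHS]mul0r => e; rewrite -[RHS]e.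
by suff -> : (fun=> 0 * 0) = @zero_fun R by []; apply/funext => x; rewrite mul0r.
Qed.

Lemma Hplus_zero : Hplus (@zero_fun R).
Proof.
rewrite HplusE; apply/HsgnP; split; last by move=> n _; exact: fourier_zero.
apply: (@Hhalf_intro _ _ 0).
  by apply: ccont_L2circle; [exact: ccont_cst|by move=> x].
move=> N; rewrite /wsum big1// => n _; rewrite !fourier_zero.
by rewrite absC2_0 addr0 mulr0.
Qed.

(** The lower bound comes from the value at the zero function. *)
Lemma opnorm_bounds (T : (R -> R[i]) -> (R -> R[i])) (k : R) : 0 <= k ->
  (forall u, Hplus u -> (forall N, wsum (fourier u) N <= 1) ->
    forall N, wsum (fourier (T u)) N <= k ^+ 2) ->
  (0 <= opnorm T)%E /\ (opnorm T <= k%:E)%E.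
Proof.
move=> k0 hT; split.
  apply: (@le_trans _ _ (normH (T (@zero_fun R)))); first exact: sqrte_ge0.
  apply: ereal_sup_ubound; exists (@zero_fun R) => //; split; first exact: Hplus_zero.
  apply/(normH_le _ ler01) => N; rewrite expr1n /wsum big1// => n _.
  by rewrite !fourier_zero absC2_0 addr0 mulr0.
apply: ge_ereal_sup => _ [u [hu /(normH_le _ ler01) nu] <-].
by apply/(normH_le _ k0); apply: hT => // N; rewrite -[1](expr1n _ 2).
Qed.

Lemma Hsgn_eqH b u v : Hsgn b u -> Hsgn b v ->
  (forall n : nat, (0 < n)%N -> fourier u (freq b n) = fourier v (freq b n)) -> eqH u v.
Proof.
move=> hu hv e; have [[u2 _] un] := (HsgnP _ _).1 hu; have [[v2 _] vn] := (HsgnP _ _).1 hv.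
apply: fourier_eqH => // k k0.
have [n [s [n0 ->]]] : exists n s, (0 < n)%N /\ k = freq s n.
  case: k k0 => [[|n]|n] // _; first by exists n.+1, true.
  by exists n.+1, false; rewrite NegzE.
have [->|->] : s = b \/ s = ~~ b by case: s; case: (b); [left|right|right|left].
  exact: e.
by rewrite un// vn.
Qed.

Lemma fourier_lin (c : R[i]) u v n : cintegrable u -> cintegrable v ->
  fourier (fun x => c * u x + v x) n = c * fourier u n + fourier v n.
Proof. by move=> iu iv; rewrite (fourierD _ (cintegrableZ c iu) iv) (fourierZ _ _ iu). Qed.

Lemma Hsgn_lin b (c : R[i]) u v : Hsgn b u -> Hsgn b v -> Hsgn b (fun x => c * u x + v x).
Proof.
move=> hu hv; have [hu1 un] := (HsgnP _ _).1 hu; have [hv1 vn] := (HsgnP _ _).1 hv.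
apply/HsgnP; split; first exact: (HhalfD (HhalfZ c hu1) hv1).
move=> n n0; rewrite fourier_lin; try exact: Hhalf_cintegrable.
by rewrite un// vn// mulr0 addr0.
Qed.

(** ** The matrix of the derivative *)
Variable A : R -> R.
Hypothesis sA : smooth_circle A.

(** The matrix of [u |-> P_- (A u')]: moving along the field [A] adds [t A u'] to
    [u] to first order. *)
Definition Dmx (m k : nat) : R[i] :=
  'i * k%:R * fourier (fun x => (A x)%:C) (- (m + k)%N%:Z).

Lemma fourier_iter_deriv j n : fourier (fun x => (derive1n j A x)%:C) n =
  ('i * (n%:~R)%:C) ^+ j * fourier (fun x => (A x)%:C) n.
Proof.
have [s1 p1] := sA; elim: j => [|j IH]; first by rewrite expr0 mul1r.
have d : cderiv (fun x => (derive1n j A x)%:C) (fun x => (derive1n j.+1 A x)%:C).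
  by apply: cderiv_real => x; exact: smooth_deriv.
have c : ccont (fun x => (derive1n j.+1 A x)%:C).
  by apply: ccont_real; exact: smooth_continuous.
have pj : periodic2pi (fun x => (derive1n j A x)%:C).
  elim: j {IH d c} => [|j IH]; first by move=> x; rewrite /= p1.
  by apply: cderiv_periodic IH; apply: cderiv_real => x; exact: smooth_deriv.
by rewrite (fourier_deriv n d c pj) IH mulrA -exprS.
Qed.

(** Six derivatives of [A] are bounded, and [(m + k)^6 >= m^2 k^4]. *)
Lemma Dmx_decay : exists2 C, 0 <= C & forall m k : nat, (0 < m)%N -> (0 < k)%N ->
  normc (Dmx m k) <= C / (m%:R ^+ 2 * k%:R ^+ 3).
Proof.
have [s1 p1] := sA; have [B B0 hB] := smooth_periodic_bounded s1 p1 6.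
exists (2 * B); first by rewrite mulr_ge0.
move=> m k m0 k0.
have m1 : (0 : R) < m%:R by rewrite ltr0n.
have k1 : (0 : R) < k%:R by rewrite ltr0n.
have c6 : cintegrable (fun x => (derive1n 6 A x)%:C).
  by apply: ccont_cintegrable; apply: ccont_real; exact: smooth_continuous.
have b6 : forall x, normc ((derive1n 6 A x)%:C) <= B by move=> x; rewrite normc_real; exact: hB.
have := fourier_bound (- (m + k)%N%:Z) c6 b6.
rewrite fourier_iter_deriv /Dmx; move: (fourier _ _) => X.
rewrite Normc.normcM normcX !Normc.normcM normc_i normc_nat !mul1r normc_real.
have -> : `|(- (m + k)%N%:Z)%:~R| = m%:R + k%:R :> R.
  by rewrite mulrNz normrN -pmulrn normr_nat natrD.
rewrite mulrC -ler_pdivlMr ?exprn_gt0 ?addr_gt0// => hX.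
apply: (le_trans (ler_wpM2l (ltW k1) hX)).
rewrite mulrA ler_pdivrMr ?exprn_gt0 ?addr_gt0// mulrAC ler_pdivlMr ?mulr_gt0 ?exprn_gt0//.
rewrite [k%:R * _]mulrC -mulrA ler_wpM2l ?mulr_ge0//.
have -> : k%:R * (m%:R ^+ 2 * k%:R ^+ 3) = m%:R ^+ 2 * k%:R ^+ 4 :> R by ring.
have le2 n (x y : R) : 0 <= x -> x <= y -> x ^+ n <= y ^+ n.
  by move=> x0 xy; apply: lerXn2r => //; rewrite nnegrE// (le_trans x0).
rewrite (exprD (m%:R + k%:R) 2 4); apply: ler_pM; [by rewrite exprn_ge0// ltW|by rewrite exprn_ge0// ltW| |].
  by apply: le2; [exact: ltW|rewrite lerDl ltW].
by apply: le2; [exact: ltW|rewrite lerDr ltW].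
Qed.

Definition Dcoef u (m : nat) : R[i] := csum (fun k => Dmx m k * fourier u k%:Z).

(** An operator acts on representatives, so one has to be chosen; the sum of the
    Fourier series is a continuous one. *)
Definition Dop u : R -> R[i] :=
  xget (@zero_fun R) [set f | uniform_series f (onesided false (Dcoef u))].

Section WithBound.
Variable C : R.
Hypothesis C0 : 0 <= C.
Hypothesis hC : forall m k : nat, (0 < m)%N -> (0 < k)%N ->
  normc (Dmx m k) <= C / (m%:R ^+ 2 * k%:R ^+ 3).

Lemma Dmx_term (Q : R) (x : R[i]) m k : (0 < m)%N -> (0 < k)%N -> normc x <= Q ->
  normc (Dmx m k * x) <= C * Q / m%:R ^+ 2 / k%:R ^+ 2.
Proof.
move=> m0 k0 hx; have Q0 := le_trans (normc_ge0 _) hx.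
have m1 : (0 : R) < m%:R by rewrite ltr0n.
have k1 : (0 : R) < k%:R by rewrite ltr0n.
have k2 : (1 : R) <= k%:R by rewrite ler1n.
rewrite Normc.normcM.
apply: (le_trans (ler_pM (normc_ge0 _) (normc_ge0 _) (hC m0 k0) hx)).
rewrite [leLHS](_ : _ = C * Q / m%:R ^+ 2 / k%:R ^+ 2 * (k%:R)^-1); last first.
  by field; rewrite !gt_eqF.
by rewrite ler_piMr ?invf_le1// !divr_ge0 ?exprn_ge0 ?mulr_ge0.
Qed.

Lemma Dcoef_sum u (K : R) m : (0 < m)%N -> (forall N, psum true (fourier u) N <= K) ->
  ccvg (fun N => \sum_(1 <= k < N) Dmx m k * fourier u k%:Z) (Dcoef u m) /\
  normc (Dcoef u m) <= 2 * C * Num.sqrt K / m%:R ^+ 2.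
Proof.
move=> m0 hK; have [c n] := csumP (fun k k0 => Dmx_term m0 k0 (psum_coef hK k0)).
by split; [exact: c|rewrite -!mulrA; move: n; rewrite -!mulrA].
Qed.

Lemma Dop_spec u : Hsgn true u -> Hsgn false (Dop u) /\
  forall m : nat, (0 < m)%N -> fourier (Dop u) (freq false m) = Dcoef u m.
Proof.
move=> hu; have [K K0 hK] := Hsgn_psum hu.
have dK : decay2 (2 * C * Num.sqrt K) (Dcoef u) by move=> m m0; have [] := Dcoef_sum m0 hK.
have k0 : 0 <= 2 * C * Num.sqrt K by rewrite !mulr_ge0// sqrtr_ge0.
have us : uniform_series (Dop u) (onesided false (Dcoef u)).
  have [f hf] := onesided_series false k0 dK.
  have : [set f | uniform_series f (onesided false (Dcoef u))] (Dop u).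
    by apply: xgetPex; exists f.
  by [].
split; first exact: onesided_Hsgn k0 dK us.
by move=> m m0; rewrite (uniform_series_fourier _ us) (onesided_same false).
Qed.

Lemma Hsgn_small_wsum b v (K : R) : 0 <= K ->
  (forall n : nat, (0 < n)%N -> fourier v (freq (~~ b) n) = 0) ->
  (forall m : nat, (0 < m)%N -> absC2 (fourier v (freq b m)) <= K / m%:R ^+ 3) ->
  forall N, wsum (fourier v) N <= 2 * K.
Proof.
move=> K0 h0 hK N; rewrite (wsum_psum b) [X in _ + X](_ : _ = 0) ?addr0.
  exact: weighted_tail_le.
rewrite /psum big_nat_cond big1// => n; rewrite andbT => /andP[n1 _].
by rewrite h0// absC2_0 mulr0.
Qed.

Lemma Dop_bounded : bounded_plus_minus Dop.
Proof.
split.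
- by move=> u; rewrite HplusE HminusE => /Dop_spec[].
- move=> u v; rewrite HplusE => hu hv euv.
  have [h1 e1] := Dop_spec hu; have [h2 e2] := Dop_spec hv.
  have iu : cintegrable u by case: hu => /Hhalf_cintegrable.
  have iv : cintegrable v by case: hv => /Hhalf_cintegrable.
  have eD n : Dcoef u n = Dcoef v n.
    rewrite /Dcoef; suff -> : (fun k => Dmx n k * fourier u k%:Z) = (fun k => Dmx n k * fourier v k%:Z) by [].
    apply/funext => -[|k]; first by rewrite /Dmx mulr0 !mul0r.
    by rewrite (eqH_fourier (n := k.+1%:Z) iu iv euv).
  have eq n : (0 < n)%N -> fourier (Dop u) (freq false n) = fourier (Dop v) (freq false n).
    by move=> n0; exact: etrans (e1 n n0) (etrans (eD n) (esym (e2 n n0))).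
  exact: Hsgn_eqH h1 h2 eq.
- move=> c u v; rewrite HplusE => hu hv.
  have [h1 e1] := Dop_spec hu; have [h2 e2] := Dop_spec hv.
  have [iu iv] : cintegrable u /\ cintegrable v.
    by split; [case: hu|case: hv] => /Hhalf_cintegrable.
  have [i1 i2] : cintegrable (Dop u) /\ cintegrable (Dop v).
    by split; [case: h1|case: h2] => /Hhalf_cintegrable.
  have hcuv := Hsgn_lin c hu hv; have hD := Hsgn_lin c h1 h2.
  have [h3 e3] := Dop_spec hcuv.
  have [Ku _ hKu] := Hsgn_psum hu; have [Kv _ hKv] := Hsgn_psum hv.
  have eD m : (0 < m)%N -> Dcoef (fun x => c * u x + v x) m = c * Dcoef u m + Dcoef v m.
    move=> m0; have [cu _] := Dcoef_sum m0 hKu; have [cv _] := Dcoef_sum m0 hKv.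
    apply: csum_unique; apply: ccvg_ext (ccvgD (ccvgZ c cu) cv) => N.
    rewrite mulr_sumr -big_split; apply: eq_bigr => k _.
    by rewrite fourier_lin// mulrDr mulrCA.
  have eq m : (0 < m)%N -> fourier (Dop (fun x => c * u x + v x)) (freq false m) =
      fourier (fun x => c * Dop u x + Dop v x) (freq false m).
    move=> m0; apply: (etrans (e3 m m0)); apply: (etrans (eD m m0)).
    apply: esym; apply: (etrans (fourier_lin c (freq false m) i1 i2)).
    by apply: (congr2 (fun x y => c * x + y)); [exact: e1|exact: e2].
  exact: Hsgn_eqH h3 hD eq.
- have k0 : 0 <= Num.sqrt (2 * (2 * C) ^+ 2) by exact: sqrtr_ge0.
  have := @opnorm_bounds Dop _ k0; case => [u hu nu N|_ h]; last exact: le_lt_trans h (ltry _).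
  rewrite sqr_sqrtr ?mulr_ge0 ?exprn_ge0 ?mulr_ge0//.
  rewrite HplusE in hu; have [h1 e1] := Dop_spec hu.
  have nu' M : psum true (fourier u) M <= 1.
    by apply: le_trans (nu M); rewrite (wsum_psum true) lerDl psum_ge0.
  have [_ z1] := (HsgnP _ _).1 h1.
  apply: (@Hsgn_small_wsum false) => //; first by rewrite exprn_ge0// mulr_ge0.
  move=> m m0; have m1 : (0 : R) < m%:R by rewrite ltr0n.
  rewrite (e1 m m0) absC2E; have [_] := Dcoef_sum m0 nu'; rewrite sqrtr1 mulr1 => hm.
  apply: (@le_trans _ _ ((2 * C / m%:R ^+ 2) ^+ 2)).
    by rewrite ler_pXn2r ?nnegrE ?normc_ge0 ?divr_ge0 ?exprn_ge0 ?mulr_ge0.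
  rewrite expr_div_n ler_wpM2l ?exprn_ge0 ?mulr_ge0// -exprM.
  by rewrite lef_pV2 ?posrE ?exprn_gt0// ler_weXn2l// ler1n.
Qed.

End WithBound.
End Derivative.

(** * Differentiability along a path *)
Section PathDerivative.
Variable R : realType.
Implicit Types (u v w : R -> R[i]) (h g : R -> R).

Lemma smooth_seq (F : nat -> R -> R) :
  (forall k (x : R), is_derive x 1 (F k) (F k.+1 x)) -> smooth (F 0%N).
Proof. by move=> dF k x; rewrite (derive1n_seq dF); case: (dF k x). Qed.

Lemma slift_id : slift (@id R) id.
Proof.
have s : smooth (@id R).
  apply: (@smooth_seq (fun k x => if k is k'.+1 then (k' == 0%N)%:R else x)) => k x.
  by case: k => [|k]; [exact: is_derive_id|exact: is_derive_cst].
by split.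
Qed.

(** The identity has no mixing entries. *)
Lemma Zop_id u : Hplus u -> Hsgn false (Zop id u) /\
  forall m : nat, (0 < m)%N -> fourier (Zop id u) (freq false m) = 0.
Proof.
move=> hu.
have mix : mixing_cube (@id R) 0.
  move=> m k m0 k0; rewrite mul0r /cmx (_ : fourier _ _ = 0) ?Normc.normc0//.
  rewrite -[LHS]/(fourier (chi k%:Z) (- m%:Z)) fourier_chi.
  by have -> : (k%:Z == - m%:Z) = false by lia.
have q0 : (0 : R) <= 1 / 4 by rewrite divr_ge0.
have [w [hw _ hZ eZ]] := Zop_spec slift_id (lexx 0) q0 mix hu.
split; first exact: hZ.
move=> m m0; apply: (etrans (eZ m m0)).
by have [_ z] := (HsgnP _ _).1 hw; exact: z.
Qed.

Variables (p : R -> R -> R) (A : R -> R).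
Hypothesis sp : smooth_path p.
Hypothesis ip : initial_field p A.
Hypothesis sA : smooth_circle A.
Variable C : R.
Hypothesis C0 : 0 <= C.
Hypothesis hC : forall m k : nat, (0 < m)%N -> (0 < k)%N ->
  normc (Dmx A m k) <= C / (m%:R ^+ 2 * k%:R ^+ 3).

(** [D] composed with the analytic part of composition by [h]. *)
Definition Dcomp h (m l : nat) : R[i] := csum (fun k => Dmx A m k * cmx h k%:Z l%:Z).

(** The difference quotient minus the derivative, read on the solution [w] of
    [P_+ (w \o h) = u] instead of on [u]. *)
Definition mixing_error h (t : R) (m l : nat) : R[i] :=
  (t^-1)%:C * cmx h (- m%:Z) l%:Z - Dcomp h m l.

Lemma Dcomp_term h g k0 (m l k : nat) : slift h g -> 0 <= k0 -> k0 <= 2^-1 -> near_id h k0 ->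
  (0 < m)%N -> (0 < l)%N -> (0 < k)%N ->
  normc (Dmx A m k * cmx h k%:Z l%:Z) <= 8 * C / (m%:R ^+ 2 * l%:R) / k%:R ^+ 2.
Proof.
move=> hl a0 a1 hn m0 l0 k1; rewrite Normc.normcM.
apply: (le_trans (ler_pM (normc_ge0 _) (normc_ge0 _) (hC m0 k1) (near_id_forward hl a0 a1 hn k1 l0))).
rewrite le_eqVlt; apply/orP; left; apply/eqP; field.
by rewrite !pnatr_eq0 -!lt0n l0 k1 m0.
Qed.

Lemma Dcomp_bound h g k0 (m l : nat) : slift h g -> 0 <= k0 -> k0 <= 2^-1 -> near_id h k0 ->
  (0 < m)%N -> (0 < l)%N -> normc (Dcomp h m l) <= 16 * C / (m%:R ^+ 2 * l%:R).
Proof.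
move=> hl a0 a1 hn m0 l0.
have [_ h1] := csumP (fun k k1 => Dcomp_term hl a0 a1 hn m0 l0 k1).
by apply: (le_trans h1); rewrite le_eqVlt; apply/orP; left; apply/eqP; ring.
Qed.

(** For the truncations of [w] both sides are finite sums; the first term passes to
    the limit by [analytic_partial_sums], the second by dominated convergence. *)
Lemma mixing_error_limit h g k0 M t w m : slift h g -> 0 <= k0 -> k0 <= 2^-1 -> near_id h k0 ->
  0 <= M -> mixing_le h M -> Hsgn true w -> (0 < m)%N ->
  ccvg (fun N => \sum_(1 <= l < N) mixing_error h t m l * fourier w l%:Z)
    ((t^-1)%:C * fourier (w \o h) (- m%:Z) -
     csum (fun k => Dmx A m k * fourier (w \o h) k%:Z)).
Proof.
move=> hl a0 a1 hn M0 mix hw m0; have [K K0 hK] := Hsgn_psum hw.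
pose T N := trigpoly true N (fun n => fourier w n%:Z).
pose Q := (1 + 4 * M) * K.
have hT N M1 : psum true (fourier (T N \o h)) M1 <= Q.
  have [h1 _] := trigpoly_comp_norm hl N (fun n => fourier w n%:Z).
  have h2 M' := trigpoly_comp_anti hl N (fun n => fourier w n%:Z) M' M0 mix.
  apply: (le_trans (h1 _ h2 M1)); rewrite -[X in X + _]mul1r -mulrDl.
  rewrite ler_wpM2l ?addr_ge0 ?mulr_ge0//.
  by rewrite psum_trigpoly; exact: (hK N).
have hw2 M1 : psum true (fourier (w \o h)) M1 <= Q.
  by have [+ _] := comp_bounded hl M0 mix hw hK; apply.
have mz : - m%:Z != 0 :> int by lia.
have c1 := ccvgZ ((t^-1)%:C) (analytic_partial_sums hl hw mz).
have S0 : 0 <= C * Num.sqrt Q / m%:R ^+ 2.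
  by rewrite divr_ge0 ?exprn_ge0// mulr_ge0// sqrtr_ge0.
have c2 : ccvg (fun N => csum (fun k => Dmx A m k * fourier (T N \o h) k%:Z))
    (csum (fun k => Dmx A m k * fourier (w \o h) k%:Z)).
  apply: (csum_dominated S0).
  - by move=> N k k1; apply: (Dmx_term C0 hC m0 k1); exact: (psum_coef (b := true) (hT N) k1).
  - by move=> k k1; apply: (Dmx_term C0 hC m0 k1); exact: (psum_coef (b := true) hw2 k1).
  - move=> k k1; apply: ccvgZ; apply: (analytic_partial_sums hl hw); lia.
have := ccvgD c1 (ccvgZ (-1) c2); rewrite mulN1r; apply: ccvg_ext => N.
rewrite mulN1r (fourier_trigpoly_comp hl).
have -> : csum (fun k => Dmx A m k * fourier (T N \o h) k%:Z) =
    csum (fun k => \sum_(1 <= l < N) (Dmx A m k * cmx h k%:Z l%:Z) * fourier w l%:Z).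
  suff -> : (fun k => Dmx A m k * fourier (T N \o h) k%:Z) =
    (fun k => \sum_(1 <= l < N) (Dmx A m k * cmx h k%:Z l%:Z) * fourier w l%:Z) by [].
  apply/funext => k; rewrite (fourier_trigpoly_comp hl) mulr_sumr.
  by apply: eq_bigr => l _; rewrite mulrA.
rewrite (csum_sum _ _ (fun l k l0 k1 => Dcomp_term hl a0 a1 hn m0 l0 k1)).
rewrite mulr_sumr -sumrB; apply: eq_bigr => l _.
by rewrite /mixing_error mulrBl mulrA.
Qed.

(** ** The entries of the error tend to zero, uniformly dominated *)

(** The character [e_l] has no coefficient at [- m], so the quotient is that of
    [e_l \o p t - e_l], which converges uniformly. *)
Lemma cmx_quotient_limit (m l : nat) (e : R) : (0 < m)%N -> (0 < l)%N -> 0 < e ->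
  \forall t \near (0 : R), t != 0 ->
    normc ((t^-1)%:C * cmx (p t) (- m%:Z) l%:Z - Dmx A m l) <= e.
Proof.
move=> m0 l0 e0; have e2 : 0 < e / 2 by rewrite divr_gt0.
have [s1 _] := sA.
apply: filterS2 (path_slift sp) (path_chi_diff ip sA l%:Z e2) => t [g hl] hq t0.
have hd := hq t0.
have cA : ccont (fun x => (A x)%:C) by apply: ccont_real; exact: smooth_cont.
have cl : ccont (fun x => chi l%:Z (p t x)).
  by apply: ccont_comp; [exact: ccont_chi|exact: smooth_cont (sl_h hl)].
pose q1 x := (t^-1)%:C * (chi l%:Z (p t x) - chi l%:Z x).
pose q2 x := 'i * (l%:Z%:~R)%:C * (A x)%:C * chi l%:Z x.
have c1 : ccont q1.
  apply: ccontM; first exact: ccont_cst.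
  by apply: ccontD => //; apply: ccontN; exact: ccont_chi.
have c2 : ccont q2.
  by apply: ccontM; [apply: ccontM => //; exact: ccont_cst|exact: ccont_chi].
have i1 := ccont_cintegrable c1; have i2 := ccont_cintegrable c2.
have il : cintegrable (fun x => chi l%:Z (p t x)) by exact: ccont_cintegrable.
have ic := ccont_cintegrable (@ccont_chi R l%:Z).
have f1 : fourier q1 (- m%:Z) = (t^-1)%:C * cmx (p t) (- m%:Z) l%:Z.
  rewrite /q1 (fourierZ _ _ (cintegrableB il ic)) (fourierB _ il ic) fourier_chi.
  have -> : (l%:Z == - m%:Z) = false by lia.
  by rewrite subr0.
have f2 : fourier q2 (- m%:Z) = Dmx A m l.
  rewrite /q2 fourier_mul_chi (fourierZ _ _ (ccont_cintegrable cA)) /Dmx.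
  rewrite -pmulrn rmorph_nat.
  by have -> : - m%:Z - l%:Z = - (m + l)%N%:Z by lia.
rewrite -f1 -f2 -(fourierB _ i1 i2).
have -> : e = 2 * (e / 2) by field.
by apply: fourier_bound; [exact: cintegrableB i1 i2|exact: hd].
Qed.

(** The entries of the composition operator tend to those of the identity, and the
    decay of [Dmx] makes the sum converge uniformly. *)
Lemma Dcomp_limit (m l : nat) (e : R) : (0 < m)%N -> (0 < l)%N -> 0 < e ->
  \forall t \near (0 : R), normc (Dcomp (p t) m l - Dmx A m l) <= e.
Proof.
move=> m0 l0 e0; have [K K0 hK] := path_chi_close ip sA l%:Z.
have [B B0 hB] := path_near_id sp ip sA.
pose Q := 4 * C * K; have Q0 : 0 <= Q by rewrite !mulr_ge0.
have q0 : 0 < e / (Q + 1) by rewrite divr_gt0// ltr_wpDl.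
have b0 : 0 < 2^-1 / (B + 1) by rewrite divr_gt0// ltr_wpDl.
near=> t.
have [g hl] : exists g, slift (p t) g by near: t; exact: path_slift sp.
have hn : near_id (p t) (B * `|t|) by near: t.
have hc : forall x, normc (chi l%:Z (p t x) - chi l%:Z x) <= K * `|t| by near: t.
have tq : `|t| < e / (Q + 1) by near: t; exact: near0_lt.
have tb : `|t| < 2^-1 / (B + 1) by near: t; exact: near0_lt.
have a0 : 0 <= B * `|t| by rewrite mulr_ge0.
have a1 : B * `|t| <= 2^-1.
  have := ltW tb; rewrite ler_pdivlMr ?ltr_wpDl//.
  by have := normr_ge0 t; move: `|t| => y y0; lra.
have m1 : (1 : R) <= m%:R by rewrite ler1n.
pose d (k : nat) : R[i] := (l%:Z == k%:Z :> int)%:R.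
have close k : normc (cmx (p t) k%:Z l%:Z - d k) <= 2 * (K * `|t|).
  have il : cintegrable (fun x => chi l%:Z (p t x)).
    by apply: ccont_cintegrable; apply: ccont_comp; [exact: ccont_chi|exact: smooth_cont (sl_h hl)].
  have ic := ccont_cintegrable (@ccont_chi R l%:Z).
  rewrite /d -(@fourier_chi R l%:Z k%:Z) /cmx -(fourierB _ il ic).
  by apply: fourier_bound; [exact: cintegrableB il ic|exact: hc].
have d1 k : normc (d k) <= 1.
  by rewrite /d; case: eqP => _; rewrite ?Normc.normc0// Normc.normc1.
have dE : csum (fun k => Dmx A m k * d k) = Dmx A m l.
  apply: csum_unique => r r0; exists l.+1 => N lN.
  rewrite (bigD1_seq l) ?mem_index_iota ?iota_uniq ?l0 ?lN//=.
  rewrite /d eqxx mulr1 big1 ?addr0 ?subrr ?Normc.normc0 ?(ltW r0)//.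
  move=> k kl; suff -> : (l%:Z == k%:Z :> int) = false by rewrite mulr0.
  by apply/negP => /eqP[lk]; rewrite lk eqxx in kl.
rewrite -dE /Dcomp.
have t1 k k1 := Dcomp_term hl a0 a1 hn m0 l0 (k := k) k1.
have t2 k k1 := Dmx_term C0 hC m0 (k := k) k1 (d1 k).
rewrite (csumB t1 t2).
have t3 k : (0 < k)%N -> normc (Dmx A m k * cmx (p t) k%:Z l%:Z - Dmx A m k * d k) <=
    C * (2 * (K * `|t|)) / m%:R ^+ 2 / k%:R ^+ 2.
  by move=> k1; rewrite -mulrBr; apply: (Dmx_term C0 hC m0 k1); exact: close.
have [_ h3] := csumP t3; apply: (le_trans h3).
apply: (@le_trans _ _ (Q * `|t|)).
  have -> : 2 * (C * (2 * (K * `|t|)) / m%:R ^+ 2) = Q * `|t| / m%:R ^+ 2 by rewrite /Q; ring.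
  by rewrite ler_pdivrMr ?exprn_gt0 ?(lt_le_trans _ m1)// ler_peMr ?mulr_ge0// exprn_ege1.
have := ltW tq; rewrite ler_pdivlMr ?ltr_wpDl//.
by have := normr_ge0 t; move: `|t| => y y0; lra.
Unshelve. all: by end_near. Qed.

Lemma mixing_error_dominated : exists2 K, 0 <= K & \forall t \near (0 : R), t != 0 ->
  forall m l : nat, (0 < m)%N -> (0 < l)%N ->
    normc (mixing_error (p t) t m l) <= K / (m%:R ^+ 2 * l%:R).
Proof.
have [B B0 hB] := path_near_id sp ip sA.
have b0 : 0 < 2^-1 / (B + 1) by rewrite divr_gt0// ltr_wpDl.
exists (832 * B + 16 * C); first exact: addr_ge0 (mulr_ge0 (ler0n _ _) B0) (mulr_ge0 (ler0n _ _) C0).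
near=> t => t0 m l m0 l0.
have [g hl] : exists g, slift (p t) g by near: t; exact: path_slift sp.
have hn : near_id (p t) (B * `|t|) by near: t.
have tb : `|t| < 2^-1 / (B + 1) by near: t; exact: near0_lt.
have a0 : 0 <= B * `|t| by rewrite mulr_ge0.
have a1 : B * `|t| <= 2^-1.
  have := ltW tb; rewrite ler_pdivlMr ?ltr_wpDl//.
  by have := normr_ge0 t; move: `|t| => y y0; lra.
have k0 : 0 <= 832 * (B * `|t|) := mulr_ge0 (ler0n _ _) a0.
have mix := mixing_cube_small k0 (near_id_mixing hl a0 a1 hn) m0 l0.
apply: (le_trans (normcB _ _)); rewrite mulrDl; apply: lerD; last exact: Dcomp_bound hl a0 a1 hn m0 l0.
have n0 : 0 < `|t| by rewrite normr_gt0.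
rewrite Normc.normcM normc_real normfV mulrC ler_pdivrMr//.
by apply: (le_trans mix); rewrite le_eqVlt; apply/orP; left; apply/eqP; ring.
Unshelve. all: by end_near. Qed.

(** Where [m l] is large the domination by [m^-2 l^-1] suffices; finitely many
    entries remain, and each of them tends to 0. *)
Lemma mixing_error_small (e : R) : 0 < e -> \forall t \near (0 : R), t != 0 ->
  forall m l : nat, (0 < m)%N -> (0 < l)%N ->
    absC2 (mixing_error (p t) t m l) <= e / m%:R ^+ 3 / l%:R.
Proof.
move=> e0; have [K K0 hK] := mixing_error_dominated.
pose M := (Num.truncn (K ^+ 2 / e)).+1.
have M0 : (0 : R) < M%:R by rewrite ltr0n.
have hM : K ^+ 2 <= e * M%:R.
  rewrite mulrC -ler_pdivrMr//; apply: ltW; exact: Num.Theory.truncnS_gt.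
pose d := Num.sqrt (e / M%:R ^+ 4).
have d0 : 0 < d by rewrite sqrtr_gt0 divr_gt0// exprn_gt0.
have d2 : 0 < d / 2 by rewrite divr_gt0.
have small : forall i j : 'I_M, \forall t \near (0 : R), t != 0 ->
    (0 < i)%N -> (0 < j)%N -> normc (mixing_error (p t) t i j) <= d.
  move=> i j; case: (posnP i) => [->|i0]; first by near=> t.
  case: (posnP j) => [->|j0]; first by near=> t.
  near=> t => t0 _ _.
  have h1 : normc ((t^-1)%:C * cmx (p t) (- (i : nat)%:Z) (j : nat)%:Z - Dmx A i j) <= d / 2.
    by move: t0; near: t; exact: cmx_quotient_limit.
  have h2 : normc (Dcomp (p t) i j - Dmx A i j) <= d / 2.
    by near: t; exact: Dcomp_limit.
  rewrite /mixing_error.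
  have -> : d = d / 2 + d / 2 by field.
  apply: le_trans (lerD h1 h2); apply: le_trans (normcB _ _).
  by move: (cmx _ _ _) (Dcomp _ _ _) (Dmx _ _ _) => x y z; rewrite opprB addrA subrK.
near=> t => t0 m l m0 l0.
have m1 : (0 : R) < m%:R by rewrite ltr0n.
have l1 : (0 : R) < l%:R by rewrite ltr0n.
have hE : forall m l : nat, (0 < m)%N -> (0 < l)%N ->
    normc (mixing_error (p t) t m l) <= K / (m%:R ^+ 2 * l%:R).
  by move: t0; near: t.
have hS : forall i j : 'I_M, (0 < i)%N -> (0 < j)%N -> normc (mixing_error (p t) t i j) <= d.
  move=> i j; move: i j t0; near: t.
  apply: filter_forall => i; apply: filter_forall => j; exact: small.
have {}hE := hE m l m0 l0.
rewrite absC2E; have [mlM|[mM lM]] : (M <= m * l)%N \/ (m < M)%N /\ (l < M)%N.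
- by case: (leqP M (m * l)) => h; [left|right; split; apply: leq_ltn_trans h; [exact: leq_pmulr|exact: leq_pmull]].
- apply: (@le_trans _ _ ((K / (m%:R ^+ 2 * l%:R)) ^+ 2)).
    by rewrite ler_pXn2r ?nnegrE ?normc_ge0 ?divr_ge0 ?mulr_ge0 ?exprn_ge0.
  have ML : M%:R <= m%:R * l%:R :> R by rewrite -natrM ler_nat.
  rewrite expr_div_n ler_pdivrMr ?exprn_gt0 ?mulr_gt0 ?exprn_gt0//.
  apply: (le_trans hM).
  have -> : e / m%:R ^+ 3 / l%:R * (m%:R ^+ 2 * l%:R) ^+ 2 = e * (m%:R * l%:R).
    by field; rewrite !pnatr_eq0 -!lt0n l0 m0.
  by rewrite ler_wpM2l ?(ltW e0).
- have hd := hS (Ordinal mM) (Ordinal lM) m0 l0.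
  apply: (@le_trans _ _ (d ^+ 2)).
    by rewrite ler_pXn2r ?nnegrE ?normc_ge0 ?(ltW d0).
  rewrite sqr_sqrtr ?divr_ge0 ?exprn_ge0 ?(ltW e0)//.
  rewrite -mulrA ler_wpM2l ?(ltW e0)// -invfM lef_pV2 ?posrE ?mulr_gt0 ?exprn_gt0//.
  have -> : M%:R ^+ 4 = M%:R ^+ 3 * M%:R :> R by rewrite -exprSr.
  by rewrite ler_pM ?exprn_ge0 ?lerXn2r ?nnegrE// ler_nat ltnW.
Unshelve. all: by end_near. Qed.

(** The coefficient is the pairing of the row [m] of [mixing_error] with the
    coefficients of [w], and the norm of [w] is controlled by that of [u]. *)
Lemma error_coef h g k0 t u (e : R) m : slift h g -> 0 <= k0 -> k0 <= 2^-1 -> near_id h k0 ->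
  832 * k0 <= 1 / 4 -> 0 <= e ->
  (forall m l : nat, (0 < m)%N -> (0 < l)%N -> absC2 (mixing_error h t m l) <= e / m%:R ^+ 3 / l%:R) ->
  Hplus u -> (forall N, psum true (fourier u) N <= 1) -> (0 < m)%N ->
  absC2 ((t^-1)%:C * fourier (Zop h u) (freq false m) - fourier (Dop A u) (freq false m)) <=
    4 * e / m%:R ^+ 3.
Proof.
move=> hl a0 a1 hn c1 e0 hE hu nu m0.
have q0 : 0 <= 832 * k0 := mulr_ge0 (ler0n _ _) a0.
have cube := near_id_mixing hl a0 a1 hn.
have [w [hw ew hZ eZ]] := Zop_spec hl q0 c1 cube hu.
have mix := mixing_small_le q0 (mixing_cube_small q0 cube).
have Q0 : 0 <= (832 * k0) ^+ 2 := exprn_ge0 2 q0.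
have hu' : Hsgn true u by rewrite -HplusE.
have [_ eD] := Dop_spec C0 hC hu'.
have nwh M : psum true (fourier (w \o h)) M <= 1.
  apply: le_trans (nu M); rewrite /psum big_nat_cond [leRHS]big_nat_cond le_eqVlt; apply/orP; left.
  apply/eqP; apply: eq_bigr => n; rewrite andbT => /andP[n1 _].
  by congr (_ * absC2 _); exact: ew.
have nw := comp_lower hl Q0 mix hw nwh.
have lim := mixing_error_limit t hl a0 a1 hn Q0 mix hw m0.
have eDw : fourier (Dop A u) (freq false m) = csum (fun k => Dmx A m k * fourier (w \o h) k%:Z).
  apply: (etrans (eD m m0)); rewrite /Dcoef.
  suff -> : (fun k => Dmx A m k * fourier u k%:Z) = (fun k => Dmx A m k * fourier (w \o h) k%:Z) by [].
  apply/funext => -[|k]; first by rewrite /Dmx mulr0 !mul0r.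
  by rewrite (ew k.+1 isT).
have eZw : fourier (Zop h u) (freq false m) = fourier (w \o h) (- m%:Z) by exact: (eZ m m0).
rewrite eDw eZw; move: lim; move: (_ - _) => X lim.
have m1 : (0 : R) < m%:R by rewrite ltr0n.
have E0 : 0 <= e / m%:R ^+ 3 by rewrite divr_ge0// exprn_ge0.
have B0 : 0 <= 4 * e / m%:R ^+ 3 by rewrite divr_ge0 ?exprn_ge0 ?mulr_ge0.
have bnd N : (0 <= N)%N -> normc (\sum_(1 <= l < N) mixing_error h t m l * fourier w l%:Z) <=
    Num.sqrt (4 * e / m%:R ^+ 3).
  move=> _; rewrite normcE; apply: ler_wsqrtr.
  have := sum_weighted_cauchy (fun l => fourier w l%:Z) N E0 (fun l l0 => hE m l m0 l0).
  move=> h1; apply: (le_trans h1).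
  have -> : 4 * e / m%:R ^+ 3 = 2 * (e / m%:R ^+ 3) * (2 * 1) by ring.
  by apply: ler_wpM2l; [exact: mulr_ge0|exact: nw].
have h1 := ccvg_le lim bnd; rewrite absC2E -[leRHS](sqr_sqrtr B0).
by rewrite ler_pXn2r ?nnegrE ?normc_ge0 ?sqrtr_ge0.
Qed.

Lemma sub_Hsgn_coef b (c : R[i]) (u1 u2 u3 : R -> R[i]) : Hsgn b u1 -> Hsgn b u2 -> Hsgn b u3 ->
  Hsgn b (sub_fun (scale_fun c (sub_fun u1 u2)) u3) /\
  forall n, fourier (sub_fun (scale_fun c (sub_fun u1 u2)) u3) n =
    c * (fourier u1 n - fourier u2 n) - fourier u3 n.
Proof.
move=> h1 h2 h3.
have i1 : cintegrable u1 by case: h1 => /Hhalf_cintegrable.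
have i2 : cintegrable u2 by case: h2 => /Hhalf_cintegrable.
have i3 : cintegrable u3 by case: h3 => /Hhalf_cintegrable.
have ff n : fourier (sub_fun (scale_fun c (sub_fun u1 u2)) u3) n =
    c * (fourier u1 n - fourier u2 n) - fourier u3 n.
  rewrite -(fourierB _ i1 i2) -(fourierZ _ _ (cintegrableB i1 i2)).
  exact: (fourierB _ (cintegrableZ c (cintegrableB i1 i2)) i3).
split; last exact: ff.
have [[k1 _] [[k2 _] [k3 _]]] := (h1, (h2, h3)).
apply/HsgnP; split; first exact: (HhalfB (HhalfZ c (HhalfB k1 k2)) k3).
move=> n n0; rewrite ff.
have [_ z1] := (HsgnP _ _).1 h1; have [_ z2] := (HsgnP _ _).1 h2; have [_ z3] := (HsgnP _ _).1 h3.
by rewrite (z1 n n0) (z2 n n0) (z3 n n0) subrr mulr0 subrr.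
Qed.

Lemma error_opnorm (e : R) : 0 < e -> \forall t \near (0 : R), t != 0 ->
  let T u := sub_fun (scale_fun (t^-1)%:C (sub_fun (Zop (p t) u) (Zop (p 0) u))) (Dop A u) in
  (0 <= opnorm T)%E /\ (opnorm T <= e%:E)%E.
Proof.
move=> e0; have [B B0 hB] := path_near_id sp ip sA.
have e8 : 0 < e ^+ 2 / 8 by rewrite divr_gt0// exprn_gt0.
have h832 : (0 : R) < 832 by rewrite ltr0n.
have b1 : 0 < 832 * (B + 1) := mulr_gt0 h832 (ltr_wpDl B0 ltr01).
have b0 : 0 < 1 / 4 / (832 * (B + 1)) by apply: divr_gt0 b1; rewrite divr_gt0.
have p00 : p 0 = id by case: sp.
near=> t => t0.
have [g hl] : exists g, slift (p t) g by near: t; exact: path_slift sp.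
have hn : near_id (p t) (B * `|t|) by near: t.
have tb : `|t| < 1 / 4 / (832 * (B + 1)) by near: t; exact: near0_lt.
have hE : forall m l : nat, (0 < m)%N -> (0 < l)%N ->
    absC2 (mixing_error (p t) t m l) <= e ^+ 2 / 8 / m%:R ^+ 3 / l%:R.
  by move: t0; near: t; exact: mixing_error_small.
have a0 : 0 <= B * `|t| by rewrite mulr_ge0.
have c1 : 832 * (B * `|t|) <= 1 / 4.
  have := ltW tb; rewrite (ler_pdivlMr _ _ b1).
  by have := normr_ge0 t; move: `|t| => y y0; lra.
have a1 : B * `|t| <= 2^-1 by move: a0 c1; lra.
apply: opnorm_bounds; first exact: ltW.
move=> u hu nu N.
have nu' M : psum true (fourier u) M <= 1.
  by apply: le_trans (nu M); rewrite (wsum_psum true) lerDl psum_ge0.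
have q0 : 0 <= 832 * (B * `|t|) := mulr_ge0 (ler0n _ _) a0.
have [w [_ _ hZ _]] := Zop_spec hl q0 c1 (near_id_mixing hl a0 a1 hn) hu.
have [hI eI] := Zop_id hu.
have hu' : Hsgn true u by rewrite -HplusE.
have [hD _] := Dop_spec C0 hC hu'.
have hI' : Hsgn false (Zop (p 0) u) by rewrite p00.
have [hT fT] := sub_Hsgn_coef (t^-1)%:C hZ hI' hD.
have [_ zT] := (HsgnP _ _).1 hT.
have -> : e ^+ 2 = 2 * (4 * (e ^+ 2 / 8)) by field.
apply: (@Hsgn_small_wsum _ false) => //; first by rewrite mulr_ge0// ltW.
have eI' m : (0 < m)%N -> fourier (Zop (p 0) u) (freq false m) = 0 by rewrite p00; exact: eI.
have drop (c x y z v : R[i]) : y = 0 -> v = c * (x - y) - z -> v = c * x - z.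
  by move=> -> ->; rewrite subr0.
move=> m m0; rewrite (drop _ _ _ _ _ (eI' m m0) (fT (freq false m))).
exact: (error_coef hl a0 a1 hn c1 (ltW e8) hE hu nu' m0).
Unshelve. all: by end_near. Qed.

Lemma Z_derivative_Dop : Z_derivative p (Dop A).
Proof.
have dn (P : set R) : (\forall t \near (0 : R), t != 0 -> P t) -> \forall t \near (0 : R)^', P t by [].
rewrite /Z_derivative; apply/fine_cvgP; split.
  apply: dn; apply: filterS (error_opnorm ltr01) => t h t0; have [h1 h2] := h t0.
  by rewrite fin_numElt (lt_le_trans _ h1)// (le_lt_trans h2)// ltry.
apply/cvgr0Pnorm_le => e e0; apply: dn.
apply: filterS (error_opnorm e0) => t h t0; have [h1 h2] := h t0; rewrite /=.
move: h1 h2; move: (opnorm _) => [x||]//=; rewrite !lee_fin => x0 xe.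
by rewrite ger0_norm.
Qed.

End PathDerivative.

(** * Smooth functions and paths of diffeomorphisms *)
Section Paths.
Variable R : realType.
Implicit Types (f g h a : R -> R).

(** Smoothness of finite order, for inductions on the order. *)
Fixpoint nsmooth (n : nat) f : Prop := if n is n'.+1 then
  exists f', (forall x : R, is_derive x 1 f (f' x)) /\ nsmooth n' f' else True.

Lemma nsmooth_smooth f : (forall n, nsmooth n f) -> smooth f.
Proof.
move=> hf k x; move: (hf k.+1); elim: k f {hf} x => [|k IH] f x [f' [df hf']].
  by case: (df x).
rewrite derive1Sn; have -> : derive1 f = f'.
  by apply/funext => y; rewrite derive1E; have [_ ->] := df y.
exact: IH.
Qed.

Lemma smooth_nsmooth f n k : smooth f -> nsmooth n (derive1n k f).
Proof.
move=> sf; elim: n k => [//|n IH] k; exists (derive1n k.+1 f).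
by split => [x|]; [exact: smooth_deriv|exact: IH].
Qed.

Lemma nsmoothW n f : nsmooth n.+1 f -> nsmooth n f.
Proof.
elim: n f => [//|n IH] f [f' [df hf]]; exists f'; split => //; exact: IH.
Qed.

Lemma nsmoothD n f g : nsmooth n f -> nsmooth n g -> nsmooth n (fun x => f x + g x).
Proof.
elim: n f g => [//|n IH] f g [f' [df hf]] [g' [dg hg]].
exists (fun x => f' x + g' x); split; last exact: IH.
by move=> x; have d1 := df x; have d2 := dg x; apply: is_derive_eq.
Qed.

Lemma nsmoothM n f g : nsmooth n f -> nsmooth n g -> nsmooth n (fun x => f x * g x).
Proof.
elim: n f g => [//|n IH] f g hf0 hg0.
have hf1 := nsmoothW hf0; have hg1 := nsmoothW hg0.
have [f' [df hf]] := hf0; have [g' [dg hg]] := hg0.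
exists (fun x => f' x * g x + f x * g' x); split; last by apply: nsmoothD; exact: IH.
move=> x; have d1 := df x; have d2 := dg x; apply: is_derive_eq.
by rewrite /GRing.scale /=; ring.
Qed.

Lemma nsmoothN n f : nsmooth n f -> nsmooth n (fun x => - f x).
Proof.
elim: n f => [//|n IH] f [f' [df hf]].
exists (fun x => - f' x); split; last exact: IH.
by move=> x; have d1 := df x; apply: is_derive_eq.
Qed.

Lemma nsmoothV n f : (forall x, f x != 0) -> nsmooth n f -> nsmooth n (fun x => (f x)^-1).
Proof.
move=> f0; elim: n => [//|n IH] hf0; have hf1 := nsmoothW hf0; have [f' [df hf]] := hf0.
exists (fun x => - (f' x * ((f x)^-1 * (f x)^-1))); split.
  move=> x; apply: (is_derive_eq (is_deriveV (f0 x) (df x))).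
  by rewrite -[_ *: _]/(- (f x ^- 2) * f' x) expr2 invfM; ring.
by apply: nsmoothN; apply: nsmoothM => //; apply: nsmoothM; exact: IH.
Qed.

Lemma nsmooth_comp n f g : nsmooth n f -> nsmooth n g -> nsmooth n (fun x => f (g x)).
Proof.
elim: n f g => [//|n IH] f g [f' [df hf]] hg0.
have hg1 := nsmoothW hg0; have [g' [dg hg]] := hg0.
exists (fun x => f' (g x) * g' x); split; last by apply: nsmoothM => //; exact: IH.
by move=> x; exact: (is_derive1_comp (df (g x)) (dg x)).
Qed.

(** The derivative of [g] is [(1 / h') \o g], which has as many derivatives as [g]. *)
Lemma smooth_inverse h g : smooth h -> (forall x, 0 < derive1n 1 h x) ->
  cancel h g -> cancel g h -> smooth g.
Proof.
move=> sh hp hg gh; apply: nsmooth_smooth.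
have dg (y : R) : is_derive y 1 g (derive1n 1 h (g y))^-1.
  rewrite -{1}(gh y); apply: is_derive_inverse.
  - by near=> x; exact: hg.
  - by near=> x; exact: smooth_cont.
  - exact: (smooth_deriv 0 (g y) sh).
  - exact: lt0r_neq0.
have hi n : nsmooth n (fun x => (derive1n 1 h x)^-1).
  by apply: nsmoothV; [move=> x; exact: lt0r_neq0|exact: smooth_nsmooth].
elim=> [//|n IH]; exists (fun y => (derive1n 1 h (g y))^-1); split => //.
exact: (nsmooth_comp (hi n) IH).
Unshelve. all: by end_near. Qed.

(** ** The straight path with initial field [A] *)
Section Straight.
Variable A : R -> R.
Hypothesis sA : smooth_circle A.

Definition straight (t x : R) : R := x + t * A x.

Let id_jet (j : nat) (x : R) : R := if j is j'.+1 then (j' == 0%N)%:R else x.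

Let jet (j : nat) (t x : R) : R := id_jet j x + t * derive1n j A x.

Let d_id_jet j (x : R) : is_derive x 1 (id_jet j) (id_jet j.+1 x).
Proof. by case: j => [|j]; [exact: is_derive_id|exact: is_derive_cst]. Qed.

Let d_jet j t (x : R) : is_derive x 1 (jet j t) (jet j.+1 t x).
Proof.
have [s1 _] := sA; have d1 := d_id_jet j x; have d2 := smooth_deriv j x s1.
by rewrite /jet; apply: is_derive_eq.
Qed.

(** For small [t] the derivative [1 + t A'] is positive, and [t A] is bounded, so
    that the intermediate value theorem gives surjectivity. *)
Lemma straight_diffeo : exists2 e : R, 0 < e & forall t, `|t| < e -> diffeo_lift (straight t).
Proof.
have [s1 p1] := sA.
have [B0 B00 hB0] := smooth_periodic_bounded s1 p1 0.
have [B B1 hB] := smooth_periodic_bounded s1 p1 1.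
have b1 : 0 < 2 * (B + 1) by rewrite mulr_gt0// ltr_wpDl.
exists (1 / (2 * (B + 1))); first exact: divr_gt0.
move=> t ht.
have sh : smooth (straight t) by apply: (smooth_seq (F := fun j => jet j t)) => k x; exact: d_jet.
have dE k : derive1n k (straight t) = jet k t.
  exact: (derive1n_seq (F := fun j => jet j t) (fun k x => d_jet k t x)).
have hp x : 0 < derive1n 1 (straight t) x.
  rewrite dE /jet /id_jet /=.
  have h1 : `|t * derive1n 1 A x| <= `|t| * B by exact: normM_le (lexx _) (hB x).
  have h2 : `|t| * B < 1.
    move: ht; rewrite ltr_pdivlMr//; have := normr_ge0 t; move: `|t| => y y0; nra.
  move: h1; rewrite ler_norml => /andP[h3 _]; have := le_lt_trans _ h2.
  by move: h3 h2; rewrite -[_%:R]/(1 : R); move: (`|t| * B) (t * _) => y z; lra.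
have inj x y : x < y -> straight t x < straight t y.
  move=> xy; have cs : {within `[x, y], continuous (straight t)}.
    by apply: continuous_subspaceT => z; exact: smooth_cont.
  have [c _ e] := MVT_segment (ltW xy) (fun z _ => smooth_deriv 0 z sh) cs.
  by rewrite -subr_gt0 e mulr_gt0// subr_gt0.
have surj y : exists x, straight t x = y.
  pose M := `|t| * B0.
  have M0 : 0 <= M by rewrite mulr_ge0.
  have hM x : `|t * A x| <= M by exact: normM_le (lexx _) (hB0 x).
  have yM : y - M <= y + M by lra.
  have cs : {within `[y - M, y + M], continuous (straight t)}.
    by apply: continuous_subspaceT => z; exact: smooth_cont.
  have h1 : straight t (y - M) <= y.
    by have := hM (y - M); rewrite ler_norml /straight => /andP[_]; move: (t * _) => z; lra.
  have h2 : y <= straight t (y + M).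
    by have := hM (y + M); rewrite ler_norml /straight => /andP[+ _]; move: (t * _) => z; lra.
  have hv : Num.min (straight t (y - M)) (straight t (y + M)) <= y <=
      Num.max (straight t (y - M)) (straight t (y + M)).
    by rewrite ge_min le_max h1 h2 orbT.
  by have [c _ e] := IVT yM cs hv; exists c.
have [g gh] := choice surj.
have hg : cancel (straight t) g.
  move=> x; have := gh (straight t x); case: (ltgtP (g (straight t x)) x) => // /inj; lra.
split => //; first by move=> x; rewrite /straight p1; ring.
by exists g; split => //; exact: smooth_inverse hp hg gh.
Qed.

Lemma straight_smooth_path : smooth_path straight.
Proof.
have [s1 p1] := sA.
split; first by apply/funext => x; rewrite /straight mul0r addr0.
have [e e0 he] := straight_diffeo; exists e => //; split => //.
pose G (i j : nat) (t x : R) : R :=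
  match i with 0%N => jet j t x | 1%N => derive1n j A x | _ => 0 end.
exists G; split; first by apply/funext => t; apply/funext => x.
have cA j (z : R * R) : {for z, continuous (fun z : R * R => derive1n j A z.2)}.
  apply: (@continuous_comp _ _ _ snd (derive1n j A)); first exact: cvg_snd.
  exact: (smooth_continuous s1).
move=> i j t x _; split.
- case: i => [|[|i]]; rewrite /G; [|exact: cA|exact: cvg_cst].
  rewrite /jet; apply: cvgD; last by apply: cvgM; [exact: cvg_fst|exact: cA].
  by case: j => [|j]; [exact: cvg_snd|exact: cvg_cst].
- case: i => [|[|i]]; rewrite /G; [|exact: is_derive_cst|exact: is_derive_cst].
  suff : is_derive (t : R) 1 (fun s : R => id_jet j x + s * derive1n j A x) (derive1n j A x) by [].
  by apply: is_derive_eq; rewrite /GRing.scale /=; ring.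
- case: i => [|[|i]]; rewrite /G; [exact: d_jet|exact: smooth_deriv|exact: is_derive_cst].
Qed.

Lemma straight_initial_field : initial_field straight A.
Proof.
move=> k e e0; near=> t => x.
have -> : (fun y => straight t y - y - t * A y) = fun=> 0.
  by apply/funext => y; rewrite /straight; ring.
have -> : derive1n k (fun=> 0 : R) = fun=> 0.
  apply: (derive1n_seq (F := fun _ _ => 0)) => j y; exact: is_derive_cst.
by rewrite normr0 mulr_ge0// ltW.
Unshelve. all: by end_near. Qed.

End Straight.
End Paths.

(** * Uniqueness of the derivative *)
Section UniqueDerivative.
Variable R : realType.
Implicit Types (u v : R -> R[i]) (D : (R -> R[i]) -> (R -> R[i])).

(** When there is no projection the chosen value is the zero function. *)
Lemma orth_proj_Hsgn b u : Hsgn b (orth_proj (Hsgn b) u).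
Proof.
have hz : Hsgn b (@zero_fun R).
  have := Hplus_zero R; rewrite HplusE => -[h1 _]; apply/HsgnP; split => // n _.
  exact: fourier_zero.
rewrite /orth_proj; set S := (X in xget _ X).
have [[v hv]|no] := pselect (exists v, S v).
  by have [] : S (xget (@zero_fun R) S) by apply: xgetPex; exists v.
by rewrite xgetPN// => v hv; apply: no; exists v.
Qed.

Lemma Z_derivative_near (p : R -> R -> R) D (e : R) : Z_derivative p D -> 0 < e ->
  \forall t \near (0 : R)^', (opnorm (fun u => sub_fun (scale_fun (t^-1)%:C
     (sub_fun (Zop (p t) u) (Zop (p 0%R) u))) (D u)) <= e%:E)%E.
Proof.
move=> /fine_cvgP[h1 /cvgr0Pnorm_le h2] e0.
apply: filterS2 h1 (h2 _ e0) => t f; rewrite /= => g.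
by rewrite -(fineK f) lee_fin; exact: le_trans (ler_norm _) g.
Qed.

Lemma wsum_coef v (e : R) (n : nat) : 0 <= e -> (0 < n)%N ->
  (forall N, wsum (fourier v) N <= e ^+ 2) -> normc (fourier v (freq false n)) <= e.
Proof.
move=> e0 n0 h; rewrite -(@ler_pXn2r _ 2) ?nnegrE ?normc_ge0// -absC2E.
apply: le_trans (h n.+1); apply: le_trans (wsum_single _ false n0).
by rewrite ler_peMl ?absC2_ge0// ler1n.
Qed.

(** Both operators are limits of the same difference quotients. *)
Lemma Z_derivative_coef (p : R -> R -> R) D1 D2 u (n : nat) :
  Z_derivative p D1 -> Z_derivative p D2 -> Hplus u -> (normH u <= 1)%E ->
  Hsgn false (D1 u) -> Hsgn false (D2 u) -> (0 < n)%N ->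
  fourier (D1 u) (freq false n) = fourier (D2 u) (freq false n).
Proof.
move=> z1 z2 hu nu h1 h2 n0; apply/eqP; rewrite -subr_eq0; apply/eqP.
apply: normc_eq0P; apply/ler_addgt0Pr => e e0; rewrite add0r.
have e2 : 0 < e / 2 by rewrite divr_gt0.
have [t [k1 k2]] := filter_ex (filterI (Z_derivative_near z1 e2) (Z_derivative_near z2 e2)).
have hZ t' : Hsgn false (Zop (p t') u).
  by rewrite /Zop /Bop /Pminus HminusE; exact: orth_proj_Hsgn.
pose X (D : (R -> R[i]) -> (R -> R[i])) := sub_fun (scale_fun (t^-1)%:C (sub_fun (Zop (p t) u) (Zop (p 0) u))) (D u).
have bnd (D : (R -> R[i]) -> (R -> R[i])) : (opnorm (fun u => sub_fun (scale_fun (t^-1)%:C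
     (sub_fun (Zop (p t) u) (Zop (p 0%R) u))) (D u)) <= (e / 2)%:E)%E ->
    normc (fourier (X D) (freq false n)) <= e / 2.
  move=> hD; apply: wsum_coef => //; first exact: ltW.
  apply/(normH_le _ (ltW e2)); apply: le_trans hD; apply: ereal_sup_ubound.
  by exists u.
have [_ f1] := sub_Hsgn_coef (t^-1)%:C (hZ t) (hZ 0) h1.
have [_ f2] := sub_Hsgn_coef (t^-1)%:C (hZ t) (hZ 0) h2.
have := bnd _ k2; have := bnd _ k1.
have sub3 (x a b y z : R[i]) : y = x - a -> z = x - b -> a - b = z - y.
  by move=> -> ->; ring.
move=> b1 b2; rewrite (sub3 _ _ _ _ _ (f1 (freq false n)) (f2 (freq false n))).
apply: (le_trans (normcB _ _)); have -> : e = e / 2 + e / 2 by field.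
exact: lerD b2 b1.
Qed.

(** Homogeneity extends the comparison from the unit ball to the whole space. *)
Lemma bounded_op_coef D1 D2 u (n : nat) : bounded_plus_minus D1 -> bounded_plus_minus D2 ->
  (forall v, Hplus v -> (normH v <= 1)%E ->
    fourier (D1 v) (freq false n) = fourier (D2 v) (freq false n)) ->
  Hplus u -> (0 < n)%N -> fourier (D1 u) (freq false n) = fourier (D2 u) (freq false n).
Proof.
move=> b1 b2 unit hu n0.
have hu' : Hsgn true u by rewrite -HplusE.
have [/HhalfP[_ [K hK]] _] := hu'.
have K0 : 0 <= K by exact: le_trans (wsum_ge0 _ 0) (hK 0%N).
pose c := (1 + K)^-1; have c0 : 0 < c by rewrite invr_gt0 ltr_wpDr.
pose z := @zero_fun R; have hz : Hplus z := Hplus_zero R.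
have hz' : Hsgn true z by rewrite -HplusE.
pose v := add_fun (scale_fun c%:C u) z.
have iu : cintegrable u by case: hu' => /Hhalf_cintegrable.
have iz : cintegrable z by case: hz' => /Hhalf_cintegrable.
have hv : Hplus v by rewrite HplusE; exact: Hsgn_lin.
have fv k : fourier v k = c%:C * fourier u k.
  by apply: (etrans (fourier_lin c%:C k iu iz)); rewrite fourier_zero addr0.
have nz : (normH z <= 1)%E.
  apply/(normH_le _ ler01) => N; rewrite expr1n /wsum big1// => k _.
  by rewrite !fourier_zero absC2_0 addr0 mulr0.
have nv : (normH v <= 1)%E.
  apply/(normH_le _ ler01) => N; rewrite (wsum_ext _ (fun k _ => fv k)) wsumZ.
  rewrite absC2E normc_real (gtr0_norm c0) expr1n.
  apply: (@le_trans _ _ (c ^+ 2 * K)); first by rewrite ler_wpM2l ?exprn_ge0 ?(ltW c0).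
  have K1 : 0 < 1 + K by rewrite ltr_wpDr.
  by rewrite /c exprVn mulrC ler_pdivrMr ?exprn_gt0// mul1r expr2; nra.
have lin D : bounded_plus_minus D ->
    fourier (D v) (freq false n) = c%:C * fourier (D u) (freq false n) + fourier (D z) (freq false n).
  move=> [dm _ dl _].
  have [m1 m2 m3] : [/\ Hsgn false (D v), Hsgn false (D u) & Hsgn false (D z)].
    by split; rewrite -HminusE; exact: dm.
  have [j1 j2 j3] : [/\ cintegrable (D v), cintegrable (D u) & cintegrable (D z)].
    by split; [case: m1|case: m2|case: m3] => /Hhalf_cintegrable.
  have mz : freq false n != 0 by rewrite /=; lia.
  have ic : cintegrable (add_fun (scale_fun c%:C (D u)) (D z)).
    exact: cintegrableD (cintegrableZ _ j2) j3.
  apply: (etrans (eqH_fourier j1 ic (dl c%:C u z hu hz) mz)).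
  exact: fourier_lin.
have ev := unit v hv nv; have ez := unit z hz nz.
have cancel (k a1 a2 y1 y2 x1 x2 : R[i]) : k != 0 -> x1 = k * a1 + y1 -> x2 = k * a2 + y2 ->
    x1 = x2 -> y1 = y2 -> a1 = a2.
  move=> k0 e1 e2 e3 e4; apply: (mulfI k0); apply: (addIr y1).
  by rewrite -e1 e3 e2 e4.
have k0 : c%:C != 0 :> R[i] by rewrite eq_complex /= eqxx andbT gt_eqF.
exact: cancel k0 (lin D1 b1) (lin D2 b2) ev ez.
Qed.

Lemma is_Zdot_Dop (A : R -> R) : smooth_circle A -> is_Zdot A (Dop A).
Proof.
move=> sA; have [C C0 hC] := Dmx_decay sA; split; first exact: Dop_bounded C0 hC.
by move=> p sp ip; exact: (Z_derivative_Dop sp ip sA C0 hC).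
Qed.

(** The straight path exists for every [A], so the derivative along it determines
    the operator. *)
Lemma is_Zdot_coef (A : R -> R) D u (n : nat) : smooth_circle A -> is_Zdot A D ->
  Hplus u -> (0 < n)%N -> fourier (D u) (freq false n) = Dcoef A u n.
Proof.
move=> sA [bD zD] hu n0; have [bO zO] := is_Zdot_Dop sA.
have [C C0 hC] := Dmx_decay sA.
have hu' : Hsgn true u by rewrite -HplusE.
have [_ eO] := Dop_spec C0 hC hu'; apply: (etrans _ (eO n n0)).
have sp := straight_smooth_path sA; have ip := @straight_initial_field R A.
apply: (bounded_op_coef bD bO _ hu n0) => v hv nv.
have h1 : Hsgn false (D v) by rewrite -HminusE; case: bD => h _ _ _; exact: h.
have h2 : Hsgn false (Dop A v) by rewrite -HminusE; case: bO => h _ _ _; exact: h.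
exact: (Z_derivative_coef (zD _ sp ip) (zO _ sp ip) hv nv h1 h2 n0).
Qed.

End UniqueDerivative.

(** * Infinitesimal Moebius transformations *)
Section Moebius.
Variable R : realType.
Implicit Types (A : R -> R).

(** The characters detect the entries of the matrix. *)
Lemma eq_op_zero_Dmx A D : smooth_circle A -> is_Zdot A D ->
  eq_op_plus D op_zero <-> forall m k : nat, (0 < m)%N -> (0 < k)%N -> Dmx A m k = 0.
Proof.
move=> sA zD; have [bD _] := zD; have [bm _ _ _] := bD; split.
  move=> h m k m0 k0.
  have hk : Hplus (chi (freq true k) : R -> R[i]) by rewrite HplusE; exact: Hsgn_chi.
  have hm := bm _ hk; rewrite HminusE in hm.
  have i1 : cintegrable (D (chi (freq true k))) by case: hm => /Hhalf_cintegrable.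
  have mz : freq false m != 0 by rewrite /=; lia.
  have e1 := eqH_fourier i1 (@cintegrable0 R) (h _ hk) mz.
  have e2 := is_Zdot_coef sA zD hk m0.
  have <- : Dcoef A (chi (freq true k)) m = Dmx A m k.
    apply: csum_unique => r r0; exists k.+1 => N kN.
    rewrite (bigD1_seq k) ?mem_index_iota ?iota_uniq ?k0 ?kN//=.
    rewrite fourier_chi eqxx mulr1 big1 ?addr0 ?subrr ?Normc.normc0 ?(ltW r0)//.
    move=> j jk; rewrite fourier_chi; suff -> : (k%:Z == j%:Z :> int) = false by rewrite mulr0.
    by apply/negP => /eqP[kj]; rewrite kj eqxx in jk.
  by rewrite -e2 e1; exact: fourier_zero.
move=> h u hu; have hm := bm _ hu; rewrite HminusE in hm.
have hz : Hsgn false (@zero_fun R).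
  have := Hplus_zero R; rewrite HplusE => -[h1 _]; apply/HsgnP; split => // n _.
  exact: fourier_zero.
apply: (Hsgn_eqH hm hz) => n n0.
apply: (etrans (is_Zdot_coef sA zD hu n0)); apply: (etrans _ (esym (fourier_zero _ _))).
apply: csum_unique; apply: ccvg_ext (ccvg_cst _) => N; rewrite big_nat_cond big1// => k.
by rewrite andbT => /andP[k1 _]; rewrite h// mul0r.
Qed.

(** The sums [m + k] with [m, k >= 1] are the integers [N >= 2]. *)
Lemma Dmx_zero A : (forall m k : nat, (0 < m)%N -> (0 < k)%N -> Dmx A m k = 0) <->
  forall N : nat, (2 <= N)%N -> fourier (fun x => (A x)%:C) (- N%:Z) = 0.
Proof.
split=> [h N N2|h m k m0 k0]; last by rewrite /Dmx h ?mulr0// (@leq_add 1 1).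
have N1 : (0 < N.-1)%N by lia.
have /eqP := h 1%N N.-1 isT N1; rewrite /Dmx.
have -> : (1 + N.-1)%N = N by lia.
move: (fourier _ _) => z; rewrite !mulf_eq0 pnatr_eq0 eqn0Ngt N1 orbF eq_complex /= oner_eq0 andbF /=.
by move/eqP.
Qed.

Lemma inf_moebius_smooth A : inf_moebius A -> smooth_circle A.
Proof.
move=> [a [b [c hA]]].
(* Differentiation acts on the coefficients of [cos] and [sin] by [T]. *)
pose T (z : R * R) := (z.2, - z.1).
pose F (k : nat) (x : R) : R := (if k is 0%N then a else 0) +
  (iter k T (b, c)).1 * cos x + (iter k T (b, c)).2 * sin x.
have FA : F 0%N = A by apply/funext => x; rewrite hA.
split; last by move=> x; have := expi_periodic x 1; rewrite mul1r !hA => -[-> ->].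
rewrite -FA; apply: smooth_seq => k x; rewrite /F iterS /T /=.
move: (iter k _ _).1 (iter k _ _).2 => y z.
have d0 : is_derive x 1 (fun _ : R => if k is 0%N then a else 0) 0 by exact: is_derive_cst.
by apply: is_derive_eq; rewrite /GRing.scale /=; ring.
Qed.

(** [A] is real, so its coefficients at [N] and [- N] are conjugate: those that
    remain are at -1, 0 and 1. *)
Lemma fourier_inf_moebius A : smooth_circle A ->
  (forall N : nat, (2 <= N)%N -> fourier (fun x => (A x)%:C) (- N%:Z) = 0) <-> inf_moebius A.
Proof.
move=> sA; have [s1 p1] := sA; split; last first.
  move=> [a [b [c hA]]] N N2.
  pose z1 : R[i] := (b / 2) +i* (- (c / 2)); pose z2 : R[i] := (b / 2) +i* (c / 2).
  have -> : (fun x => (A x)%:C) =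
      (fun x => (a%:C * chi 0 x + z1 * chi 1 x) + z2 * chi (- 1) x).
    apply/funext => x; rewrite chi0 mulr1 hA /chi mulN1r !mul1r.
    by rewrite /expi cosN sinN; apply: complex_ext; rewrite /z1 /z2 /=; field.
  have i0 k : cintegrable (@chi R k) := ccont_cintegrable (@ccont_chi R k).
  have iz (w : R[i]) k : cintegrable (fun x => w * chi k x) := cintegrableZ w (i0 k).
  have i12 : cintegrable (fun x => a%:C * chi 0 x + z1 * chi 1 x) := cintegrableD (iz _ _) (iz _ _).
  rewrite (fourierD _ i12 (iz z2 (- 1))) (fourierD _ (iz a%:C 0) (iz z1 1)).
  rewrite (fourierZ _ _ (i0 0)) (fourierZ _ _ (i0 1)) (fourierZ _ _ (i0 (- 1))) !fourier_chi.
  have -> : (0 == - N%:Z :> int) = false by lia.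
  have -> : (1 == - N%:Z :> int) = false by lia.
  have -> : (- 1 == - N%:Z :> int) = false by lia.
  by rewrite !mulr0 !addr0.
move=> h; pose Ac x : R[i] := (A x)%:C.
have cA : ccont Ac by apply: ccont_real; exact: smooth_cont.
have iA := ccont_cintegrable cA.
have us : uniform_series Ac (fourier Ac).
  by apply: is_C2_uniform_series; [exact: is_C2_real|move=> x; rewrite /Ac p1].
have {}h N : (2 <= N)%N -> fourier Ac (- N%:Z) = 0 by exact: h.
have hpos N : (2 <= N)%N -> fourier Ac N%:Z = 0.
  move=> N2; have := fourier_conj (- N%:Z) iA.
  have -> : (fun x => conjc (Ac x)) = Ac by apply/funext => x; rewrite /Ac conjc_real.
  by rewrite opprK h// => /(congr1 conjc); rewrite conjcK conjc0.
have fin N x : (2 <= N)%N -> fsum (fourier Ac) N x = fsum (fourier Ac) 2 x.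
  move=> N2; rewrite /fsum /symsum; congr (_ + _).
  rewrite (@big_cat_nat _ _ _ 2 1 N)//= [X in _ + X]big_nat_cond [X in _ + X]big1 ?addr0// => n.
  by rewrite andbT => /andP[n2 _]; rewrite hpos// h// !mul0r addr0.
have AE x : Ac x = fsum (fourier Ac) 2 x.
  apply/eqP; rewrite -subr_eq0; apply/eqP; apply: normc_eq0P.
  apply/ler_addgt0Pr => e e0; rewrite add0r; have [N0 hN] := us e e0.
  by rewrite -(fin (maxn 2 N0) x) ?leq_maxl//; apply: hN; exact: leq_maxr.
pose z0 := fourier Ac 0; pose z1 := fourier Ac 1; pose z2 := fourier Ac (- 1).
exists (Re_ z0), (Re_ z1 + Re_ z2), (Im_ z2 - Im_ z1) => x.
have := congr1 (@Re_ R) (AE x); rewrite /fsum /symsum big_nat1 -/z0 -/z1 -/z2.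
rewrite chi0 mulr1 !Re_D !Re_M /chi mulN1r mul1r /expi cosN sinN /=.
by move=> ->; ring.
Qed.

End Moebius.

Theorem corollary4p6 (R : realType) :
  (forall A : R -> R, smooth_circle A ->
     is_Zdot A (Zdot A) /\
     (eq_op_plus (Zdot A) op_zero <-> inf_moebius A)) /\
  [set A : R -> R | smooth_circle A /\ eq_op_plus (Zdot A) op_zero] =
    @inf_moebius R.
Proof.
have main (A : R -> R) : smooth_circle A -> is_Zdot A (Zdot A) /\
    (eq_op_plus (Zdot A) op_zero <-> inf_moebius A).
  move=> sA; have zA : is_Zdot A (Zdot A).
    have : [set D | is_Zdot A D] (Zdot A) by apply: xgetPex; exists (Dop A); exact: is_Zdot_Dop.
    by [].
  split => //; have h1 := eq_op_zero_Dmx sA zA; have h2 := Dmx_zero A.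
  have h3 := fourier_inf_moebius sA.
  by split=> h; [apply/h3/h2/h1|apply/h1/h2/h3].
split; first exact: main.
apply/seteqP; split => A.
  by move=> [sA h]; have [_ e] := main A sA; exact/e.
move=> mA; have sA := inf_moebius_smooth mA; split => //.
by have [_ e] := main A sA; exact/e.
Qed.
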